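(* Let $(A_1,A_2),(B_1,B_2)\in\mathbb{H}$ and $\phi_A,\phi_B\in\mathbb{R}$ be given. For $s_*\in\mathbb{R}$, $k\in(0,1)$ let $\kappa,\mu,W_1,W_2,\vartheta$ be as in the context, and let $\gamma$ be the orbitlike elastica $$\gamma_1=\frac{b_1W_1+b_2W_2+b_3}{a_1W_1+a_2W_2+a_3},\qquad \gamma_2=\frac{1}{\kappa(a_1W_1+a_2W_2+a_3)}$$ with curvature function $\kappa$, where $a_1,\ldots,b_3\in\mathbb{R}$ satisfy $a_3=\sqrt{a_1^2+a_2^2}>0$ and $(b_1,b_2)=\frac{b_3}{a_3}(a_1,a_2)+\frac{1}{\sqrt\mu a_3}(-a_2,a_1)$. Let $L>0$. Then $\gamma$ solves the Dirichlet problem $$\gamma(0)=(A_1,A_2),\quad \gamma(L)=(B_1,B_2),\quad e^{i\phi(0)}=e^{i\phi_A},\quad e^{i\phi(L)}=e^{i\phi_B}$$ ($\phi$ being the angle function of $\gamma$) if and only if there is an $l\in\mathbb{Z}$ such that \begin{align*} a_3&=\frac{2\kappa(0)+2\kappa'(0)\sin(\phi_A)-\kappa(0)^2\cos(\phi_A)}{2\mu A_2},\\ b_3&=a_3A_1-\frac{\kappa(0)^2\sin(\phi_A)+2\kappa'(0)\cos(\phi_A)}{2\mu},\\ a_1+ia_2&=a_3\,\frac{\sigma_2+i\sigma_1}{\sqrt{\sigma_1^2+\sigma_2^2}}\,e^{i\vartheta(0)},\\ b_1+ib_2&=\Big(\frac{b_3}{a_3}+\frac{i}{\sqrt\mu a_3}\Big)(a_1+ia_2),\\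 L&=-s_*+\sqrt{2-k^2}\Big(2lK(k)-\sigma\,\mathrm{dn}^{-1}\Big(\frac{\sqrt{2-k^2}}{2}\cdot\frac{1+\mu(B_2^2a_3^2+(a_3B_1-b_3)^2)}{2B_2a_3},k\Big)\Big) \end{align*} where $$\sigma:=\operatorname{sign}\Big(\mu(a_3B_1-b_3)\cos(\phi_B)-\frac{1+\mu(-a_3^2B_2^2+(a_3B_1-b_3)^2)}{2B_2a_3}\sin(\phi_B)\Big),$$ and $s_*,k$ satisfy the equations \begin{align*} \Big(\frac{1+\mu(B_2^2a_3^2+(a_3B_1-b_3)^2)}{2B_2a_3}\Big)^2&=2\mu(a_3B_1-b_3)\sin(\phi_B)+\frac{1+\mu(-B_2^2a_3^2+(a_3B_1-b_3)^2)}{B_2a_3}\cos(\phi_B),\\ e^{i(\vartheta(L)-\vartheta(0))}&=\frac{(\sigma_1-i\sigma_2)(\sigma_3+i\sigma_4)}{\sqrt{(\sigma_1^2+\sigma_2^2)(\sigma_3^2+\sigma_4^2)}}. \end{align*}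
   Context: Let $\mathbb{H}=\{(x_1,x_2)\in\mathbb{R}^2: x_2>0\}$ be the hyperbolic plane. A smooth curve $\gamma=(\gamma_1,\gamma_2)$ in $\mathbb{H}$ is parametrized by hyperbolic arclength if $(\gamma_1')^2+(\gamma_2')^2=\gamma_2^2$; its angle function $\phi$ (unique up to $2\pi\mathbb{Z}$) is the smooth function with $\gamma_1'=\gamma_2\cos\phi$, $\gamma_2'=\gamma_2\sin\phi$, and its hyperbolic curvature function is $\phi'+\cos\phi$. For $k\in(0,1)$, $s_*\in\mathbb{R}$ put $$\kappa(s)=\frac{2}{\sqrt{2-k^2}}\,\mathrm{dn}\Big(\frac{s+s_*}{\sqrt{2-k^2}},k\Big),\qquad \mu=\frac{4(1-k^2)}{(2-k^2)^2}.$$ An orbitlike elastica (positively oriented, for these $k,s_*$) is a curve $\gamma:\mathbb{R}\to\mathbb{H}$ parametrized by hyperbolic arclength with hyperbolic curvature function $\kappa$; the formulas for $\gamma_1,\gamma_2$ in the claim, with coefficients subject to the stated relations, describe exactly these curves. $\mathrm{dn}(\cdot,k)$ is Jacobi's elliptic function with modulus $k$, and $\mathrm{dn}^{-1}(\cdot,k):[\sqrt{1-k^2},1]\to[0,K(k)]$ denotes the inverse of $\mathrm{dn}(\cdot,k):[0,K(k)]\to[\sqrt{1-k^2},1]$ (the condition on $L$ includes that its argument lies in this interval). The sign function is understood with values in $\{\pm1\}$, $\operatorname{sign}(0):=1$. Shorthand notation: $$\sigma_1=\tfrac12\big(1-\mu(a_3^2A_2^2+(a_3A_1-b_3)^2)\big),\quad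 \sigma_2=\sqrt\mu(A_1a_3-b_3),\quad \sigma_3=\tfrac12\big(1-\mu(a_3^2B_2^2+(a_3B_1-b_3)^2)\big),\quad \sigma_4=\sqrt\mu(B_1a_3-b_3).$$ Definition of $W_1,W_2$. Let $F(l,k)=\int_0^l\frac{dt}{\sqrt{1-t^2}\sqrt{1-k^2t^2}}$, $K(k)=F(1,k)$, $k'=\sqrt{1-k^2}$, $q_k=\exp(-\pi K(k')/K(k))$. For $z\in\mathbb{C}$ let $$\Theta(z,k)=1+2\sum_{n\ge1}(-1)^nq_k^{n^2}\cos\Big(\frac{n\pi z}{K(k)}\Big),\quad H(z,k)=2\sum_{n\ge0}(-1)^nq_k^{(n+1/2)^2}\sin\Big(\frac{(2n+1)\pi z}{2K(k)}\Big),\quad \zeta(z,k)=\frac{\partial_z\Theta(z,k)}{\Theta(z,k)}.$$ With $\alpha_k=F(k',k')$ set $w_+(s)=\frac{H(s-i\alpha_k,k)}{\Theta(s,k)}e^{s\zeta(i\alpha_k,k)}$ and define real functions $w_1,w_2$ by $w_1(s)+iw_2(s)=\frac{\sqrt{1-k^2}}{\operatorname{Im}(w_+(0))}w_+(s)$; they form a fundamental system of $w''+2\,\mathrm{dn}^2(\cdot,k)w=0$. Finally $W_j(s)=\frac{1}{\sqrt{2-k^2}}w_j\big(-K(k)+\frac{s+s_*}{\sqrt{2-k^2}}\big)$ for $j=1,2$. The function $\vartheta:\mathbb{R}\to\mathbb{R}$ is the continuous function with $W_2(s)-iW_1(s)=\frac{\sqrt{\kappa(s)^2-\mu}}{\kappa(s)}e^{i\vartheta(s)}$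 and $-2\pi<\vartheta(-s_* )\le0$. *)

(* Defs.v *)
(* Stdlib reals with Coquelicot. *)
From Stdlib Require Export Reals.
From Coquelicot Require Export Coquelicot.
Open Scope R_scope.

Definition Cexp (z : C) : C :=
  (exp (Re z) * cos (Im z), exp (Re z) * sin (Im z)).

Definition Ccos (z : C) : C :=
  ((Cexp (Ci * z) + Cexp (- (Ci * z))) / RtoC 2)%C.

Definition Csin (z : C) : C :=
  ((Cexp (Ci * z) - Cexp (- (Ci * z))) / (RtoC 2 * Ci))%C.

(* [Series] exists for real terms only. *)
Definition CSeries (a : nat -> C) : C :=
  (Series (fun n => Re (a n)), Series (fun n => Im (a n))).

Definition smooth (f : R -> R) : Prop := forall n x, ex_derive_n f n x.

(* Takes the value 1 at 0, unlike [sign]. *)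
Definition sign1 (x : R) : R := if Rle_dec 0 x then 1 else -1.

(* Moduli k are meant in (0,1) throughout.  The integral is improper at its
   upper end, so that l = 1 is allowed; meant for 0 < l <= 1. *)
Definition ellF (l k : R) : R :=
  RInt_gen (fun t => / (sqrt (1 - t ^ 2) * sqrt (1 - k ^ 2 * t ^ 2)))
    (at_point 0) (at_left l).

Definition ellK (k : R) : R := ellF 1 k.

(* Jacobi's amplitude: the inverse of x |-> int_0^x dt / sqrt (1 - k^2 sin^2 t),
   which is an increasing bijection of R; [iota] picks the unique solution. *)
Definition am (u k : R) : R :=
  iota (fun x : R => RInt (fun t => / sqrt (1 - k ^ 2 * sin t ^ 2)) 0 x = u).

Definition dn (u k : R) : R := sqrt (1 - k ^ 2 * sin (am u k) ^ 2).

(* The inverse of dn(.,k) : [0,K(k)] -> [sqrt (1-k^2),1]; meaningful only for y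
   in the latter interval. *)
Definition dn_inv (y k : R) : R :=
  iota (fun u : R => 0 <= u <= ellK k /\ dn u k = y).

Definition compl (k : R) : R := sqrt (1 - k ^ 2).

Definition nome (k : R) : R := exp (- PI * ellK (compl k) / ellK k).

Definition Theta (z : C) (k : R) : C :=
  (RtoC 1 + RtoC 2 * CSeries (fun m => let n := S m in
     RtoC ((-1) ^ n * nome k ^ (n * n)) *
     Ccos (RtoC (INR n * PI) * z / RtoC (ellK k))))%C.

Definition Eta (z : C) (k : R) : C :=
  (RtoC 2 * CSeries (fun n =>
     RtoC ((-1) ^ n * Rpower (nome k) ((INR n + 1 / 2) ^ 2)) *
     Csin (RtoC ((2 * INR n + 1) * PI) * z / RtoC (2 * ellK k))))%C.

Definition zeta (z : C) (k : R) : C :=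
  (C_derive (fun y => Theta y k) z / Theta z k)%C.

Definition alpha (k : R) : R := ellF (compl k) (compl k).

Definition w_plus (k s : R) : C :=
  (Eta (RtoC s - Ci * RtoC (alpha k)) k / Theta (RtoC s) k *
   Cexp (RtoC s * zeta (Ci * RtoC (alpha k)) k))%C.

Definition w12 (k s : R) : C :=
  (RtoC (sqrt (1 - k ^ 2) / Im (w_plus k 0)) * w_plus k s)%C.

Definition w1 (k s : R) : R := Re (w12 k s).
Definition w2 (k s : R) : R := Im (w12 k s).

Definition W1 (k sstar s : R) : R :=
  / sqrt (2 - k ^ 2) * w1 k (- ellK k + (s + sstar) / sqrt (2 - k ^ 2)).
Definition W2 (k sstar s : R) : R :=
  / sqrt (2 - k ^ 2) * w2 k (- ellK k + (s + sstar) / sqrt (2 - k ^ 2)).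

Definition kappa (k sstar s : R) : R :=
  2 / sqrt (2 - k ^ 2) * dn ((s + sstar) / sqrt (2 - k ^ 2)) k.

Definition mu (k : R) : R := 4 * (1 - k ^ 2) / (2 - k ^ 2) ^ 2.

Definition is_vartheta (k sstar : R) (vartheta : R -> R) : Prop :=
  (forall s, continuous vartheta s) /\
  (forall s,
     (RtoC (W2 k sstar s) - Ci * RtoC (W1 k sstar s))%C =
     (RtoC (sqrt (kappa k sstar s ^ 2 - mu k) / kappa k sstar s) *
      Cexp (Ci * RtoC (vartheta s)))%C) /\
  - (2 * PI) < vartheta (- sstar) <= 0.

Definition elastica1 (k sstar a1 a2 a3 b1 b2 b3 s : R) : R :=
  (b1 * W1 k sstar s + b2 * W2 k sstar s + b3) /
  (a1 * W1 k sstar s + a2 * W2 k sstar s + a3).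

Definition elastica2 (k sstar a1 a2 a3 s : R) : R :=
  1 / (kappa k sstar s * (a1 * W1 k sstar s + a2 * W2 k sstar s + a3)).

(* The two equations imply that the curve (g1,g2) is parametrized by hyperbolic
   arclength. *)
Definition is_angle_function (g1 g2 phi : R -> R) : Prop :=
  smooth phi /\
  forall s, is_derive g1 s (g2 s * cos (phi s)) /\
            is_derive g2 s (g2 s * sin (phi s)).

(* The angle function is unique up to a multiple of 2 pi, hence [exists]. *)
Definition solves_dirichlet (A1 A2 B1 B2 phiA phiB L : R) (g1 g2 : R -> R)
  : Prop :=
  exists phi : R -> R,
    is_angle_function g1 g2 phi /\
    (g1 0 = A1 /\ g2 0 = A2) /\
    (g1 L = B1 /\ g2 L = B2) /\
    Cexp (Ci * RtoC (phi 0)) = Cexp (Ci * RtoC phiA) /\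
    Cexp (Ci * RtoC (phi L)) = Cexp (Ci * RtoC phiB).

(* Main.v *)
Require Import Defs.
From Stdlib Require Import Reals ZArith Lia Lra Psatz.
From Coquelicot Require Import Coquelicot.
Open Scope R_scope.

(* For a3 = 1, b3 = 0 the curve is x = V / (sqrt mu (1 + U)), y = 1 / (kappa (1 + U)),
   where (U, V) is (W1, W2) rotated by the direction of (a1, a2).  Everything
   about it follows from U^2 + V^2 = 1 - mu / kappa^2, which is part of the
   definition of vartheta, and from the value sqrt mu / 2 of the Wronskian of
   W1, W2.  With P = mu x and Q = kappa - mu y one gets
   Q + i P = (kappa^2 / 2 + i kappa') e^(i phi), and conversely kappa together
   with the direction of sigma_2 + i sigma_1 determines the point (x, y).

   The Wronskian is the angular velocity of w_+, a logarithmic derivative of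
   theta functions.  By the Cauchy-Riemann equations and the addition theorem for
   H(x + y) H(x - y) it equals half the logarithmic derivative at i alpha of
   f = H^2 / Theta^2.  Theta identities give f'^2 = f q(f) in the whole complex
   plane for some quadratic q.  On the real axis the known modulus of w_+ expresses
   f by dn and so determines q, without using that dn is a quotient of theta
   functions.  On the imaginary axis the equation then gives the square of the
   derivative at i alpha; its sign follows because - f increases from 0 and
   reaches its first pole only after alpha. *)

(** * Sums over the integers *)

(** Zeros of the theta functions are never located. Division by zero yields 0, so a zero of [Theta]
    on the real axis, or [Im (w_plus k 0) = 0], would make [w12] vanish somewhere, whereas
    [is_vartheta] prescribes a positive modulus. Evaluation at a quarter period then excludes a zero
    of [Theta] at [i alpha]. By the same convention an equation of the theorem whose denominator is
    a vanishing square root is false, so these equations carry their own nondegeneracy.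

    A product of two theta series regroups into products of theta series with doubled [d]. All
    identities become bilinear or quartic in just two functions, [thA] and [thB], and the two axes
    differ only in the sign of one constant. That is what carries the equation for f from one axis
    to the other.

    At the far end, the value of kappa fixes L only up to period and reflection: [l] chooses the
    period and [sigma] the reflection. The sign of kappa'(L), and not only its square, is needed to
    recover the prescribed angle from the equation for [X ^ 2]. *)

Lemma ex_series_dom (f g : nat -> R) :
  (forall n, Rabs (f n) <= g n) -> ex_series g -> ex_series f.
Proof. intros H. now apply (ex_series_le (V := R_CompleteNormedModule)). Qed.

Lemma ex_series_scalar (c : R) (f : nat -> R) : ex_series f -> ex_series (fun n => c * f n).
Proof. apply (ex_series_scal_l (K := R_AbsRing) (V := R_NormedModule)). Qed.

Lemma Series_dom (f g : nat -> R) :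
  (forall n, Rabs (f n) <= g n) -> ex_series g -> Rabs (Series f) <= Series g.
Proof.
intros H Hg. eapply Rle_trans; [apply Series_Rabs|].
- apply (ex_series_dom _ g); auto. intros n. now rewrite Rabs_Rabsolu.
- apply Series_le; auto. intros n. split; [apply Rabs_pos|apply H].
Qed.

Lemma Series_fubini (f : nat -> nat -> R) (U V : nat -> R) :
  (forall m n, Rabs (f m n) <= U m * V n) -> ex_series U -> ex_series V ->
  Series (fun m => Series (f m)) = Series (fun n => Series (fun m => f m n)).
Proof.
intros Hf HU HV.
assert (Hrow : forall m, ex_series (f m)).
{ intros m. apply ex_series_dom with (fun n => U m * V n).
  - intros n. apply Hf.
  - now apply ex_series_scalar. }
assert (Hcol : forall n, ex_series (fun m => f m n)).
{ intros n. apply ex_series_dom with (fun m => U m * V n).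
  - intros m. apply Hf.
  - now apply ex_series_scal_r. }
assert (Hpart : forall M, ex_series (fun n => sum_n (fun m => f m n) M) /\
  sum_n (fun m => Series (f m)) M = Series (fun n => sum_n (fun m => f m n) M)).
{ induction M as [|M [IH1 IH2]].
  - split.
    + apply ex_series_ext with (f 0%nat); [|apply Hrow]. intros n. now rewrite sum_O.
    + rewrite sum_O. apply Series_ext. intros n. now rewrite sum_O.
  - split.
    + apply ex_series_ext with (fun n => sum_n (fun m => f m n) M + f (S M) n).
      * intros n. now rewrite sum_Sn.
      * now apply (ex_series_plus (V := R_NormedModule)).
    + rewrite sum_Sn, IH2. unfold plus; simpl.
      rewrite <- Series_plus; auto. apply Series_ext. intros n. now rewrite sum_Sn. }
(* The error after [M] rows is at most a tail of [U] times [V n]; summation over [n] only adds the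
   factor [Series V], so the whole error tends to 0. *)
assert (Htail : forall M n, Rabs (Series (fun m => f m n) - sum_n (fun m => f m n) M)
   <= (Series U - sum_n U M) * V n).
{ intros M n.
  rewrite (Series_incr_n (fun m => f m n) (S M)), (Series_incr_n U (S M)); auto; try lia.
  simpl Init.Nat.pred. rewrite <- !sum_n_Reals.
  replace (sum_n (fun m => f m n) M + Series (fun k => f (S M + k)%nat n) - sum_n (fun m => f m n) M)
    with (Series (fun k => f (S M + k)%nat n)) by ring.
  replace (sum_n U M + Series (fun k => U (S M + k)%nat) - sum_n U M)
    with (Series (fun k => U (S M + k)%nat)) by ring.
  rewrite <- Series_scal_r.
  apply Series_dom; [intros m; apply Hf|].
  apply ex_series_scal_r. now apply (ex_series_incr_n U (S M)). }
assert (Htot : ex_series (fun n => Series (fun m => f m n))).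
{ apply ex_series_dom with (fun n => Series U * V n).
  - intros n. rewrite <- Series_scal_r. apply Series_dom; [intros m; apply Hf|]. now apply ex_series_scal_r.
  - now apply ex_series_scalar. }
apply is_series_unique.
change (is_lim_seq (sum_n (fun m => Series (f m))) (Series (fun n => Series (fun m => f m n)))).
apply is_lim_seq_ext with (fun M => Series (fun n => sum_n (fun m => f m n) M)).
{ intros M. symmetry. apply Hpart. }
assert (Hlim : is_lim_seq (fun M => (Series U - sum_n U M) * Series V) 0).
{ replace (Finite 0) with (Rbar_mult (Series U - Series U) (Series V)).
  2: simpl; f_equal; ring.
  apply is_lim_seq_mult'; [|apply is_lim_seq_const].
  apply is_lim_seq_minus'; [apply is_lim_seq_const|].
  exact (Series_correct _ HU). }
apply is_lim_seq_ext with (fun M => Series (fun n => Series (fun m => f m n)) -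
  (Series (fun n => Series (fun m => f m n)) - Series (fun n => sum_n (fun m => f m n) M))).
{ intros M. ring. }
replace (Finite (Series (fun n => Series (fun m => f m n))))
  with (Finite (Series (fun n => Series (fun m => f m n)) - 0)) by (f_equal; ring).
apply is_lim_seq_minus'; [apply is_lim_seq_const|].
apply is_lim_seq_abs_0.
apply is_lim_seq_le_le with (fun _ => 0) (fun M => (Series U - sum_n U M) * Series V);
  auto using is_lim_seq_const.
intros M. split; [apply Rabs_pos|].
rewrite <- Series_minus; auto. 2: apply Hpart.
rewrite <- Series_scal_l.
apply Series_dom; [apply Htail|]. now apply ex_series_scalar.
Qed.

(** The splitting of a power series into even and odd part, taken at the point 1. *)
Lemma Series_even_odd (a : nat -> R) :
  ex_series (fun n => a (2 * n)%nat) -> ex_series (fun n => a (2 * n + 1)%nat) ->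
  Series a = Series (fun n => a (2 * n)%nat) + Series (fun n => a (2 * n + 1)%nat).
Proof.
intros H0 H1.
assert (E : forall b : nat -> R, ex_series b -> ex_pseries b (1 ^ 2)).
{ intros b Hb. replace (1 ^ 2) with 1 by ring. now apply ex_pseries_1. }
rewrite <- PSeries_1, (PSeries_odd_even a 1); [| now apply E | now apply E].
replace (1 ^ 2) with 1 by ring. rewrite !PSeries_1. ring.
Qed.

(** Gaussian terms beat every exponential, so this one weight serves for all convergence arguments.
    The rate is linear in [|n|] so that a shift of the index by [k] costs only a factor
    [exp |k|]. *)
Definition zdecay (n : Z) : R := exp (- IZR (Z.abs n)).

Definition zdom (M : R) (g : Z -> R) : Prop := forall n, Rabs (g n) <= M * zdecay n.

(** Pairing [n] with [-n-1] lists every integer once without a special middle term, and the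
    reflection [n -> -n-1] just swaps the two summands. It is also the pairing of the sine series in
    [Eta]. *)
Definition zsum (g : Z -> R) : R :=
  Series (fun n => g (Z.of_nat n) + g (- Z.of_nat n - 1)%Z).

Lemma zdecay_pos n : 0 < zdecay n.
Proof. apply exp_pos. Qed.

Lemma zdom_pos M g : zdom M g -> 0 <= M.
Proof.
intros H. specialize (H 0%Z). pose proof (Rabs_pos (g 0%Z)). pose proof (zdecay_pos 0).
destruct (Rle_or_lt 0 M); auto. exfalso. nra.
Qed.

Lemma zdecay_le (m n : Z) (c : R) : IZR (Z.abs m) <= IZR (Z.abs n) + c ->
  zdecay n <= exp c * zdecay m.
Proof.
intros H. unfold zdecay. rewrite <- exp_plus.
destruct (Req_dec (- IZR (Z.abs n)) (c + - IZR (Z.abs m))) as [->|Hne]; [lra|].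
left. apply exp_increasing. lra.
Qed.

Lemma ex_series_zdecay : ex_series (fun n => zdecay (Z.of_nat n)).
Proof.
apply ex_series_ext with (fun n => (exp (- (1))) ^ n).
- intros n. unfold zdecay. rewrite Z.abs_eq by lia. rewrite <- INR_IZR_INZ.
  induction n as [|n IH].
  + simpl. now rewrite Ropp_0, exp_0.
  + rewrite S_INR, Ropp_plus_distr, exp_plus, <- IH. simpl. ring.
- apply ex_series_geom. pose proof (exp_pos (- (1))). rewrite Rabs_pos_eq by lra.
  apply Rlt_le_trans with (exp 0); [apply exp_increasing; lra|rewrite exp_0; lra].
Qed.

Lemma ex_series_zdecay_neg : ex_series (fun n => zdecay (- Z.of_nat n - 1)).
Proof.
apply ex_series_ext with (fun n => zdecay (Z.of_nat (S n))).
- intros n. unfold zdecay. do 3 f_equal. lia.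
- apply (ex_series_incr_1 (fun n => zdecay (Z.of_nat n))). apply ex_series_zdecay.
Qed.

Lemma zdom_pos_half M g : zdom M g -> ex_series (fun n => g (Z.of_nat n)).
Proof.
intros H.
apply ex_series_dom with (fun n => M * zdecay (Z.of_nat n)).
- intros n. apply H.
- apply ex_series_scalar, ex_series_zdecay.
Qed.

Lemma zdom_neg_half M g : zdom M g -> ex_series (fun n => g (- Z.of_nat n - 1)%Z).
Proof.
intros H.
apply ex_series_dom with (fun n => M * zdecay (- Z.of_nat n - 1)).
- intros n. apply H.
- apply ex_series_scalar, ex_series_zdecay_neg.
Qed.

Lemma zsum_halves M g : zdom M g ->
  zsum g = Series (fun n => g (Z.of_nat n)) + Series (fun n => g (- Z.of_nat n - 1)%Z).
Proof.
intros H. apply Series_plus; [eapply zdom_pos_half|eapply zdom_neg_half]; eauto.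
Qed.

Lemma zsum_ext f g : (forall n, f n = g n) -> zsum f = zsum g.
Proof. intros H. apply Series_ext. intros n. now rewrite !H. Qed.

Lemma zsum_scal c g : zsum (fun n => c * g n) = c * zsum g.
Proof.
unfold zsum. rewrite <- Series_scal_l. apply Series_ext. intros n. ring.
Qed.

Lemma zdom_ex M g : zdom M g -> ex_series (fun n => g (Z.of_nat n) + g (- Z.of_nat n - 1)%Z).
Proof.
intros H. apply (ex_series_plus (V := R_NormedModule) (fun n => g (Z.of_nat n)));
 [eapply zdom_pos_half|eapply zdom_neg_half]; eauto.
Qed.

Lemma zsum_plus M N f g : zdom M f -> zdom N g ->
  zsum (fun n => f n + g n) = zsum f + zsum g.
Proof.
intros Hf Hg. unfold zsum. rewrite <- Series_plus.
- apply Series_ext. intros n. ring.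
- eapply zdom_ex; eauto.
- eapply zdom_ex; eauto.
Qed.

Lemma zdom_decay : zdom 1 zdecay.
Proof. intros n. pose proof (zdecay_pos n). rewrite Rabs_pos_eq; lra. Qed.

Lemma zsum_bound M g : zdom M g -> Rabs (zsum g) <= M * zsum zdecay.
Proof.
intros H. unfold zsum. rewrite <- Series_scal_l.
apply Series_dom.
- intros n. eapply Rle_trans; [apply Rabs_triang|].
  pose proof (H (Z.of_nat n)). pose proof (H (- Z.of_nat n - 1)%Z). lra.
- apply ex_series_scalar, (zdom_ex 1), zdom_decay.
Qed.

Lemma zdom_shift M g k : zdom M g -> zdom (M * exp (IZR (Z.abs k))) (fun n => g (n + k)%Z).
Proof.
intros H n. eapply Rle_trans; [apply H|]. rewrite Rmult_assoc.
apply Rmult_le_compat_l; [eapply zdom_pos; eauto|].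
apply zdecay_le. rewrite <- plus_IZR. apply IZR_le. lia.
Qed.

Lemma zsum_succ M g : zdom M g -> zsum (fun n => g (n + 1)%Z) = zsum g.
Proof.
intros H. rewrite (zsum_halves _ _ (zdom_shift _ _ 1 H)), (zsum_halves _ _ H).
rewrite (Series_incr_1 (fun n => g (Z.of_nat n))) by (eapply zdom_pos_half; eauto).
rewrite (Series_incr_1 (fun n => g (- Z.of_nat n - 1 + 1)%Z)).
2: apply (zdom_neg_half _ _ (zdom_shift _ _ 1 H)).
rewrite (Series_ext (fun n => g (Z.of_nat n + 1)%Z) (fun n => g (Z.of_nat (S n)))).
2: intros n; f_equal; lia.
rewrite (Series_ext (fun n => g (- Z.of_nat (S n) - 1 + 1)%Z) (fun n => g (- Z.of_nat n - 1)%Z)).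
2: intros n; f_equal; lia.
simpl. ring.
Qed.

Lemma zsum_shift M g k : zdom M g -> zsum (fun n => g (n + k)%Z) = zsum g.
Proof.
intros H. revert k. apply Z.bi_induction.
- intros ? ? ->. tauto.
- apply zsum_ext. intros n. f_equal. lia.
- intros k. rewrite <- (zsum_succ _ _ (zdom_shift _ _ k H)).
  rewrite (zsum_ext (fun n => g (n + 1 + k)%Z) (fun n => g (n + Z.succ k)%Z)).
  + tauto.
  + intros n. f_equal. lia.
Qed.

Lemma zsum_reflect g : zsum (fun n => g (- n - 1)%Z) = zsum g.
Proof.
apply Series_ext. intros n. rewrite Rplus_comm. f_equal. f_equal. lia.
Qed.

(** The cosine series in [Theta] isolates 0 and pairs [n] with [-n], so the summands of [zsum] have
    to be regrouped. *)
Lemma zsum_sym M g : zdom M g ->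
  zsum g = g 0%Z + Series (fun n => g (Z.of_nat (S n)) + g (- Z.of_nat (S n))%Z).
Proof.
intros H. rewrite (zsum_halves _ _ H).
pose proof (zdom_pos_half _ _ H) as H1. pose proof (zdom_neg_half _ _ H) as H2.
rewrite Series_incr_1 by auto. simpl Z.of_nat at 1.
rewrite Series_plus.
- rewrite (Series_ext (fun n => g (- Z.of_nat (S n))%Z) (fun n => g (- Z.of_nat n - 1)%Z)).
  + ring.
  + intros n. f_equal. lia.
- now apply (ex_series_incr_1 (fun n => g (Z.of_nat n))).
- apply ex_series_ext with (2 := H2). intros n. f_equal. lia.
Qed.

Lemma zdom_even M g : zdom M g -> zdom M (fun n => g (2 * n)%Z).
Proof.
intros H n. eapply Rle_trans; [apply H|].
apply Rmult_le_compat_l; [eapply zdom_pos; eauto|].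
rewrite <- (Rmult_1_l (zdecay n)), <- exp_0. apply zdecay_le. rewrite Rplus_0_r. apply IZR_le. lia.
Qed.

Lemma zdom_odd M g : zdom M g -> zdom (M * exp 1) (fun n => g (2 * n + 1)%Z).
Proof. intros H. apply (zdom_even (M * exp 1) (fun n => g (n + 1)%Z)). apply (zdom_shift M g 1 H). Qed.

Lemma zsum_parity M g : zdom M g ->
  zsum g = zsum (fun n => g (2 * n)%Z) + zsum (fun n => g (2 * n + 1)%Z).
Proof.
intros H.
rewrite (zsum_halves _ _ H), (zsum_halves _ _ (zdom_even _ _ H)), (zsum_halves _ _ (zdom_odd _ _ H)).
rewrite (Series_even_odd (fun n => g (Z.of_nat n))).
2:{ apply ex_series_ext with (2 := zdom_pos_half _ _ (zdom_even _ _ H)). intros n. f_equal. lia. }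
2:{ apply ex_series_ext with (2 := zdom_pos_half _ _ (zdom_odd _ _ H)). intros n. f_equal. lia. }
rewrite (Series_even_odd (fun n => g (- Z.of_nat n - 1)%Z)).
2:{ apply ex_series_ext with (2 := zdom_neg_half _ _ (zdom_odd _ _ H)). intros n. f_equal. lia. }
2:{ apply ex_series_ext with (2 := zdom_neg_half _ _ (zdom_even _ _ H)). intros n. f_equal. lia. }
rewrite (Series_ext (fun n => g (2 * Z.of_nat n)%Z) (fun n => g (Z.of_nat (2 * n)))).
2: intros n; f_equal; lia.
rewrite (Series_ext (fun n => g (2 * Z.of_nat n + 1)%Z) (fun n => g (Z.of_nat (2 * n + 1)))).
2: intros n; f_equal; lia.
rewrite (Series_ext (fun n => g (2 * (- Z.of_nat n - 1))%Z) (fun n => g (- Z.of_nat (2 * n + 1) - 1)%Z)).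
2: intros n; f_equal; lia.
rewrite (Series_ext (fun n => g (2 * (- Z.of_nat n - 1) + 1)%Z) (fun n => g (- Z.of_nat (2 * n) - 1)%Z)).
2: intros n; f_equal; lia.
ring.
Qed.

Lemma zsum_fubini M (f : Z -> Z -> R) :
  (forall m n, Rabs (f m n) <= M * (zdecay m * zdecay n)) ->
  zsum (fun m => zsum (f m)) = zsum (fun n => zsum (fun m => f m n)).
Proof.
intros H.
assert (HM : 0 <= M).
{ specialize (H 0%Z 0%Z). pose proof (Rabs_pos (f 0%Z 0%Z)). pose proof (zdecay_pos 0).
  destruct (Rle_or_lt 0 M); auto. exfalso.
  assert (0 < zdecay 0 * zdecay 0) by (apply Rmult_lt_0_compat; auto). nra. }
assert (Hr : forall m, zdom (M * zdecay m) (f m)).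
{ intros m n. rewrite Rmult_assoc. apply H. }
assert (Hc : forall n, zdom (M * zdecay n) (fun m => f m n)).
{ intros n m. replace (M * zdecay n * zdecay m) with (M * (zdecay m * zdecay n)) by ring. apply H. }
unfold zsum at 1.
set (U := fun n => M * (zdecay (Z.of_nat n) + zdecay (- Z.of_nat n - 1))).
set (V := fun n => (zdecay (Z.of_nat n) + zdecay (- Z.of_nat n - 1))).
(* The four quadrants of the integer lattice are folded into one double series over the naturals, so
   that [Series_fubini] is applied only once. *)
set (F := fun m n : nat => f (Z.of_nat m) (Z.of_nat n) + f (Z.of_nat m) (- Z.of_nat n - 1)%Z
   + (f (- Z.of_nat m - 1)%Z (Z.of_nat n) + f (- Z.of_nat m - 1)%Z (- Z.of_nat n - 1)%Z)).
rewrite (Series_ext _ (fun m => Series (F m))).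
2:{ intros m. unfold zsum. rewrite <- Series_plus.
    - reflexivity.
    - eapply zdom_ex, Hr.
    - eapply zdom_ex, Hr. }
rewrite (Series_fubini F U V).
- apply Series_ext. intros n. unfold zsum. rewrite <- Series_plus.
  + apply Series_ext. intros m. unfold F. ring.
  + eapply (zdom_ex _ (fun m => f m (Z.of_nat n))), Hc.
  + eapply (zdom_ex _ (fun m => f m (- Z.of_nat n - 1)%Z)), Hc.
- intros m n. unfold F, U, V.
  pose proof (H (Z.of_nat m) (Z.of_nat n)).
  pose proof (H (Z.of_nat m) (- Z.of_nat n - 1)%Z).
  pose proof (H (- Z.of_nat m - 1)%Z (Z.of_nat n)).
  pose proof (H (- Z.of_nat m - 1)%Z (- Z.of_nat n - 1)%Z).
  eapply Rle_trans; [apply Rabs_triang|].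
  match goal with |- Rabs (?a + ?b) + Rabs (?c + ?d) <= _ =>
    pose proof (Rabs_triang a b); pose proof (Rabs_triang c d) end.
  lra.
- apply ex_series_scalar.
  apply (zdom_ex 1), zdom_decay.
- apply (zdom_ex 1), zdom_decay.
Qed.

(** * Complex exponential and complex derivatives *)

Lemma Cmod_le_abs (z : C) : Cmod z <= Rabs (Re z) + Rabs (Im z).
Proof.
rewrite <- (Rabs_pos_eq (Cmod z)) by apply Cmod_ge_0.
pose proof (Rabs_pos (Re z)). pose proof (Rabs_pos (Im z)).
rewrite <- (Rabs_pos_eq (Rabs (Re z) + Rabs (Im z))) by lra.
apply Rsqr_le_abs_0. rewrite !Rsqr_pow2, Cmod2_alt.
rewrite <- (pow2_abs (Re z)), <- (pow2_abs (Im z)). nra.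
Qed.

Lemma im_le_Cmod (z : C) : Rabs (Im z) <= Cmod z.
Proof. eapply Rle_trans; [|apply Rmax_Cmod]. apply Rmax_r. Qed.

Lemma C_eq (z w : C) : Re z = Re w -> Im z = Im w -> z = w.
Proof. destruct z, w. simpl. congruence. Qed.

Lemma Cexp_plus (z w : C) : Cexp (z + w) = (Cexp z * Cexp w)%C.
Proof.
destruct z as [x y], w as [x' y']. unfold Cexp. apply C_eq; unfold Re, Im; simpl; rewrite exp_plus, ?cos_plus, ?sin_plus; ring.
Qed.

Lemma Cexp_0 : Cexp 0 = 1.
Proof. unfold Cexp. apply C_eq; unfold Re, Im; simpl; rewrite exp_0, ?cos_0, ?sin_0; ring. Qed.

Lemma Cexp_opp (z : C) : (Cexp z * Cexp (- z))%C = 1.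
Proof. rewrite <- Cexp_plus, <- Cexp_0. f_equal. ring. Qed.

Lemma Cmod_Cexp (z : C) : Cmod (Cexp z) = exp (Re z).
Proof.
destruct z as [x y]. unfold Cmod, Cexp, Re, Im; simpl.
match goal with |- sqrt ?a = _ => replace a with (exp x ^ 2 * (Rsqr (sin y) + Rsqr (cos y)))
 by (unfold Rsqr; ring) end.
rewrite sin2_cos2, Rmult_1_r. apply sqrt_pow2. left. apply exp_pos.
Qed.

Lemma Cexp_angle (x : R) : Cexp (Ci * RtoC x) = (cos x, sin x).
Proof.
unfold Cexp, Re, Im. simpl. replace (0 * x - 1 * 0) with 0 by ring. replace (0 * 0 + 1 * x) with x by ring.
rewrite exp_0. f_equal; ring.
Qed.

Lemma exp_le (x y : R) : x <= y -> exp x <= exp y.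
Proof. intros [H| ->]; [left; now apply exp_increasing|lra]. Qed.

Lemma Rabs_between (x c : R) : Rmin 0 x <= c <= Rmax 0 x -> Rabs c <= Rabs x.
Proof.
intros H. unfold Rmin, Rmax in H. destruct (Rle_dec 0 x);
unfold Rabs; destruct (Rcase_abs c); destruct (Rcase_abs x); lra.
Qed.

Lemma is_derive_cst (c x : R) : is_derive (fun _ : R => c) x 0.
Proof. apply (is_derive_const (K := R_AbsRing) (V := R_NormedModule)). Qed.

Lemma is_derive_Rmult (f g : R -> R) (x f' g' : R) : is_derive f x f' -> is_derive g x g' ->
  is_derive (fun t => f t * g t) x (f' * g x + f x * g').
Proof. intros Hf Hg. apply (is_derive_mult (K := R_AbsRing) f g); auto. intros; apply Rmult_comm. Qed.

Lemma is_derive_continuity (f : R -> R) (x l : R) : is_derive f x l -> continuity_pt f x.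
Proof.
intros H. apply continuity_pt_filterlim, (ex_derive_continuous f). eexists; apply H.
Qed.

(** The Taylor estimates below apply this to a function minus its Taylor polynomial, the
    second-order ones using a first-order one as the bound on the derivative. The constants are not
    sharp: the factor 1/2 is dropped. *)
Lemma MVT_abs0 (f df : R -> R) (B x : R) :
  (forall t, is_derive f t (df t)) -> (forall t, Rabs t <= Rabs x -> Rabs (df t) <= B) ->
  Rabs (f x - f 0) <= B * Rabs x.
Proof.
intros Hd HB.
destruct (MVT_gen f 0 x df) as [c [Hc He]].
- intros t _. apply Hd.
- intros t _. eapply is_derive_continuity, Hd.
- rewrite He, Rabs_mult, Rminus_0_r. apply Rmult_le_compat_r; [apply Rabs_pos|].
  apply HB. now apply Rabs_between.
Qed.

Lemma exp_taylor1 (x : R) : Rabs (exp x - 1) <= exp (Rabs x) * Rabs x.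
Proof.
rewrite <- exp_0. apply (MVT_abs0 exp exp).
- intros t. apply is_derive_exp.
- intros t Ht. rewrite Rabs_pos_eq by (left; apply exp_pos). apply exp_le.
  eapply Rle_trans; [apply Rle_abs|apply Ht].
Qed.

Lemma exp_taylor2 (x : R) : Rabs (exp x - 1 - x) <= exp (Rabs x) * Rabs x * Rabs x.
Proof.
replace (exp x - 1 - x) with ((exp x - x) - (exp 0 - 0)) by (rewrite exp_0; ring).
apply (MVT_abs0 (fun x => exp x - x) (fun x => exp x - 1)).
- intros t. auto_derive; trivial. ring.
- intros t Ht. eapply Rle_trans; [apply exp_taylor1|].
  apply Rmult_le_compat; try apply Rabs_pos; auto.
  + left; apply exp_pos.
  + now apply exp_le.
Qed.

Lemma cos_taylor1 (x : R) : Rabs (cos x - 1) <= Rabs x.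
Proof.
rewrite <- cos_0. rewrite <- (Rmult_1_l (Rabs x)).
apply (MVT_abs0 cos (fun t => - sin t)).
- intros t. auto_derive; trivial. ring.
- intros t _. rewrite Rabs_Ropp. apply Rabs_le. apply SIN_bound.
Qed.

Lemma sin_taylor1 (x : R) : Rabs (sin x) <= Rabs x.
Proof.
rewrite <- (Rminus_0_r (sin x)), <- sin_0. rewrite <- (Rmult_1_l (Rabs x)).
apply (MVT_abs0 sin cos).
- intros t. auto_derive; trivial. ring.
- intros t _. apply Rabs_le. apply COS_bound.
Qed.

Lemma sin_taylor2 (x : R) : Rabs (sin x - x) <= Rabs x * Rabs x.
Proof.
replace (sin x - x) with ((sin x - x) - (sin 0 - 0)) by (rewrite sin_0; ring).
apply (MVT_abs0 (fun x => sin x - x) (fun x => cos x - 1)).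
- intros t. auto_derive; trivial. ring.
- intros t Ht. eapply Rle_trans; [apply cos_taylor1|auto].
Qed.

Lemma cos_taylor2 (x : R) : Rabs (cos x - 1) <= Rabs x * Rabs x.
Proof.
rewrite <- cos_0. 
apply (MVT_abs0 cos (fun t => - sin t)).
- intros t. auto_derive; trivial. ring.
- intros t Ht. rewrite Rabs_Ropp. eapply Rle_trans; [apply sin_taylor1|auto].
Qed.

(** The two terms of the real part together contribute [|x|^2 + |y|^2 = |w|^2], and each of the two
    terms of the imaginary part another [|w|^2]; hence the 3. *)
Lemma Cexp_taylor2 (w : C) : Cmod (Cexp w - 1 - w) <= 3 * Cmod w ^ 2 * exp (Cmod w).
Proof.
eapply Rle_trans; [apply Cmod_le_abs|].
pose proof (re_le_Cmod w) as Hx. pose proof (im_le_Cmod w) as Hy.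
destruct w as [x y]. set (r := Cmod (x, y)) in *. cbn [Re Im fst snd] in Hx, Hy.
unfold Cexp. simpl.
replace (exp x * cos y + - (1) + - x) with ((exp x - 1 - x) + exp x * (cos y - 1)) by ring.
replace (exp x * sin y + - 0 + - y) with ((exp x - 1) * sin y + (sin y - y)) by ring.
assert (Hr : 0 <= r) by apply Cmod_ge_0.
assert (He : exp (Rabs x) <= exp r) by now apply exp_le.
assert (He0 : exp x <= exp r) by (apply exp_le; eapply Rle_trans; [apply Rle_abs|apply Hx]).
assert (He1 : 1 <= exp r) by (rewrite <- exp_0; now apply exp_le).
pose proof (exp_pos x). pose proof (exp_pos (Rabs x)).
pose proof (Rabs_pos x). pose proof (Rabs_pos y).
assert (B1 : Rabs (exp x - 1 - x) <= exp r * Rabs x * Rabs x).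
{ eapply Rle_trans; [apply exp_taylor2|]. repeat apply Rmult_le_compat_r; auto. }
assert (B2 : Rabs (exp x * (cos y - 1)) <= exp r * (Rabs y * Rabs y)).
{ rewrite Rabs_mult, (Rabs_pos_eq (exp x)) by lra.
  apply Rmult_le_compat; try lra; [apply Rabs_pos|apply cos_taylor2]. }
assert (B3 : Rabs ((exp x - 1) * sin y) <= exp r * (r * r)).
{ rewrite Rabs_mult, <- Rmult_assoc. apply Rmult_le_compat; try apply Rabs_pos.
  - eapply Rle_trans; [apply exp_taylor1|]. apply Rmult_le_compat; lra.
  - eapply Rle_trans; [apply sin_taylor1|auto]. }
assert (B4 : Rabs (sin y - y) <= exp r * (r * r)).
{ eapply Rle_trans; [apply sin_taylor2|]. rewrite <- (Rmult_1_l (Rabs y * Rabs y)).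
  apply Rmult_le_compat; try lra; [nra|]. apply Rmult_le_compat; lra. }
assert (B5 : Rabs x * Rabs x + Rabs y * Rabs y = r * r).
{ unfold r. replace (Cmod (x, y) * Cmod (x, y)) with (Cmod (x, y) ^ 2) by ring.
  rewrite Cmod2_alt. simpl. rewrite <- !Rabs_mult. rewrite !Rabs_pos_eq by apply Rle_0_sqr. ring. }
eapply Rle_trans; [apply Rplus_le_compat; apply Rabs_triang|].
apply Rle_trans with (exp r * (Rabs x * Rabs x + Rabs y * Rabs y) + 2 * (exp r * (r * r))); [lra|].
rewrite B5. right; ring.
Qed.

(** Complex differentiability with a quadratic remainder. It is preserved by products and affine
    substitutions through plain estimates, and it restricts to real derivatives along any line. The
    radius is at most 1 so that [|h|^2 <= |h|] is available in the product rule. *)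
Definition quad_diff (F : C -> C) (v l : C) : Prop :=
  exists M r, 0 <= M /\ 0 < r <= 1 /\
  forall h : C, Cmod h <= r -> Cmod (F (v + h) - F v - h * l)%C <= M * Cmod h ^ 2.

Lemma quad_diff_is_derive (F : C -> C) (v l : C) :
  quad_diff F v l -> is_derive F v l.
Proof.
intros [M [r [HM0 [Hr HM]]]]. split.
- apply is_linear_scal_l.
- intros x Hx.
  assert (Hx' : v = x) by now apply (is_filter_lim_locally_unique (V := AbsRing_NormedModule C_AbsRing)).
  subst x. clear Hx. intros eps.
  apply (locally_le_locally_norm (K := C_AbsRing) (V := AbsRing_NormedModule C_AbsRing)).
  assert (Hd : 0 < Rmin r (eps / (M + 1))).
  { apply Rmin_pos; [lra|]. apply Rdiv_lt_0_compat; [apply cond_pos|lra]. }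
  exists (mkposreal _ Hd). intros y Hy. simpl in Hy.
  change (Cmod (y - v)%C < Rmin r (eps / (M + 1))) in Hy.
  change (Cmod (F y - F v - (y - v) * l)%C <= eps * Cmod (y - v)%C).
  set (h := (y - v)%C) in *. replace y with (v + h)%C by (unfold h; ring).
  pose proof (Rmin_l r (eps / (M + 1))). pose proof (Rmin_r r (eps / (M + 1))).
  eapply Rle_trans; [apply HM; lra|].
  simpl. rewrite Rmult_1_r, <- Rmult_assoc. apply Rmult_le_compat_r; [apply Cmod_ge_0|].
  pose proof (Cmod_ge_0 h).
  apply Rle_trans with ((M + 1) * Cmod h); [nra|].
  apply Rle_trans with ((M + 1) * (eps / (M + 1))); [apply Rmult_le_compat_l; lra|].
  right. field. lra.
Qed.

Lemma quad_diff_unique (F : C -> C) (v l m : C) : quad_diff F v l -> quad_diff F v m -> l = m.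
Proof.
intros H1 H2. apply quad_diff_is_derive, is_C_derive_unique in H1.
apply quad_diff_is_derive, is_C_derive_unique in H2. congruence.
Qed.

Lemma quad_diff_ext (F G : C -> C) (v l : C) :
  (forall x, F x = G x) -> quad_diff F v l -> quad_diff G v l.
Proof.
intros HE [M [r [HM0 [Hr HM]]]]. exists M, r. repeat split; try tauto.
intros h Hh. rewrite <- !HE. auto.
Qed.

Lemma quad_diff_const (c v : C) : quad_diff (fun _ => c) v 0.
Proof.
exists 0, 1. repeat split; try lra. intros h _.
replace (c - c - h * 0)%C with (RtoC 0) by ring. rewrite Cmod_0. lra.
Qed.

Lemma quad_diff_mult (F G : C -> C) (v l m : C) :
  quad_diff F v l -> quad_diff G v m -> quad_diff (fun x => F x * G x)%C v (l * G v + F v * m)%C.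
Proof.
intros [M [r [HM0 [Hr HM]]]] [N [t [HN0 [Ht HN]]]].
exists (M * Cmod (G v) + Cmod (F v) * N + (M + Cmod l) * (N + Cmod m)), (Rmin r t).
pose proof (Cmod_ge_0 (G v)). pose proof (Cmod_ge_0 (F v)). pose proof (Cmod_ge_0 l). pose proof (Cmod_ge_0 m).
pose proof (Rmin_l r t). pose proof (Rmin_r r t).
assert (0 < Rmin r t) by (apply Rmin_pos; lra).
repeat split; try lra.
- assert (0 <= M * Cmod (G v)) by now apply Rmult_le_pos.
  assert (0 <= Cmod (F v) * N) by now apply Rmult_le_pos.
  assert (0 <= (M + Cmod l) * (N + Cmod m)) by (apply Rmult_le_pos; lra). lra.
- intros h Hh. specialize (HM h ltac:(lra)). specialize (HN h ltac:(lra)).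
  pose proof (Cmod_ge_0 h).
  set (u := (F (v + h) - F v - h * l)%C) in *. set (w := (G (v + h) - G v - h * m)%C) in *.
  replace (F (v + h) * G (v + h) - F v * G v - h * (l * G v + F v * m))%C
   with (u * G v + F v * w + (u + h * l) * (w + h * m))%C by (unfold u, w; ring).
  assert (B1 : Cmod (u + h * l)%C <= (M + Cmod l) * Cmod h).
  { eapply Rle_trans; [apply Cmod_triangle|]. rewrite Cmod_mult.
    assert (M * Cmod h ^ 2 <= M * Cmod h) by (apply Rmult_le_compat_l; nra). lra. }
  assert (B2 : Cmod (w + h * m)%C <= (N + Cmod m) * Cmod h).
  { eapply Rle_trans; [apply Cmod_triangle|]. rewrite Cmod_mult.
    assert (N * Cmod h ^ 2 <= N * Cmod h) by (apply Rmult_le_compat_l; nra). lra. }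
  eapply Rle_trans; [apply Cmod_triangle|]. eapply Rle_trans; [apply Rplus_le_compat_r, Cmod_triangle|].
  rewrite !Cmod_mult.
  assert (C1 : Cmod u * Cmod (G v) <= M * Cmod h ^ 2 * Cmod (G v)) by now apply Rmult_le_compat_r.
  assert (C2 : Cmod (F v) * Cmod w <= Cmod (F v) * (N * Cmod h ^ 2)) by now apply Rmult_le_compat_l.
  assert (C3 : Cmod (u + h * l)%C * Cmod (w + h * m)%C <= ((M + Cmod l) * Cmod h) * ((N + Cmod m) * Cmod h))
   by (apply Rmult_le_compat; auto using Cmod_ge_0).
  lra.
Qed.

Lemma quad_diff_minus (F G : C -> C) (v l m : C) :
  quad_diff F v l -> quad_diff G v m -> quad_diff (fun x => F x - G x)%C v (l - m)%C.
Proof.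
intros [M [r [HM0 [Hr HM]]]] [N [t [HN0 [Ht HN]]]].
exists (M + N), (Rmin r t).
pose proof (Rmin_l r t). pose proof (Rmin_r r t).
assert (0 < Rmin r t) by (apply Rmin_pos; lra).
repeat split; try lra.
intros h Hh. specialize (HM h ltac:(lra)). specialize (HN h ltac:(lra)).
replace (F (v + h) - G (v + h) - (F v - G v) - h * (l - m))%C
  with ((F (v + h) - F v - h * l) + - (G (v + h) - G v - h * m))%C by ring.
eapply Rle_trans; [apply Cmod_triangle|]. rewrite Cmod_opp. lra.
Qed.

Lemma quad_diff_affine (F : C -> C) (p q v l : C) :
  quad_diff F (p * v + q)%C l -> quad_diff (fun x => F (p * x + q)%C) v (p * l)%C.
Proof.
intros [M [r [HM0 [Hr HM]]]].
pose proof (Cmod_ge_0 p) as Hp.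
assert (Hq : 0 < / (Cmod p + 1) <= 1).
{ split; [apply Rinv_0_lt_compat; lra|]. rewrite <- Rinv_1. apply Rinv_le_contravar; lra. }
exists (M * Cmod p ^ 2), (r * / (Cmod p + 1)).
repeat split.
- apply Rmult_le_pos; [auto|apply pow2_ge_0].
- apply Rmult_lt_0_compat; lra.
- nra.
- intros h Hh. replace (p * (v + h) + q)%C with (p * v + q + p * h)%C by ring.
  replace (h * (p * l))%C with (p * h * l)%C by ring.
  replace (M * Cmod p ^ 2 * Cmod h ^ 2) with (M * (Cmod p * Cmod h) ^ 2) by ring.
  rewrite <- Cmod_mult. apply HM. rewrite Cmod_mult. pose proof (Cmod_ge_0 h).
  apply Rle_trans with ((Cmod p + 1) * (r * / (Cmod p + 1))); [apply Rmult_le_compat; lra|].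
  right. field. lra.
Qed.

Lemma is_derive_quad (f : R -> R) (x l : R) :
  (exists M d, 0 < d /\ forall h, Rabs h <= d -> Rabs (f (x + h) - f x - h * l) <= M * Rabs h ^ 2) ->
  is_derive f x l.
Proof.
intros [M [d [Hd0 HM]]]. apply is_derive_Reals. intros eps Heps.
assert (Hd : 0 < Rmin d (eps / (Rabs M + 1))).
{ apply Rmin_pos; [lra|]. apply Rdiv_lt_0_compat; [auto|]. pose proof (Rabs_pos M); lra. }
exists (mkposreal _ Hd). intros h Hh0 Hh. simpl in Hh.
pose proof (Rmin_l d (eps / (Rabs M + 1))). pose proof (Rmin_r d (eps / (Rabs M + 1))).
replace ((f (x + h) - f x) / h - l) with ((f (x + h) - f x - h * l) / h) by (field; auto).
unfold Rdiv. rewrite Rabs_mult, Rabs_inv.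
pose proof (Rabs_pos_lt h Hh0) as Hp. pose proof (Rabs_pos M). pose proof (Rle_abs M).
apply Rle_lt_trans with (M * Rabs h ^ 2 * / Rabs h).
- apply Rmult_le_compat_r; [left; now apply Rinv_0_lt_compat|]. apply HM. lra.
- replace (M * Rabs h ^ 2 * / Rabs h) with (M * Rabs h) by (field; lra).
  apply Rle_lt_trans with ((Rabs M + 1) * Rabs h); [nra|].
  apply Rlt_le_trans with ((Rabs M + 1) * (eps / (Rabs M + 1))); [apply Rmult_lt_compat_l; lra|].
  right. field. lra.
Qed.

(** One complex number [l] serves every direction [d]. Comparing a real with an imaginary direction
    is the form in which the Cauchy-Riemann equations are used. *)
Lemma quad_diff_line (F : C -> C) (p d l : C) (s : R) :
  quad_diff F (p + RtoC s * d)%C l ->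
  is_derive (fun s : R => Re (F (p + RtoC s * d)%C)) s (Re (d * l)%C) /\
  is_derive (fun s : R => Im (F (p + RtoC s * d)%C)) s (Im (d * l)%C).
Proof.
intros HF.
assert (HF' : quad_diff (fun x => F (d * x + p)%C) (RtoC s) (d * l)%C).
{ apply quad_diff_affine. now replace (d * RtoC s + p)%C with (p + RtoC s * d)%C by ring. }
destruct HF' as [M [r [HM0 [Hr HM]]]].
assert (HH : forall h, Rabs h <= r ->
  Cmod (F (p + RtoC (s + h) * d) - F (p + RtoC s * d) - RtoC h * (d * l))%C <= M * Rabs h ^ 2).
{ intros h Hh. rewrite <- Cmod_R in *.
  replace (p + RtoC (s + h) * d)%C with (d * (RtoC s + RtoC h) + p)%C by (rewrite RtoC_plus; ring).
  replace (p + RtoC s * d)%C with (d * RtoC s + p)%C by ring. auto. }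
split; apply is_derive_quad; exists M, r; (split; [lra|]); intros h Hh;
 (eapply Rle_trans; [|apply (HH h Hh)]).
- eapply Rle_trans; [|apply re_le_Cmod]. right. f_equal. unfold Re, Im. simpl. ring.
- eapply Rle_trans; [|apply im_le_Cmod]. right. f_equal. unfold Re, Im. simpl. ring.
Qed.

(** * Theta series *)

Definition czdom (M : R) (f : Z -> C) : Prop := forall n, Cmod (f n) <= M * zdecay n.

Definition czsum (f : Z -> C) : C := (zsum (fun n => Re (f n)), zsum (fun n => Im (f n))).

Lemma czdom_re M f : czdom M f -> zdom M (fun n => Re (f n)).
Proof. intros H n. eapply Rle_trans; [apply re_le_Cmod|apply H]. Qed.

Lemma czdom_im M f : czdom M f -> zdom M (fun n => Im (f n)).
Proof. intros H n. eapply Rle_trans; [apply im_le_Cmod|apply H]. Qed.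

Lemma czdom_scal M f (c : C) : czdom M f -> czdom (Cmod c * M) (fun n => c * f n)%C.
Proof.
intros H n. rewrite Cmod_mult, Rmult_assoc. apply Rmult_le_compat_l; [apply Cmod_ge_0|apply H].
Qed.

Lemma czdom_plus M N f g : czdom M f -> czdom N g -> czdom (M + N) (fun n => f n + g n)%C.
Proof.
intros Hf Hg n. eapply Rle_trans; [apply Cmod_triangle|].
specialize (Hf n). specialize (Hg n). lra.
Qed.

Lemma czsum_ext f g : (forall n, f n = g n) -> czsum f = czsum g.
Proof. intros H. unfold czsum. f_equal; apply zsum_ext; intros n; now rewrite H. Qed.

Lemma czsum_plus M N f g : czdom M f -> czdom N g ->
  czsum (fun n => f n + g n)%C = (czsum f + czsum g)%C.
Proof.
intros Hf Hg. unfold czsum. apply C_eq; simpl.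
- rewrite <- (zsum_plus M N); auto using czdom_re.
- rewrite <- (zsum_plus M N); auto using czdom_im.
Qed.

Lemma zdom_scal M g c : zdom M g -> zdom (Rabs c * M) (fun n => c * g n).
Proof.
intros H n. rewrite Rabs_mult, Rmult_assoc. apply Rmult_le_compat_l; [apply Rabs_pos|apply H].
Qed.

Lemma czsum_scal M f (c : C) : czdom M f ->
  czsum (fun n => c * f n)%C = (c * czsum f)%C.
Proof.
intros H. unfold czsum. destruct c as [x y].
pose proof (czdom_re _ _ H) as H1. pose proof (czdom_im _ _ H) as H2.
apply C_eq; simpl.
- unfold Rminus. rewrite <- Ropp_mult_distr_l_reverse, <- !zsum_scal.
  rewrite <- (zsum_plus (Rabs x * M) (Rabs (-y) * M)); auto using zdom_scal.
  apply zsum_ext. intros n. unfold Re, Im. ring.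
- rewrite <- !zsum_scal.
  rewrite <- (zsum_plus (Rabs x * M) (Rabs y * M)); auto using zdom_scal.
Qed.

Lemma czsum_bound M f : czdom M f -> Cmod (czsum f) <= M * (2 * zsum zdecay).
Proof.
intros H. eapply Rle_trans; [apply Cmod_le_abs|].
pose proof (zsum_bound _ _ (czdom_re _ _ H)). pose proof (zsum_bound _ _ (czdom_im _ _ H)).
unfold czsum. simpl. lra.
Qed.

Lemma czsum_shift M f k : czdom M f -> czsum (fun n => f (n + k)%Z) = czsum f.
Proof.
intros H. unfold czsum. f_equal.
- apply (zsum_shift M (fun n => Re (f n))), czdom_re, H.
- apply (zsum_shift M (fun n => Im (f n))), czdom_im, H.
Qed.

Lemma czsum_reflect M f k : czdom M f -> czsum (fun n => f (k - n)%Z) = czsum f.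
Proof.
intros H. rewrite <- (czsum_shift M f (k + 1)) by auto.
unfold czsum. f_equal.
- rewrite <- (zsum_reflect (fun n => Re (f (n + (k + 1))%Z))).
  apply zsum_ext. intros n. do 2 f_equal. lia.
- rewrite <- (zsum_reflect (fun n => Im (f (n + (k + 1))%Z))).
  apply zsum_ext. intros n. do 2 f_equal. lia.
Qed.

Lemma czsum_parity M f : czdom M f ->
  czsum f = (czsum (fun n => f (2 * n)%Z) + czsum (fun n => f (2 * n + 1)%Z))%C.
Proof.
intros H. unfold czsum. apply C_eq; simpl.
- apply (zsum_parity M (fun n => Re (f n))), czdom_re, H.
- apply (zsum_parity M (fun n => Im (f n))), czdom_im, H.
Qed.

Lemma czsum_fubini M (f : Z -> Z -> C) :
  (forall m n, Cmod (f m n) <= M * (zdecay m * zdecay n)) ->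
  czsum (fun m => czsum (f m)) = czsum (fun n => czsum (fun m => f m n)).
Proof.
intros H. unfold czsum. simpl. f_equal.
- apply (zsum_fubini M (fun m n => Re (f m n))).
  intros m n. eapply Rle_trans; [apply re_le_Cmod|apply H].
- apply (zsum_fubini M (fun m n => Im (f m n))).
  intros m n. eapply Rle_trans; [apply im_le_Cmod|apply H].
Qed.

(* [j = 2 n + c] runs through the integers congruent to [c] mod 2, so that [c = 0]
   gives theta_3 and [c = 1] gives theta_2, both of nome [exp (-4 d)]. *)
Definition thterm (d : R) (c : Z) (v : C) (n : Z) : C :=
  Cexp (RtoC (- d * IZR (2 * n + c) ^ 2) + Ci * RtoC (IZR (2 * n + c)) * v).

Definition tht (d : R) (c : Z) (v : C) : C := czsum (thterm d c v).

Definition thtd (d : R) (c : Z) (v : C) : C :=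
  czsum (fun n => Ci * RtoC (IZR (2 * n + c)) * thterm d c v n)%C.

(** Completing the square bounds [- d j^2 + |j| (|Im v| + s)]; the part [s |j|] pays for the decay,
    because [|n| <= |j| + |c|]. The rate [s] is left free so that later estimates can spend part of
    it on factors growing with the index. *)
Lemma thterm_bound (d : R) (c : Z) (v : C) (s : R) (n : Z) : 0 < d -> 0 <= s ->
  Cmod (thterm d c v n) <= exp ((Rabs (Im v) + s) ^ 2 / (4 * d) + s * IZR (Z.abs c))
     * exp (- s * IZR (Z.abs n)).
Proof.
intros Hd Hs. unfold thterm. rewrite Cmod_Cexp, <- exp_plus. apply exp_le.
set (j := IZR (2 * n + c)).
replace (Re (RtoC (- d * j ^ 2) + Ci * RtoC j * v)%C) with (- d * j ^ 2 - j * Im v)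
 by (unfold Re, Im; simpl; ring).
set (Y := Rabs (Im v)).
assert (H1 : - (j * Im v) <= Rabs j * Y).
{ unfold Y. rewrite <- Rabs_mult. rewrite <- Rabs_Ropp. apply Rle_abs. }
assert (H2 : IZR (Z.abs n) <= Rabs j + IZR (Z.abs c)).
{ unfold j. rewrite <- abs_IZR. rewrite <- plus_IZR. apply IZR_le. lia. }
assert (H3 : - d * j ^ 2 + Rabs j * (Y + s) <= (Y + s) ^ 2 / (4 * d)).
{ rewrite <- (pow2_abs j).
  replace ((Y + s) ^ 2 / (4 * d)) with (- d * Rabs j ^ 2 + Rabs j * (Y + s) + d * (Rabs j - (Y + s) / (2 * d)) ^ 2) by (field; lra).
  assert (0 <= d * (Rabs j - (Y + s) / (2 * d)) ^ 2) by (apply Rmult_le_pos; [lra|apply pow2_ge_0]). lra. }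
nra.
Qed.

Definition thM (d : R) (c : Z) (Y s : R) : R := exp ((Y + s) ^ 2 / (4 * d) + s * IZR (Z.abs c)).

Lemma thterm_dom (d : R) (c : Z) (v : C) : 0 < d -> czdom (thM d c (Rabs (Im v)) 1) (thterm d c v).
Proof.
intros Hd n. eapply Rle_trans; [apply (thterm_bound d c v 1); lra|].
right. unfold thM, zdecay. f_equal. f_equal. ring.
Qed.

Lemma exp_ge_id (x : R) : x <= exp x.
Proof. pose proof (exp_ineq1_le x). lra. Qed.

Lemma abs_index_exp (n c : Z) : Rabs (IZR (2 * n + c)) <= 2 * IZR (Z.abs n) + IZR (Z.abs c).
Proof.
rewrite <- abs_IZR. rewrite <- mult_IZR, <- plus_IZR. apply IZR_le. lia.
Qed.

(** The new factor satisfies [|j| <= exp |j| <= exp (2 |n| + |c|)], so decay at rate 3 leaves rate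
    1. *)
Lemma thtd_dom (d : R) (c : Z) (v : C) : 0 < d ->
  czdom (exp (IZR (Z.abs c)) * thM d c (Rabs (Im v)) 3)
   (fun n => Ci * RtoC (IZR (2 * n + c)) * thterm d c v n)%C.
Proof.
intros Hd n. rewrite !Cmod_mult, Cmod_Ci, Cmod_R, Rmult_1_l.
eapply Rle_trans.
- apply Rmult_le_compat; [apply Rabs_pos|apply Cmod_ge_0| |apply (thterm_bound d c v 3); lra].
  eapply Rle_trans; [apply exp_ge_id|]. apply exp_le, abs_index_exp.
- right. unfold thM, zdecay. rewrite exp_plus.
  replace (- IZR (Z.abs n)) with (2 * IZR (Z.abs n) + - (3) * IZR (Z.abs n)) by ring.
  rewrite (exp_plus (2 * IZR (Z.abs n)) (- (3) * IZR (Z.abs n))). ring.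
Qed.

Lemma tht_quad_diff (d : R) (c : Z) (v : C) : 0 < d -> quad_diff (tht d c) v (thtd d c v).
Proof.
intros Hd.
(* The 3 is that of [Cexp_taylor2], the 2 that of [j^2 <= 2 exp |j|]. As [|h| <= 1], the remainder
   factor is of size [exp (2 |j|) <= exp (4 |n| + 2 |c|)]; decay at rate 5 absorbs it and leaves
   rate 1. *)
set (K := 3 * exp (2 * IZR (Z.abs c)) * 2 * thM d c (Rabs (Im v)) 5).
assert (HZ : 0 <= zsum zdecay).
{ pose proof (zsum_bound _ _ zdom_decay) as H. pose proof (Rabs_pos (zsum zdecay)). lra. }
assert (HK : 0 <= K).
{ unfold K, thM. repeat apply Rmult_le_pos; try lra; left; apply exp_pos. }
exists (K * (2 * zsum zdecay)), 1. split; [apply Rmult_le_pos; lra|]. split; [lra|].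
intros h Hh.
pose proof (thterm_dom d c (v + h)%C Hd) as D1. pose proof (thterm_dom d c v Hd) as D2.
pose proof (thtd_dom d c v Hd) as D3.
unfold tht, thtd.
replace (czsum (thterm d c (v + h)) - czsum (thterm d c v) -
   h * czsum (fun n => Ci * RtoC (IZR (2 * n + c)) * thterm d c v n))%C
 with (czsum (fun n => thterm d c (v + h) n + ((- RtoC 1) * thterm d c v n + (- h) * (Ci * RtoC (IZR (2 * n + c)) * thterm d c v n)))%C).
2:{ erewrite czsum_plus; [|exact D1|].
    2:{ apply czdom_plus; apply czdom_scal; [apply D2|apply D3]. }
    erewrite czsum_plus; [| apply czdom_scal, D2| apply czdom_scal, D3].
    erewrite !czsum_scal; [| apply D3 | apply D2]. ring. }
replace (K * (2 * zsum zdecay) * Cmod h ^ 2) with (K * Cmod h ^ 2 * (2 * zsum zdecay)) by ring.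
apply czsum_bound. intros n.
set (j := IZR (2 * n + c)).
replace (thterm d c (v + h) n) with (thterm d c v n * Cexp (Ci * RtoC j * h))%C.
2:{ unfold thterm. rewrite <- Cexp_plus. f_equal. unfold j. ring. }
replace (thterm d c v n * Cexp (Ci * RtoC j * h) + (- RtoC 1 * thterm d c v n + - h * (Ci * RtoC j * thterm d c v n)))%C
  with (thterm d c v n * (Cexp (Ci * RtoC j * h) - 1 - Ci * RtoC j * h))%C by ring.
rewrite Cmod_mult.
assert (E1 : Cmod (Ci * RtoC j * h)%C = Rabs j * Cmod h) by (rewrite !Cmod_mult, Cmod_Ci, Cmod_R; ring).
pose proof (Cexp_taylor2 (Ci * RtoC j * h)%C) as HT. rewrite E1 in HT.
pose proof (Rabs_pos j) as Hj. pose proof (Cmod_ge_0 h) as Hh0.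
assert (E2 : Rabs j ^ 2 <= 2 * exp (Rabs j)).
{ pose proof (exp_ge_id (Rabs j / 2)) as Hx.
  pose proof (exp_ineq1_le (Rabs j)) as Hy.
  replace (exp (Rabs j)) with (exp (Rabs j / 2) * exp (Rabs j / 2)) by (rewrite <- exp_plus; f_equal; field).
  assert (He : 0 < exp (Rabs j / 2)) by apply exp_pos.
  (* [1.4 ^ 2 < 2], so squaring gives [E2]. The linear bound comes from squaring
     [exp (x / 4) >= 1 + x / 4]. *)
  assert (Rabs j <= 1.4 * exp (Rabs j / 2)); [|nra].
  assert (Hz : Rabs j / 4 + 1 <= exp (Rabs j / 4)) by (pose proof (exp_ineq1_le (Rabs j / 4)); lra).
  replace (exp (Rabs j / 2)) with (exp (Rabs j / 4) * exp (Rabs j / 4)) by (rewrite <- exp_plus; f_equal; field).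
  assert ((Rabs j / 4 + 1) * (Rabs j / 4 + 1) <= exp (Rabs j / 4) * exp (Rabs j / 4))
    by (apply Rmult_le_compat; lra).
  pose proof (pow2_ge_0 (Rabs j - 2)). nra. }
assert (E3 : exp (Rabs j * Cmod h) <= exp (Rabs j)) by (apply exp_le; nra).
assert (E4 : exp (Rabs j) * exp (Rabs j) <= exp (2 * IZR (Z.abs c)) * exp (4 * IZR (Z.abs n))).
{ rewrite <- !exp_plus. apply exp_le. pose proof (abs_index_exp n c) as Hi. fold j in Hi. lra. }
assert (E5 : 3 * (Rabs j * Cmod h) ^ 2 * exp (Rabs j * Cmod h) <=
  3 * 2 * Cmod h ^ 2 * (exp (2 * IZR (Z.abs c)) * exp (4 * IZR (Z.abs n)))).
{ pose proof (exp_pos (Rabs j * Cmod h)) as P1. pose proof (exp_pos (Rabs j)) as P2.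
  pose proof (pow2_ge_0 (Cmod h)) as P3.
  apply Rle_trans with (3 * 2 * Cmod h ^ 2 * (exp (Rabs j) * exp (Rabs j))).
  2: apply Rmult_le_compat_l; lra.
  replace (3 * (Rabs j * Cmod h) ^ 2 * exp (Rabs j * Cmod h))
    with (3 * Cmod h ^ 2 * (Rabs j ^ 2 * exp (Rabs j * Cmod h))) by ring.
  replace (3 * 2 * Cmod h ^ 2 * (exp (Rabs j) * exp (Rabs j)))
    with (3 * Cmod h ^ 2 * (2 * exp (Rabs j) * exp (Rabs j))) by ring.
  apply Rmult_le_compat_l; [lra|]. apply Rmult_le_compat; try lra. apply pow2_ge_0. }
eapply Rle_trans.
- apply Rmult_le_compat; [apply Cmod_ge_0|apply Cmod_ge_0|apply (thterm_bound d c v 5); lra|].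
  eapply Rle_trans; [apply HT|apply E5].
- right. unfold K, thM, zdecay.
  replace (- IZR (Z.abs n)) with (4 * IZR (Z.abs n) + - (5) * IZR (Z.abs n)) by ring.
  rewrite (exp_plus (4 * IZR (Z.abs n)) (- (5) * IZR (Z.abs n))). ring.
Qed.

Lemma Cexp_2PI (k : Z) : Cexp (Ci * RtoC (IZR k * (2 * PI))) = 1.
Proof.
assert (H : forall k, cos (IZR k * (2 * PI)) = 1 /\ sin (IZR k * (2 * PI)) = 0).
{ clear k. apply Z.bi_induction.
  - intros ? ? ->. tauto.
  - rewrite Rmult_0_l, cos_0, sin_0. auto.
  - intros k. rewrite succ_IZR, Rmult_plus_distr_r, Rmult_1_l, cos_plus, sin_plus, cos_2PI, sin_2PI.
    rewrite !Rmult_1_r, !Rmult_0_r, Rminus_0_r, Rplus_0_r. tauto. }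
destruct (H k) as [H1 H2]. set (x := IZR k * (2 * PI)) in *.
unfold Cexp, Re, Im. simpl. replace (0 * x - 1 * 0) with 0 by ring.
replace (0 * 0 + 1 * x) with x by ring. rewrite H1, H2, exp_0.
apply C_eq; simpl; ring.
Qed.

Lemma tht_period (d : R) (c : Z) (v : C) : 0 < d -> tht d (c + 2) v = tht d c v.
Proof.
intros Hd. unfold tht. rewrite <- (czsum_shift _ _ 1 (thterm_dom d c v Hd)).
apply czsum_ext. intros n. unfold thterm. now replace (2 * (n + 1) + c)%Z with (2 * n + (c + 2))%Z by ring.
Qed.

(** The reflection [n -> -c - n] sends the index [j = 2 n + c] to [-j]. *)
Lemma tht_even (d : R) (c : Z) (v : C) : 0 < d -> tht d c (- v) = tht d c v.
Proof.
intros Hd. unfold tht. rewrite <- (czsum_reflect _ _ (- c) (thterm_dom d c v Hd)).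
apply czsum_ext. intros n. unfold thterm. replace (2 * (- c - n) + c)%Z with (- (2 * n + c))%Z by ring.
rewrite opp_IZR. f_equal. f_equal.
- f_equal. ring.
- rewrite RtoC_opp. ring.
Qed.

Lemma Cexp_conj (z : C) : Cconj (Cexp z) = Cexp (Cconj z).
Proof.
destruct z as [x y]. unfold Cexp, Cconj, Re, Im. simpl. rewrite cos_neg, sin_neg.
f_equal. ring.
Qed.

Lemma zsum_opp g : zsum (fun n => - g n) = - zsum g.
Proof.
rewrite (zsum_ext _ (fun n => -1 * g n)) by (intros; ring). rewrite zsum_scal. ring.
Qed.

Lemma tht_conj (d : R) (c : Z) (v : C) : 0 < d -> Cconj (tht d c v) = tht d c (Cconj v).
Proof.
intros Hd. rewrite <- (tht_even d c (Cconj v) Hd).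
assert (H : forall n, thterm d c (- Cconj v) n = Cconj (thterm d c v n)).
{ intros n. unfold thterm. rewrite Cexp_conj. f_equal.
  destruct v as [x y]. unfold Cconj. apply C_eq; unfold Re, Im; simpl; ring. }
apply C_eq.
- rewrite re_conj. apply zsum_ext. intros n. now rewrite H, re_conj.
- rewrite im_conj. change (- zsum (fun n => Im (thterm d c v n)) = zsum (fun n => Im (thterm d c (- Cconj v) n))).
  rewrite <- zsum_opp. apply zsum_ext. intros n. now rewrite H, im_conj.
Qed.

(** All [j = 2 n + c] have the parity of [c], so the factor [e^(i j PI)] is common to all terms. *)
Lemma thterm_shift_PI (d : R) (c : Z) (v : C) (n : Z) :
  thterm d c (v + RtoC PI) n = (Cexp (Ci * RtoC (IZR c * PI)) * thterm d c v n)%C.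
Proof.
unfold thterm. rewrite <- Cexp_plus.
rewrite <- (Cmult_1_l (Cexp (Ci * RtoC (IZR c * PI) + _))).
rewrite <- (Cexp_2PI n), <- Cexp_plus. f_equal.
rewrite plus_IZR, mult_IZR, !RtoC_mult, RtoC_plus, !RtoC_mult. ring.
Qed.

Lemma tht_shift_PI (d : R) (c : Z) (v : C) : 0 < d ->
  tht d c (v + RtoC PI) = (Cexp (Ci * RtoC (IZR c * PI)) * tht d c v)%C.
Proof.
intros Hd. unfold tht. rewrite <- (czsum_scal _ _ _ (thterm_dom d c v Hd)).
apply czsum_ext. intros n. apply thterm_shift_PI.
Qed.

Lemma tht_0_shift_PI (d : R) (v : C) : 0 < d -> tht d 0 (v + RtoC PI) = tht d 0 v.
Proof.
intros Hd. rewrite tht_shift_PI by auto. rewrite Rmult_0_l, Cmult_0_r, Cexp_0. ring.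
Qed.

Lemma Cexp_PI : Cexp (Ci * RtoC (1 * PI)) = (- RtoC 1)%C.
Proof.
unfold Cexp, Re, Im; simpl. replace (0 * (1 * PI) - 1 * 0) with 0 by ring.
replace (0 * 0 + 1 * (1 * PI)) with PI by ring. rewrite exp_0, cos_PI, sin_PI.
apply C_eq; simpl; ring.
Qed.

Lemma tht_1_shift_PI (d : R) (v : C) : 0 < d -> tht d 1 (v + RtoC PI) = (- tht d 1 v)%C.
Proof. intros Hd. rewrite tht_shift_PI by auto. rewrite Cexp_PI. ring. Qed.

(** [(p + r)^2 + (p - r)^2 = 2 p^2 + 2 r^2] separates the exponent; the factor 2 is why [d] doubles,
    that is, why the nome is squared. *)
Lemma thterm_mult (d : R) (c c1 c2 : Z) (x y : C) (m n l j : Z) :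
  (2 * m + c = 2 * l + c1 + (2 * j + c2))%Z -> (2 * n + c = 2 * l + c1 - (2 * j + c2))%Z ->
  (thterm d c (x + y) m * thterm d c (x - y) n = thterm (2 * d) c1 (2 * x) l * thterm (2 * d) c2 (2 * y) j)%C.
Proof.
intros Hm Hn. unfold thterm. rewrite <- !Cexp_plus, Hm, Hn, plus_IZR, minus_IZR. f_equal.
generalize (IZR (2 * l + c1)) (IZR (2 * j + c2)). intros p r.
replace (- d * (p + r) ^ 2) with (- (2 * d) * p ^ 2 + - (2 * d) * r ^ 2 - (- d * (p - r) ^ 2)) by ring.
rewrite (RtoC_plus p r), (RtoC_minus p r), RtoC_minus, RtoC_plus. ring.
Qed.

(* Put [m + n = p]; the inner sums then only depend on the parity of [p]. *)
Lemma tht_mult (d : R) (c : Z) (x y : C) : 0 < d ->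
  (tht d c (x + y) * tht d c (x - y))%C =
  (tht (2 * d) c (2 * x) * tht (2 * d) 0 (2 * y)
   + tht (2 * d) (c + 1) (2 * x) * tht (2 * d) 1 (2 * y))%C.
Proof.
intros Hd.
assert (Hd2 : 0 < 2 * d) by lra.
pose proof (thterm_dom d c (x + y)%C Hd) as D1. pose proof (thterm_dom d c (x - y)%C Hd) as D2.
set (F := thterm d c (x + y)) in *. set (G := thterm d c (x - y)) in *.
set (f := fun m p : Z => (F m * G (p - m)%Z)%C).
(* Rate 2 in one factor: [2 |m| + |p - m| >= |m| + |p|], so the product decays in [m] and in [p], as
   [czsum_fubini] requires. *)
set (M1 := thM d c (Rabs (Im (x + y)%C)) 2). set (M2 := thM d c (Rabs (Im (x - y)%C)) 1).
assert (Hf : forall m p, Cmod (f m p) <= M1 * M2 * (zdecay m * zdecay p)).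
{ intros m p. unfold f. rewrite Cmod_mult.
  eapply Rle_trans.
  - apply Rmult_le_compat; [apply Cmod_ge_0|apply Cmod_ge_0|apply (thterm_bound d c (x + y) 2); lra|].
    apply (thterm_bound d c (x - y) 1); lra.
  - fold (thM d c (Rabs (Im (x + y)%C)) 2). fold (thM d c (Rabs (Im (x - y)%C)) 1).
    fold M1 M2.
    replace (M1 * exp (- (2) * IZR (Z.abs m)) * (M2 * exp (- (1) * IZR (Z.abs (p - m)))))
     with (M1 * M2 * (exp (- (2) * IZR (Z.abs m)) * exp (- (1) * IZR (Z.abs (p - m))))) by ring.
    apply Rmult_le_compat_l.
    + left. apply Rmult_lt_0_compat; apply exp_pos.
    + unfold zdecay. rewrite <- !exp_plus. apply exp_le.
      assert (IZR (Z.abs p) <= IZR (Z.abs m) + IZR (Z.abs (p - m))).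
      { rewrite <- plus_IZR. apply IZR_le. lia. }
      lra. }
assert (HP : (tht d c (x + y) * tht d c (x - y))%C = czsum (fun p => czsum (fun m => f m p))).
{ rewrite <- (czsum_fubini (M1 * M2) f Hf).
  unfold tht. fold F G. rewrite Cmult_comm.
  rewrite <- (czsum_scal _ _ _ D1). apply czsum_ext. intros m.
  rewrite Cmult_comm. rewrite <- (czsum_scal _ _ _ D2).
  unfold f. symmetry.
  rewrite <- (czsum_shift _ (fun n => F m * G n)%C (- m) (czdom_scal _ _ _ D2)).
  apply czsum_ext. intros n. do 2 f_equal. }
rewrite HP.
assert (Hc : forall p, czdom (M1 * M2 * zdecay p) (fun m => f m p)).
{ intros p m. replace (M1 * M2 * zdecay p * zdecay m) with (M1 * M2 * (zdecay m * zdecay p)) by ring. apply Hf. }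
rewrite (czsum_parity (M1 * M2 * (2 * zsum zdecay))).
2:{ intros p. replace (M1 * M2 * (2 * zsum zdecay) * zdecay p) with (M1 * M2 * zdecay p * (2 * zsum zdecay)) by ring.
    apply czsum_bound, Hc. }
f_equal.
- unfold tht at 1. rewrite Cmult_comm. rewrite <- (czsum_scal _ _ _ (thterm_dom _ _ _ Hd2)).
  apply czsum_ext. intros l. rewrite Cmult_comm. unfold tht.
  rewrite <- (czsum_scal _ _ _ (thterm_dom _ _ _ Hd2)).
  rewrite <- (czsum_shift _ _ l (Hc (2 * l)%Z)). apply czsum_ext. intros j.
  apply thterm_mult; ring.
- unfold tht at 1. rewrite Cmult_comm. rewrite <- (czsum_scal _ _ _ (thterm_dom _ _ _ Hd2)).
  apply czsum_ext. intros l. rewrite Cmult_comm. unfold tht.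
  rewrite <- (czsum_scal _ _ _ (thterm_dom _ _ _ Hd2)).
  (* For [p = 2 l + 1] the two indices become [l + j + 1] and [l - j]; the asymmetric shift matches
     the odd residue 1 in both factors. *)
  rewrite <- (czsum_shift _ _ (l + 1) (Hc (2 * l + 1)%Z)). apply czsum_ext. intros j.
  apply thterm_mult; ring.
Qed.

(** * Addition and derivative formulas *)

Section Theta.

Variable d : R.
Hypothesis Hd : 0 < d.

Let Hd2 : 0 < 2 * d. Proof. lra. Qed.

(** With nome [q = exp (-4 d)], [thH] and [thT] are theta_1 and theta_4, Jacobi's H and Theta in a
    rescaled variable; [thA] and [thB] are theta_3 and theta_2 of nome [q^2] at [2 v]. *)
Definition thA (v : C) : C := tht (2 * d) 0 (2 * v).
Definition thB (v : C) : C := tht (2 * d) 1 (2 * v).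
Definition thH (v : C) : C := (- tht d 1 (v + RtoC (PI / 2)))%C.
Definition thT (v : C) : C := tht d 0 (v + RtoC (PI / 2)).

Lemma thA_even v : thA (- v) = thA v.
Proof. unfold thA. rewrite <- tht_even by auto. f_equal. ring. Qed.
Lemma thB_even v : thB (- v) = thB v.
Proof. unfold thB. rewrite <- tht_even by auto. f_equal. ring. Qed.
Lemma thA_conj v : Cconj (thA v) = thA (Cconj v).
Proof. unfold thA. rewrite tht_conj by auto. f_equal. destruct v; apply C_eq; unfold Re, Im, Cconj; simpl; ring. Qed.
Lemma thB_conj v : Cconj (thB v) = thB (Cconj v).
Proof. unfold thB. rewrite tht_conj by auto. f_equal. destruct v; apply C_eq; unfold Re, Im, Cconj; simpl; ring. Qed.

Lemma RtoC_PI2 : (RtoC (PI / 2) + RtoC (PI / 2))%C = RtoC PI.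
Proof. rewrite <- RtoC_plus. f_equal. field. Qed.

Lemma thH_odd v : thH (- v) = (- thH v)%C.
Proof.
unfold thH. rewrite <- (tht_even d 1 (- v + _)) by auto.
replace (v + RtoC (PI / 2))%C with (- (- v + RtoC (PI / 2)) + RtoC PI)%C.
- rewrite tht_1_shift_PI by auto. ring.
- rewrite <- RtoC_PI2. ring.
Qed.

Lemma thT_even v : thT (- v) = thT v.
Proof.
unfold thT. rewrite <- (tht_even d 0 (- v + _)) by auto.
replace (v + RtoC (PI / 2))%C with (- (- v + RtoC (PI / 2)) + RtoC PI)%C.
- now rewrite tht_0_shift_PI by auto.
- rewrite <- RtoC_PI2. ring.
Qed.

Lemma thH_conj v : Cconj (thH v) = thH (Cconj v).
Proof.
unfold thH. rewrite Copp_conj, tht_conj by auto. do 2 f_equal. destruct v; apply C_eq; unfold Re, Im, Cconj; simpl; ring.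
Qed.
Lemma thT_conj v : Cconj (thT v) = thT (Cconj v).
Proof. unfold thT. rewrite tht_conj by auto. f_equal. destruct v; apply C_eq; unfold Re, Im, Cconj; simpl; ring. Qed.

Lemma thA_shift v : thA (v + RtoC (PI / 2)) = thA v.
Proof.
unfold thA. rewrite <- (tht_0_shift_PI (2 * d) (2 * v)) by auto. f_equal. rewrite <- RtoC_PI2. ring.
Qed.
Lemma thB_shift v : thB (v + RtoC (PI / 2)) = (- thB v)%C.
Proof.
unfold thB. rewrite <- (tht_1_shift_PI (2 * d) (2 * v)) by auto. f_equal. rewrite <- RtoC_PI2. ring.
Qed.

Lemma t0_mult x y : (tht d 0 (x + y) * tht d 0 (x - y) = thA x * thA y + thB x * thB y)%C.
Proof. apply (tht_mult d 0); auto. Qed.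

Lemma t1_mult x y : (tht d 1 (x + y) * tht d 1 (x - y) = thB x * thA y + thA x * thB y)%C.
Proof.
rewrite (tht_mult d 1) by auto. unfold thA, thB. f_equal. f_equal.
apply (tht_period _ 0); auto.
Qed.

(** This is [t0_mult] with [x] moved by [PI / 2], which changes the sign of [thB] but not of
    [thA]. *)
Lemma thT_mult x y : (thT (x + y) * thT (x - y) = thA x * thA y - thB x * thB y)%C.
Proof.
unfold thT. replace (x + y + RtoC (PI / 2))%C with (x + RtoC (PI / 2) + y)%C by ring.
replace (x - y + RtoC (PI / 2))%C with (x + RtoC (PI / 2) - y)%C by ring.
rewrite t0_mult, thA_shift, thB_shift. ring.
Qed.

Lemma thH_mult x y : (thH (x + y) * thH (x - y) = thA x * thB y - thB x * thA y)%C.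
Proof.
unfold thH. replace (x + y + RtoC (PI / 2))%C with (x + RtoC (PI / 2) + y)%C by ring.
replace (x - y + RtoC (PI / 2))%C with (x + RtoC (PI / 2) - y)%C by ring.
match goal with |- (- ?p * - ?q = _)%C => replace (- p * - q)%C with (p * q)%C by ring end.
rewrite t1_mult, thA_shift, thB_shift. ring.
Qed.

Lemma t0_dbl x : (tht d 0 (2 * x) * tht d 0 0 = thA x * thA x + thB x * thB x)%C.
Proof. rewrite <- t0_mult. f_equal; f_equal; ring. Qed.

Lemma t1_dbl x : (tht d 1 (2 * x) * tht d 1 0 = thB x * thA x + thA x * thB x)%C.
Proof. rewrite <- t1_mult. f_equal; f_equal; ring. Qed.

Definition thA' (v : C) : C := (2 * thtd (2 * d) 0 (2 * v))%C.
Definition thB' (v : C) : C := (2 * thtd (2 * d) 1 (2 * v))%C.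
Definition thH' (v : C) : C := (- thtd d 1 (v + RtoC (PI / 2)))%C.
Definition thT' (v : C) : C := thtd d 0 (v + RtoC (PI / 2)).

Lemma thA_diff v : quad_diff thA v (thA' v).
Proof.
apply quad_diff_ext with (fun x => tht (2 * d) 0 (2 * x + 0)%C).
- intros x. unfold thA. f_equal. ring.
- apply quad_diff_affine. replace (2 * v + 0)%C with (2 * v)%C by ring. now apply tht_quad_diff.
Qed.
Lemma thB_diff v : quad_diff thB v (thB' v).
Proof.
apply quad_diff_ext with (fun x => tht (2 * d) 1 (2 * x + 0)%C).
- intros x. unfold thB. f_equal. ring.
- apply quad_diff_affine. replace (2 * v + 0)%C with (2 * v)%C by ring. now apply tht_quad_diff.
Qed.
Lemma thT_diff v : quad_diff thT v (thT' v).
Proof.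
apply quad_diff_ext with (fun x => tht d 0 (1 * x + RtoC (PI / 2))%C).
- intros x. unfold thT. f_equal. ring.
- unfold thT'. replace (thtd d 0 (v + RtoC (PI / 2))) with (1 * thtd d 0 (1 * v + RtoC (PI / 2)))%C
    by (rewrite !Cmult_1_l; ring).
  apply quad_diff_affine. now apply tht_quad_diff.
Qed.
Lemma thH_diff v : quad_diff thH v (thH' v).
Proof.
apply quad_diff_ext with (fun x => 0 - tht d 1 (1 * x + RtoC (PI / 2)))%C.
- intros x. unfold thH. rewrite Cmult_1_l. ring.
- unfold thH'. replace (- thtd d 1 (v + RtoC (PI / 2)))%C with (0 - 1 * thtd d 1 (1 * v + RtoC (PI / 2)))%C
    by (rewrite !Cmult_1_l; ring).
  apply quad_diff_minus; [apply quad_diff_const|].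
  apply quad_diff_affine. now apply tht_quad_diff.
Qed.

Lemma thH_0 : thH 0 = 0.
Proof.
pose proof (thH_odd 0) as H. replace (- 0)%C with (RtoC 0) in H by ring.
assert (E : (2 * thH 0)%C = 0).
{ replace (2 * thH 0)%C with (thH 0 + thH 0)%C by ring. rewrite H at 1. ring. }
apply C_eq.
- apply (f_equal Re) in E. unfold Re in *. simpl in *. lra.
- apply (f_equal Im) in E. unfold Im in *. simpl in *. lra.
Qed.

(** Derivative of [thH_mult] in [x] at [x = y]: since [thH 0 = 0], only the term that differentiates
    the factor [thH (x - y)] survives. *)
Lemma thD_eq y : (thA' y * thB y - thB' y * thA y = thH (2 * y) * thH' 0)%C.
Proof.
assert (H1 : quad_diff (fun x => thA x * thB y - thB x * thA y)%C y (thA' y * thB y - thB' y * thA y)%C).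
{ apply quad_diff_minus.
  - replace (thA' y * thB y)%C with (thA' y * thB y + thA y * 0)%C by ring.
    apply (quad_diff_mult thA (fun _ => thB y)); [apply thA_diff|apply quad_diff_const].
  - replace (thB' y * thA y)%C with (thB' y * thA y + thB y * 0)%C by ring.
    apply (quad_diff_mult thB (fun _ => thA y)); [apply thB_diff|apply quad_diff_const]. }
apply (quad_diff_unique _ _ _ _ H1).
apply quad_diff_ext with (fun x => thH (1 * x + y) * thH (1 * x + - y))%C.
- intros x. rewrite <- thH_mult. f_equal; f_equal; ring.
- replace (thH (2 * y) * thH' 0)%C with ((1 * thH' (1 * y + y)) * thH (1 * y + - y) + thH (1 * y + y) * (1 * thH' (1 * y + - y)))%C.
  + apply (quad_diff_mult (fun x => thH (1 * x + y)%C) (fun x => thH (1 * x + - y)%C)).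
    * apply quad_diff_affine, thH_diff.
    * apply quad_diff_affine, thH_diff.
  + replace (1 * y + - y)%C with (RtoC 0) by ring. rewrite thH_0.
    replace (1 * y + y)%C with (2 * y)%C by ring. ring.
Qed.

(** By [thD_eq] the square of the Wronskian of [thA] and [thB] is a multiple of [thH (2 x)^2]. That
    square is a combination of the squares of theta_3 and theta_2 at [2 x], and the duplication
    formulas turn these into quartics at [x]. The factors in [a], [b] on the left clear the
    denominators. *)
Lemma thD_sq (x : C) :
  let a := thA 0 in let b := thB 0 in
  (a * b * (a * a + b * b) * (a * a - b * b) *
    ((thA' x * thB x - thB' x * thA x) * (thA' x * thB x - thB' x * thA x)) =
   2 * (thH' 0 * thH' 0) *
   ((a * b * (thA x * thA x + thB x * thB x)) * (a * b * (thA x * thA x + thB x * thB x))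
    - ((a * a + b * b) * (thA x * thB x)) * ((a * a + b * b) * (thA x * thB x))))%C.
Proof.
intros a b. rewrite thD_eq.
pose proof (thH_mult (2 * x) 0) as E1. pose proof (t0_mult (2 * x) 0) as E2.
pose proof (t1_mult (2 * x) 0) as E3. pose proof (t0_dbl x) as E4. pose proof (t1_dbl x) as E5.
pose proof (t0_mult 0 0) as E6. pose proof (t1_mult 0 0) as E7.
fold a b in E1, E2, E3, E6, E7.
replace (2 * x + 0)%C with (2 * x)%C in * by ring.
replace (2 * x - 0)%C with (2 * x)%C in * by ring.
replace (0 + 0)%C with (RtoC 0) in * by ring.
replace (0 - 0)%C with (RtoC 0) in * by ring.
set (P := thA (2 * x)) in *. set (Q := thB (2 * x)) in *.
set (t0 := tht d 0 (2 * x)) in *. set (t1 := tht d 1 (2 * x)) in *.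
set (c0 := tht d 0 0) in *. set (c1 := tht d 1 0) in *.
set (h := thH (2 * x)) in *. set (h' := thH' 0) in *.
transitivity (h' * h' * (a * b * (a * a + b * b) * (a * a - b * b)) * (h * h))%C; [ring|].
rewrite E1.
(* The factor [a^2 - b^2] makes [P b - Q a] a combination of [P a + Q b] and [Q a + P b], which are
   the squares [t0^2] and [t1^2]. *)
transitivity (h' * h' * (a * b * (a * a + b * b)) * (2 * (a * b) * (P * a + Q * b) - (a * a + b * b) * (Q * a + P * b)))%C; [ring|].
rewrite <- E2, <- E3.
transitivity (h' * h' * (2 * (a * b * a * b) * ((a * a + b * b) * (t0 * t0)) - (a * a + b * b) * (a * a + b * b) * ((a * b) * (t1 * t1))))%C; [ring|].
(* [a^2 + b^2 = c0^2] and [2 a b = c1^2] supply the theta constants that the duplication formulas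
   ask for. *)
rewrite <- E6 at 1.
replace (c0 * c0 * (t0 * t0))%C with ((t0 * c0) * (t0 * c0))%C by ring. rewrite E4.
replace (a * b * (t1 * t1))%C with ((t1 * c1) * (t1 * c1) / 2)%C.
- rewrite E5. field.
- transitivity ((c1 * c1) * (t1 * t1) / 2)%C.
  + unfold Cdiv. ring.
  + rewrite E7. field.
Qed.

End Theta.

(** * Theta functions on the two axes *)

Lemma C_real (z : C) : Cconj z = z -> z = RtoC (Re z).
Proof.
intros H. apply C_eq; [reflexivity|]. apply (f_equal Im) in H. rewrite im_conj in H.
change (Im (RtoC (Re z))) with 0. lra.
Qed.

Lemma C_imag (z : C) : Cconj z = (- z)%C -> z = (Ci * RtoC (Im z))%C.
Proof.
intros H. apply (f_equal Re) in H. rewrite re_conj in H.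
destruct z as [x y]. unfold Re, Im in *. simpl in H. apply C_eq; unfold Re, Im; simpl; lra.
Qed.

Lemma Cconj_R (x : R) : Cconj (RtoC x) = RtoC x.
Proof. apply C_eq; unfold Re, Im, Cconj, RtoC; simpl; ring. Qed.

Lemma zsum_pos M g : zdom M g -> (forall n, 0 < g n) -> 0 < zsum g.
Proof.
intros H Hp. unfold zsum. rewrite Series_incr_1 by (eapply zdom_ex; eauto).
pose proof (Hp (Z.of_nat 0)). pose proof (Hp (- Z.of_nat 0 - 1)%Z).
match goal with |- 0 < _ + ?S => assert (0 <= S); [|lra] end.
assert (HZ : Series (fun _ : nat => 0) = 0).
{ rewrite (Series_ext (fun _ => 0) (fun _ : nat => 0 * 0)) by (intros; ring). now rewrite Series_scal_l, Rmult_0_l. }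
rewrite <- HZ.
apply Series_le.
- intros n. pose proof (Hp (Z.of_nat (S n))). pose proof (Hp (- Z.of_nat (S n) - 1)%Z). lra.
- apply (ex_series_incr_1 (fun n => g (Z.of_nat n) + g (- Z.of_nat n - 1)%Z)). eapply zdom_ex; eauto.
Qed.

(** On the imaginary axis every term of the series is a positive real exponential. *)
Lemma tht_imag_pos (d : R) (c : Z) (y : R) : 0 < d -> 0 < Re (tht d c (Ci * RtoC y)).
Proof.
intros Hd. unfold tht, czsum. simpl.
apply (zsum_pos _ _ (czdom_re _ _ (thterm_dom d c (Ci * RtoC y)%C Hd))).
intros n. unfold thterm, Cexp. set (j := IZR (2 * n + c)).
replace (Im (RtoC (- d * j ^ 2) + Ci * RtoC j * (Ci * RtoC y))%C) with 0 by (unfold Re, Im; simpl; ring).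
rewrite cos_0. simpl. pose proof (exp_pos (Re (RtoC (- d * j ^ 2) + Ci * RtoC j * (Ci * RtoC y))%C)) as He.
unfold Re in *. simpl in *. lra.
Qed.

(** Real and imaginary directions are treated together: an even function that commutes with
    conjugation is real along both. *)
Definition axis (e : C) : Prop := Cconj e = e \/ Cconj e = (- e)%C.

Lemma axis_real (x : R) : axis (RtoC x).
Proof. left. apply Cconj_R. Qed.

Lemma axis_imag (x : R) : axis (Ci * RtoC x).
Proof. right. apply C_eq; unfold Re, Im, Cconj, RtoC; simpl; ring. Qed.

Section EvenAxis.

Variables F F' : C -> C.
Hypothesis Fdiff : forall v, quad_diff F v (F' v).
Hypothesis Fconj : forall v, Cconj (F v) = F (Cconj v).
Hypothesis Feven : forall v, F (- v) = F v.

Lemma even_axis_real e s : axis e -> F (RtoC s * e) = RtoC (Re (F (RtoC s * e))).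
Proof.
intros He. apply C_real. rewrite Fconj, Cmult_conj, Cconj_R.
destruct He as [-> | ->]; [reflexivity|]. rewrite <- Feven. f_equal. ring.
Qed.

Lemma axis_derive e s : is_derive (fun s => Re (F (RtoC s * e))) s (Re (e * F' (RtoC s * e))%C) /\
  is_derive (fun s => Im (F (RtoC s * e))) s (Im (e * F' (RtoC s * e))%C).
Proof.
destruct (quad_diff_line F 0 e (F' (RtoC s * e)%C) s) as [H1 H2].
- rewrite Cplus_0_l. apply Fdiff.
- split; (eapply is_derive_ext; [|eassumption]); intros t; simpl; now rewrite Cplus_0_l.
Qed.

(** [F] is real all along the axis, so the imaginary part of its directional derivative [e * F'] is
    the derivative of 0. *)
Lemma even_axis_derive_real e s : axis e -> (e * F' (RtoC s * e))%C = RtoC (Re (e * F' (RtoC s * e))%C).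
Proof.
intros He. apply C_eq; [reflexivity|].
destruct (axis_derive e s) as [_ H].
assert (H0 : is_derive (fun s => Im (F (RtoC s * e))) s 0).
{ apply (is_derive_ext (fun _ => 0)); [|apply is_derive_cst].
  intros t. now rewrite (even_axis_real e t He). }
apply is_derive_unique in H. apply is_derive_unique in H0.
change (Im (RtoC (Re (e * F' (RtoC s * e))%C))) with 0. congruence.
Qed.

End EvenAxis.

Section ThetaAxis.

Variable d : R.
Hypothesis Hd : 0 < d.

Definition axA (e : C) (s : R) : R := Re (thA d (RtoC s * e)).
Definition axB (e : C) (s : R) : R := Re (thB d (RtoC s * e)).
Definition axT (e : C) (s : R) : R := Re (thT d (RtoC s * e)).
Definition axA' (e : C) (s : R) : R := Re (e * thA' d (RtoC s * e))%C.
Definition axB' (e : C) (s : R) : R := Re (e * thB' d (RtoC s * e))%C.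
Definition axT' (e : C) (s : R) : R := Re (e * thT' d (RtoC s * e))%C.
Definition thA0 : R := Re (thA d 0).
Definition thB0 : R := Re (thB d 0).
Definition thH0' : R := Re (thH' d 0).

Lemma axA_eq e s : axis e -> thA d (RtoC s * e) = RtoC (axA e s).
Proof. apply (even_axis_real (thA d)); auto using thA_conj, thA_even. Qed.
Lemma axB_eq e s : axis e -> thB d (RtoC s * e) = RtoC (axB e s).
Proof. apply (even_axis_real (thB d)); auto using thB_conj, thB_even. Qed.
Lemma axT_eq e s : axis e -> thT d (RtoC s * e) = RtoC (axT e s).
Proof. apply (even_axis_real (thT d)); auto using thT_conj, thT_even. Qed.
Lemma axA'_eq e s : axis e -> (e * thA' d (RtoC s * e))%C = RtoC (axA' e s).
Proof. apply (even_axis_derive_real (thA d)); auto using thA_conj, thA_even, thA_diff. Qed.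
Lemma axB'_eq e s : axis e -> (e * thB' d (RtoC s * e))%C = RtoC (axB' e s).
Proof. apply (even_axis_derive_real (thB d)); auto using thB_conj, thB_even, thB_diff. Qed.
Lemma axT'_eq e s : axis e -> (e * thT' d (RtoC s * e))%C = RtoC (axT' e s).
Proof. apply (even_axis_derive_real (thT d)); auto using thT_conj, thT_even, thT_diff. Qed.
Lemma axA_derive e s : is_derive (axA e) s (axA' e s).
Proof. apply (axis_derive (thA d) (thA' d) (thA_diff d Hd) e s). Qed.
Lemma axB_derive e s : is_derive (axB e) s (axB' e s).
Proof. apply (axis_derive (thB d) (thB' d) (thB_diff d Hd) e s). Qed.
Lemma axT_derive e s : is_derive (axT e) s (axT' e s).
Proof. apply (axis_derive (thT d) (thT' d) (thT_diff d Hd) e s). Qed.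

Lemma thA0_eq : thA d 0 = RtoC thA0.
Proof. apply C_real. rewrite thA_conj by auto. f_equal. apply Cconj_R. Qed.
Lemma thB0_eq : thB d 0 = RtoC thB0.
Proof. apply C_real. rewrite thB_conj by auto. f_equal. apply Cconj_R. Qed.
Lemma axA_0 e : axA e 0 = thA0.
Proof. unfold axA, thA0. now rewrite Cmult_0_l. Qed.
Lemma axB_0 e : axB e 0 = thB0.
Proof. unfold axB, thB0. now rewrite Cmult_0_l. Qed.

Lemma axA_imag_pos x s : 0 < axA (Ci * RtoC x) s.
Proof.
unfold axA, thA. replace (2 * (RtoC s * (Ci * RtoC x)))%C with (Ci * RtoC (2 * s * x))%C
 by (rewrite !RtoC_mult; ring). apply tht_imag_pos. lra.
Qed.
Lemma axB_imag_pos x s : 0 < axB (Ci * RtoC x) s.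
Proof.
unfold axB, thB. replace (2 * (RtoC s * (Ci * RtoC x)))%C with (Ci * RtoC (2 * s * x))%C
 by (rewrite !RtoC_mult; ring). apply tht_imag_pos. lra.
Qed.
Lemma thA0_pos : 0 < thA0.
Proof. rewrite <- (axA_0 (Ci * RtoC 0)). apply axA_imag_pos. Qed.
Lemma thB0_pos : 0 < thB0.
Proof. rewrite <- (axB_0 (Ci * RtoC 0)). apply axB_imag_pos. Qed.

Lemma thH_real t : thH d (RtoC t) = RtoC (Re (thH d (RtoC t))).
Proof. apply C_real. now rewrite thH_conj, Cconj_R by auto. Qed.

Lemma thH0'_eq : thH' d 0 = RtoC thH0'.
Proof.
apply C_eq; [reflexivity|]. change (Im (RtoC thH0')) with 0.
destruct (axis_derive (thH d) (thH' d) (thH_diff d Hd) 1 0) as [_ H].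
assert (H0 : is_derive (fun s => Im (thH d (RtoC s * 1))) 0 0).
{ apply (is_derive_ext (fun _ => 0)); [|apply is_derive_cst].
  intros t. rewrite Cmult_1_r, thH_real. reflexivity. }
apply is_derive_unique in H. apply is_derive_unique in H0.
rewrite H in H0. rewrite Cmult_1_l, Cmult_1_r in H0. exact H0.
Qed.

Lemma axT_sq e s : axis e -> axT e s ^ 2 = axA e s * thA0 - axB e s * thB0.
Proof.
intros He. pose proof (thT_mult d Hd (RtoC s * e) 0) as H.
replace (RtoC s * e + 0)%C with (RtoC s * e)%C in H by ring.
replace (RtoC s * e - 0)%C with (RtoC s * e)%C in H by ring.
rewrite axT_eq, axA_eq, axB_eq, thA0_eq, thB0_eq in H by auto.
rewrite <- !RtoC_mult, <- RtoC_minus in H. apply RtoC_inj in H. lra.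
Qed.

Lemma thH_sq v : (thH d v * thH d v = thA d v * RtoC thB0 - thB d v * RtoC thA0)%C.
Proof.
pose proof (thH_mult d Hd v 0) as H.
replace (v + 0)%C with v in H by ring. replace (v - 0)%C with v in H by ring.
now rewrite thA0_eq, thB0_eq in H.
Qed.

Lemma thH_imag y : thH d (Ci * RtoC y) = (Ci * RtoC (Im (thH d (Ci * RtoC y))))%C.
Proof.
apply C_imag. rewrite thH_conj, <- thH_odd by auto. f_equal.
apply C_eq; unfold Re, Im, Cconj, RtoC; simpl; ring.
Qed.

(** Conjugation turns [x - y] into [x + y] for real [x] and imaginary [y], so the squared modulus is
    the left side of the addition theorem. *)
Lemma thH_mixed (l t y : R) :
  Cmod (thH d (RtoC t * RtoC l - RtoC y * (Ci * RtoC l))) ^ 2 =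
  axA (RtoC l) t * axB (Ci * RtoC l) y - axB (RtoC l) t * axA (Ci * RtoC l) y.
Proof.
apply RtoC_inj. rewrite Cmod2_conj, thH_conj by auto.
replace (Cconj (RtoC t * RtoC l - RtoC y * (Ci * RtoC l)))%C with (RtoC t * RtoC l + RtoC y * (Ci * RtoC l))%C.
- rewrite Cmult_comm, thH_mult by auto.
  rewrite !axA_eq, !axB_eq by (apply axis_real || apply axis_imag).
  now rewrite <- !RtoC_mult, <- RtoC_minus.
- apply C_eq; unfold Re, Im, Cconj, RtoC; simpl; ring.
Qed.

(** This is [thD_sq] multiplied by [e * e], which turns derivatives in [v] into derivatives along
    the axis. The axis enters only through [eps], positive on the real and negative on the imaginary
    one. *)
Lemma axis_quartic e (eps s : R) : axis e -> (e * e)%C = RtoC eps ->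
  thA0 * thB0 * (thA0 * thA0 + thB0 * thB0) * (thA0 * thA0 - thB0 * thB0)
   * (axA' e s * axB e s - axB' e s * axA e s) ^ 2 =
  eps * 2 * thH0' ^ 2 *
   ((thA0 * thB0 * (axA e s * axA e s + axB e s * axB e s)) ^ 2
    - ((thA0 * thA0 + thB0 * thB0) * (axA e s * axB e s)) ^ 2).
Proof.
intros He Hee. pose proof (thD_sq d Hd (RtoC s * e)) as H. cbv zeta in H.
apply (f_equal (fun z => (e * e) * z)%C) in H.
rewrite thA0_eq, thB0_eq, thH0'_eq in H.
match type of H with (?l = ?r)%C => set (rr := r) in H end.
replace (e * e * (RtoC thA0 * RtoC thB0 * (RtoC thA0 * RtoC thA0 + RtoC thB0 * RtoC thB0) *
      (RtoC thA0 * RtoC thA0 - RtoC thB0 * RtoC thB0) *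
      ((thA' d (RtoC s * e) * thB d (RtoC s * e) - thB' d (RtoC s * e) * thA d (RtoC s * e)) *
       (thA' d (RtoC s * e) * thB d (RtoC s * e) - thB' d (RtoC s * e) * thA d (RtoC s * e)))))%C
 with (RtoC thA0 * RtoC thB0 * (RtoC thA0 * RtoC thA0 + RtoC thB0 * RtoC thB0) *
      (RtoC thA0 * RtoC thA0 - RtoC thB0 * RtoC thB0) *
      (((e * thA' d (RtoC s * e)) * thB d (RtoC s * e) - (e * thB' d (RtoC s * e)) * thA d (RtoC s * e)) *
       ((e * thA' d (RtoC s * e)) * thB d (RtoC s * e) - (e * thB' d (RtoC s * e)) * thA d (RtoC s * e))))%C in H by ring.
unfold rr in H. rewrite Hee in H.
rewrite axA_eq, axB_eq, axA'_eq, axB'_eq in H by auto.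
repeat (rewrite <- ?RtoC_mult, <- ?RtoC_plus, <- ?RtoC_minus in H).
apply RtoC_inj in H. 
set (X := axA' e s * axB e s - axB' e s * axA e s) in *. 
replace (X ^ 2) with (X * X) by ring. rewrite H. ring.
Qed.

End ThetaAxis.

(** * Elliptic integrals and the function dn *)

Section Elliptic.

Variable k : R.
Hypothesis hk : 0 < k < 1.

Definition dlt (x : R) : R := sqrt (1 - k ^ 2 * sin x ^ 2).

Definition ellPhi (x : R) : R := RInt (fun t => / sqrt (1 - k ^ 2 * sin t ^ 2)) 0 x.

Lemma sin_sq_bound x : 0 <= sin x ^ 2 <= 1.
Proof. pose proof (SIN_bound x). split; [apply pow2_ge_0|nra]. Qed.

Lemma modulus_sq : 0 < k ^ 2 < 1.
Proof. split; nra. Qed.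

Lemma dlt_arg_bound x : 1 - k ^ 2 <= 1 - k ^ 2 * sin x ^ 2 <= 1.
Proof. pose proof (sin_sq_bound x). pose proof modulus_sq. nra. Qed.

Lemma compl_pos : 0 < sqrt (1 - k ^ 2).
Proof. apply sqrt_lt_R0. pose proof modulus_sq. lra. Qed.

Lemma compl_sq : sqrt (1 - k ^ 2) ^ 2 = 1 - k ^ 2.
Proof. rewrite pow2_sqrt; [reflexivity|]. pose proof modulus_sq; lra. Qed.

Lemma dlt_bound x : sqrt (1 - k ^ 2) <= dlt x <= 1.
Proof.
pose proof (dlt_arg_bound x). unfold dlt. split; [apply sqrt_le_1_alt; lra|].
apply Rle_trans with (sqrt 1); [apply sqrt_le_1_alt; lra|rewrite sqrt_1; lra].
Qed.

Lemma dlt_pos x : 0 < dlt x.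
Proof. pose proof (dlt_bound x). pose proof compl_pos. lra. Qed.

Lemma dlt_sq x : dlt x ^ 2 = 1 - k ^ 2 * sin x ^ 2.
Proof. unfold dlt. rewrite pow2_sqrt; [reflexivity|]. pose proof (dlt_arg_bound x). pose proof modulus_sq. lra. Qed.

Lemma dlt_derive x : is_derive dlt x (- k ^ 2 * sin x * cos x / dlt x).
Proof.
pose proof (dlt_arg_bound x). pose proof modulus_sq. pose proof (dlt_pos x) as Hp.
unfold dlt in *. auto_derive.
- simpl in *; lra.
- simpl in *. match goal with |- context [sqrt (1 + - ?e)] => change (1 + - e) with (1 - e) end. field. lra.
Qed.

Lemma inv_dlt_continuous x : continuous (fun t => / sqrt (1 - k ^ 2 * sin t ^ 2)) x.
Proof.
apply (ex_derive_continuous (fun t => / sqrt (1 - k ^ 2 * sin t ^ 2))). pose proof (dlt_arg_bound x).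
pose proof modulus_sq. auto_derive. simpl in *. split; [lra|]. split; trivial.
apply Rgt_not_eq, sqrt_lt_R0. lra.
Qed.

Lemma ellPhi_derive x : is_derive ellPhi x (/ dlt x).
Proof.
apply (is_derive_RInt (fun t => / sqrt (1 - k ^ 2 * sin t ^ 2)) ellPhi 0 x).
- apply filter_forall. intros y. apply (RInt_correct (V := R_CompleteNormedModule) (fun t => / sqrt (1 - k ^ 2 * sin t ^ 2))).
  apply (ex_RInt_continuous (V := R_CompleteNormedModule)). intros z _. apply inv_dlt_continuous.
- apply inv_dlt_continuous.
Qed.

Lemma ellPhi_0 : ellPhi 0 = 0.
Proof. apply (RInt_point (V := R_CompleteNormedModule)). Qed.

Lemma zero_derive_const (f : R -> R) (x y : R) : (forall t, is_derive f t 0) -> f x = f y.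
Proof.
intros H. destruct (MVT_gen f y x (fun _ => 0)) as [c [_ Hc]].
- intros; apply H.
- intros t _. eapply is_derive_continuity, H.
- lra.
Qed.

Lemma ellPhi_mvt x y : exists c, Rmin x y <= c <= Rmax x y /\ ellPhi y - ellPhi x = (y - x) / dlt c.
Proof.
destruct (MVT_gen ellPhi x y (fun t => / dlt t)) as [c [H Hc]].
- intros; apply ellPhi_derive.
- intros t _. eapply is_derive_continuity, ellPhi_derive.
- exists c. split; auto. rewrite Hc. field. pose proof (dlt_pos c). lra.
Qed.

Lemma ellPhi_incr x y : x < y -> ellPhi x < ellPhi y.
Proof.
intros H. destruct (ellPhi_mvt x y) as [c [_ Hc]].
assert (0 < (y - x) / dlt c) by (apply Rdiv_lt_0_compat; [lra|apply dlt_pos]). lra.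
Qed.

Lemma ellPhi_incr_rev x y : ellPhi x < ellPhi y -> x < y.
Proof.
intros H. destruct (Rlt_or_le x y) as [|[H'| ->]]; auto; [|lra].
apply ellPhi_incr in H'. lra.
Qed.

Lemma ellPhi_inj x y : ellPhi x = ellPhi y -> x = y.
Proof.
intros H. destruct (Rtotal_order x y) as [H'|[H'|H']]; auto; apply ellPhi_incr in H'; lra.
Qed.

Lemma ellPhi_odd x : ellPhi (- x) = - ellPhi x.
Proof.
assert (H : ellPhi (- x) + ellPhi x = ellPhi (- 0) + ellPhi 0).
{ apply (zero_derive_const (fun t => ellPhi (- t) + ellPhi t)). intros t.
  replace 0 with (- 1 * / dlt (- t) + / dlt t).
  - apply (is_derive_plus (fun t => ellPhi (- t)) ellPhi); [|apply ellPhi_derive].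
    apply (is_derive_comp ellPhi Ropp t (/ dlt (- t)) (- 1)); [apply ellPhi_derive|].
    auto_derive; trivial; ring.
  - unfold dlt. rewrite sin_neg. replace ((- sin t) ^ 2) with (sin t ^ 2) by ring. ring. }
rewrite Ropp_0, ellPhi_0 in H. lra.
Qed.

Lemma ellPhi_shift x : ellPhi (x + PI) = ellPhi x + 2 * ellPhi (PI / 2).
Proof.
assert (H : forall x, ellPhi (x + PI) - ellPhi x = ellPhi (0 + PI) - ellPhi 0).
{ intros y. apply (zero_derive_const (fun t => ellPhi (t + PI) - ellPhi t)). intros t.
  replace 0 with (1 * / dlt (t + PI) - / dlt t).
  - apply (is_derive_minus (fun t => ellPhi (t + PI)) ellPhi); [|apply ellPhi_derive].
    apply (is_derive_comp ellPhi (fun t => t + PI) t (/ dlt (t + PI)) 1); [apply ellPhi_derive|].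
    auto_derive; trivial; ring.
  - unfold dlt. rewrite neg_sin. replace ((- sin t) ^ 2) with (sin t ^ 2) by ring. ring. }
(* The increment does not depend on the point; oddness evaluates it at [- (PI / 2)]. *)
pose proof (H x) as H1. pose proof (H (- (PI / 2))) as H2.
replace (- (PI / 2) + PI) with (PI / 2) in H2 by field. rewrite ellPhi_odd in H2. lra.
Qed.

Lemma ellPhi_ge x : 0 <= x -> x <= ellPhi x.
Proof.
intros Hx. destruct (ellPhi_mvt 0 x) as [c [_ Hc]]. rewrite ellPhi_0 in Hc.
replace (ellPhi x) with ((x - 0) / dlt c) by lra.
pose proof (dlt_bound c). pose proof (dlt_pos c).
apply Rle_trans with ((x - 0) / 1); [right; field|].
unfold Rdiv. apply Rmult_le_compat_l; [lra|]. apply Rinv_le_contravar; lra.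
Qed.

Lemma ellPhi_surj u : exists x, ellPhi x = u.
Proof.
assert (Hc : forall t, continuity_pt ellPhi t).
{ intros t. eapply is_derive_continuity, ellPhi_derive. }
destruct (IVT_gen ellPhi (- Rabs u) (Rabs u) u) as [x [_ Hx]]; eauto.
pose proof (ellPhi_ge (Rabs u) (Rabs_pos u)) as H. rewrite ellPhi_odd.
pose proof (Rle_abs u). pose proof (Rabs_maj2 u).
split; [eapply Rle_trans; [apply Rmin_l|]|eapply Rle_trans; [|apply Rmax_r]]; lra.
Qed.

Lemma am_spec u : ellPhi (am u k) = u.
Proof.
unfold am. apply (iota_correct (V := R_CompleteNormedModule) (fun x => ellPhi x = u)).
destruct (ellPhi_surj u) as [x Hx]. exists x. split; auto.
intros y Hy. apply ellPhi_inj. congruence.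
Qed.

Lemma am_ellPhi x : am (ellPhi x) k = x.
Proof. apply ellPhi_inj, am_spec. Qed.

(** Inverse function rule with an explicit remainder: by the mean value theorem for [ellPhi] the
    increment of [am] is [h * dlt c] with [c] between the two amplitudes, and [dlt] is Lipschitz. *)
Lemma am_derive u : is_derive (fun u => am u k) u (dn u k).
Proof.
apply is_derive_quad.
set (L := k ^ 2 / sqrt (1 - k ^ 2)).
pose proof compl_pos as Hcp. pose proof modulus_sq as Hm.
assert (HL : forall x y, Rabs (dlt y - dlt x) <= L * Rabs (y - x)).
{ intros x y. destruct (MVT_gen dlt x y (fun x => - k ^ 2 * sin x * cos x / dlt x)) as [c [_ Hc]].
  - intros; apply dlt_derive.
  - intros t _. eapply is_derive_continuity, dlt_derive.
  - rewrite Hc, Rabs_mult. apply Rmult_le_compat_r; [apply Rabs_pos|].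
    pose proof (dlt_bound c) as Hb. unfold Rdiv, L. rewrite !Rabs_mult, Rabs_Ropp, Rabs_inv.
    rewrite (Rabs_pos_eq (k ^ 2)), (Rabs_pos_eq (dlt c)) by lra.
    assert (Rabs (sin c) <= 1) by (apply Rabs_le, SIN_bound).
    assert (Rabs (cos c) <= 1) by (apply Rabs_le, COS_bound).
    pose proof (Rabs_pos (sin c)). pose proof (Rabs_pos (cos c)).
    apply Rmult_le_compat.
    + repeat apply Rmult_le_pos; lra.
    + left. apply Rinv_0_lt_compat. lra.
    + assert (Rabs (sin c) * Rabs (cos c) <= 1) by nra. nra.
    + apply Rinv_le_contravar; lra. }
exists L, 1. split; [lra|]. intros h _.
set (x := am u k). set (y := am (u + h) k).
destruct (ellPhi_mvt x y) as [c [Hc1 Hc2]].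
unfold x, y in Hc2. rewrite !am_spec in Hc2. fold x y in Hc2.
assert (E : y - x = h * dlt c).
{ replace (u + h - u) with h in Hc2 by ring. rewrite Hc2. field. pose proof (dlt_pos c). lra. }
rewrite E. change (dn u k) with (dlt x).
replace (h * dlt c - h * dlt x) with (h * (dlt c - dlt x)) by ring.
rewrite Rabs_mult.
assert (Hcx : Rabs (c - x) <= Rabs (y - x)).
{ unfold Rmin, Rmax in Hc1. destruct (Rle_dec x y); unfold Rabs; destruct (Rcase_abs (c - x)), (Rcase_abs (y - x)); lra. }
assert (Hyx : Rabs (y - x) <= Rabs h).
{ rewrite E, Rabs_mult. pose proof (dlt_bound c). pose proof (dlt_pos c). rewrite (Rabs_pos_eq (dlt c)) by lra.
  pose proof (Rabs_pos h). nra. }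
pose proof (HL x c) as H1. pose proof (Rabs_pos h).
assert (HLp : 0 <= L) by (unfold L; apply Rdiv_le_0_compat; lra).
assert (H2 : L * Rabs (c - x) <= L * Rabs h) by (apply Rmult_le_compat_l; lra).
replace (L * Rabs h ^ 2) with (Rabs h * (L * Rabs h)) by ring.
apply Rmult_le_compat_l; lra.
Qed.

Definition dn' (u : R) : R := - k ^ 2 * sin (am u k) * cos (am u k).

Lemma dn_derive u : is_derive (fun u => dn u k) u (dn' u).
Proof.
replace (dn' u) with (dn u k * (- k ^ 2 * sin (am u k) * cos (am u k) / dlt (am u k))).
- apply (is_derive_comp dlt (fun u => am u k) u); [apply dlt_derive|apply am_derive].
- change (dn u k) with (dlt (am u k)). unfold dn'. field. pose proof (dlt_pos (am u k)). lra.
Qed.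

Lemma dn_bound u : sqrt (1 - k ^ 2) <= dn u k <= 1.
Proof. apply dlt_bound. Qed.

Lemma dn_pos u : 0 < dn u k.
Proof. apply dlt_pos. Qed.

Lemma dn_sq u : dn u k ^ 2 = 1 - k ^ 2 * sin (am u k) ^ 2.
Proof. apply dlt_sq. Qed.

Lemma cos_sq x : cos x ^ 2 = 1 - sin x ^ 2.
Proof. pose proof (sin2_cos2 x) as H. unfold Rsqr in H. simpl. lra. Qed.

Lemma dn_ode u : dn' u ^ 2 = (1 - dn u k ^ 2) * (dn u k ^ 2 - (1 - k ^ 2)).
Proof.
rewrite dn_sq. unfold dn'.
replace ((- k ^ 2 * sin (am u k) * cos (am u k)) ^ 2) with (k ^ 4 * sin (am u k) ^ 2 * cos (am u k) ^ 2) by ring.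
rewrite cos_sq. ring.
Qed.

Lemma dn'_derive u : is_derive dn' u ((2 - k ^ 2) * dn u k - 2 * dn u k ^ 3).
Proof.
assert (H : is_derive dn' u (- k ^ 2 * (dn u k * (cos (am u k) * cos (am u k) - sin (am u k) * sin (am u k))))).
{ unfold dn'. 
  apply (is_derive_ext (fun u => - k ^ 2 * (sin (am u k) * cos (am u k)))); [intros; simpl; ring|].
  apply (is_derive_scal (fun u => sin (am u k) * cos (am u k))).
  apply (is_derive_comp (fun x => sin x * cos x) (fun u => am u k) u); [|apply am_derive].
  auto_derive; trivial. ring. }
replace ((2 - k ^ 2) * dn u k - 2 * dn u k ^ 3) with
  (- k ^ 2 * (dn u k * (cos (am u k) * cos (am u k) - sin (am u k) * sin (am u k)))); auto.
replace (dn u k ^ 3) with (dn u k * dn u k ^ 2) by ring. rewrite dn_sq.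
replace (cos (am u k) * cos (am u k)) with (cos (am u k) ^ 2) by ring. rewrite cos_sq. ring.
Qed.

Lemma am_opp u : am (- u) k = - am u k.
Proof. apply ellPhi_inj. now rewrite ellPhi_odd, !am_spec. Qed.

Lemma dn_even u : dn (- u) k = dn u k.
Proof. unfold dn. rewrite am_opp, sin_neg. do 2 f_equal. ring. Qed.

Lemma dn'_odd u : dn' (- u) = - dn' u.
Proof. unfold dn'. rewrite am_opp, sin_neg, cos_neg. ring. Qed.

(* The substitution [t = sin x]. *)
Lemma ellF_eq l : 0 < l <= 1 -> ellF l k = ellPhi (asin l).
Proof.
intros Hl. unfold ellF.
apply (is_RInt_gen_unique (V := R_CompleteNormedModule)); try typeclasses eauto.
assert (Hd : forall t, 0 <= t < 1 -> is_derive (fun t => ellPhi (asin t)) t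
   (/ (sqrt (1 - t ^ 2) * sqrt (1 - k ^ 2 * t ^ 2)))).
{ intros t Ht. 
  replace (/ (sqrt (1 - t ^ 2) * sqrt (1 - k ^ 2 * t ^ 2))) with (/ sqrt (1 - t ^ 2) * / dlt (asin t)).
  - apply (is_derive_comp ellPhi asin t); [apply ellPhi_derive|].
    apply is_derive_Reals.
    assert (Hr : -1 < t < 1) by lra.
    pose proof (derive_pt_asin t Hr) as H. 
    replace (/ sqrt (1 - t ^ 2)) with (derive_pt asin t (derivable_pt_asin t Hr)).
    + apply derive_pt_eq_1 with (derivable_pt_asin t Hr). reflexivity.
    + rewrite H. unfold Rsqr, Rdiv. rewrite Rmult_1_l. do 3 f_equal. ring.
  - unfold dlt. rewrite sin_asin by lra. rewrite Rinv_mult. reflexivity. }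
assert (Hc : forall t, 0 <= t < 1 -> continuous (fun t => / (sqrt (1 - t ^ 2) * sqrt (1 - k ^ 2 * t ^ 2))) t).
{ intros t Ht. apply (ex_derive_continuous (fun t => / (sqrt (1 - t ^ 2) * sqrt (1 - k ^ 2 * t ^ 2)))).
  pose proof modulus_sq as Hm.
  assert (0 < 1 - t ^ 2) by nra. assert (0 < 1 - k ^ 2 * t ^ 2) by nra.
  auto_derive. simpl in *. repeat split; try lra.
  apply Rgt_not_eq, Rmult_lt_0_compat; apply sqrt_lt_R0; lra. }
intros P HP.
assert (Hcont : continuity_pt (fun t => ellPhi (asin t)) l \/ l = 1).
{ destruct (proj2 Hl) as [H1| ->]; [left|now right].
  apply continuity_pt_filterlim, (ex_derive_continuous (fun t => ellPhi (asin t))). eexists. apply Hd. lra. }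
assert (HL : filterlim (fun b => ellPhi (asin b)) (at_left l) (locally (ellPhi (asin l)))).
{ destruct (proj2 Hl) as [H1| ->].
  - eapply filterlim_filter_le_1; [|apply (ex_derive_continuous (fun t => ellPhi (asin t)) l); eexists; apply Hd; lra].
    apply filter_le_within.
  (* At [l = 1] the derivative of [asin] blows up; the left limit comes from monotonicity of the
     sine: [asin y > PI / 2 - e] as soon as [y > sin (PI / 2 - e)]. *)
  - apply (filterlim_comp _ _ _ asin ellPhi (at_left 1) (locally (asin 1))).
    + rewrite asin_1. intros Q [eps HQ].
      set (e := Rmin eps (PI / 2)).
      assert (Hpi : 0 < PI / 2) by (pose proof PI_RGT_0; lra).
      assert (He : 0 < e) by (apply Rmin_pos; [apply cond_pos|auto]).
      assert (He1 : e <= eps) by apply Rmin_l. assert (He2 : e <= PI / 2) by apply Rmin_r.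
      assert (Hs : 0 < 1 - sin (PI / 2 - e)).
      { rewrite <- sin_PI2 at 1. pose proof (sin_increasing_1 (PI / 2 - e) (PI / 2)). lra. }
      exists (mkposreal _ Hs). intros y Hy Hy1. apply HQ.
      change (Rabs (asin y - PI / 2) < eps). change (Rabs (y - 1) < 1 - sin (PI / 2 - e)) in Hy.
      rewrite Rabs_left in Hy by lra.
      assert (Hs0 : 0 <= sin (PI / 2 - e)) by (apply sin_ge_0; lra).
      pose proof (asin_bound_lt y ltac:(lra)) as Hab.
      assert (PI / 2 - e < asin y).
      { apply sin_increasing_0; try lra. rewrite sin_asin by lra. lra. }
      rewrite Rabs_left by lra. lra.
    + apply (ex_derive_continuous ellPhi). eexists. apply ellPhi_derive. }
specialize (HL P HP). unfold filtermap in HL. 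
apply (Filter_prod _ _ _ (fun a => a = 0) (fun b => 0 <= b < 1 /\ P (ellPhi (asin b)))).
- reflexivity.
- apply filter_and; [|apply HL].
  exists (mkposreal l (proj1 Hl)). intros y Hy Hy1.
  change (Rabs (y - l) < l) in Hy. rewrite Rabs_left in Hy by lra. lra.
- intros a b -> [Hb HPb]. exists (ellPhi (asin b)). split; auto. simpl.
  replace (ellPhi (asin b)) with (minus (ellPhi (asin b)) (ellPhi (asin 0))).
  + apply (is_RInt_derive (V := R_CompleteNormedModule) (fun t => ellPhi (asin t))).
    * intros x Hx. rewrite Rmin_left, Rmax_right in Hx by lra. apply Hd. lra.
    * intros x Hx. rewrite Rmin_left, Rmax_right in Hx by lra. apply Hc. lra.
  + rewrite asin_0, ellPhi_0. unfold minus, plus, opp; simpl. ring.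
Qed.

Lemma ellK_eq : ellK k = ellPhi (PI / 2).
Proof. unfold ellK. rewrite ellF_eq by lra. now rewrite asin_1. Qed.

Lemma ellK_pos : 0 < ellK k.
Proof.
rewrite ellK_eq. rewrite <- ellPhi_0. apply ellPhi_incr. pose proof PI_RGT_0; lra.
Qed.

Lemma am_0 : am 0 k = 0.
Proof. rewrite <- ellPhi_0 at 1. apply am_ellPhi. Qed.

Lemma am_K : am (ellK k) k = PI / 2.
Proof. rewrite ellK_eq. apply am_ellPhi. Qed.

Lemma am_shift u : am (u + 2 * ellK k) k = am u k + PI.
Proof. apply ellPhi_inj. rewrite ellPhi_shift, !am_spec, ellK_eq. ring. Qed.

Lemma dn_shift u : dn (u + 2 * ellK k) k = dn u k.
Proof. unfold dn. rewrite am_shift, neg_sin. do 2 f_equal. ring. Qed.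

Lemma dn'_shift u : dn' (u + 2 * ellK k) = dn' u.
Proof. unfold dn'. rewrite am_shift, neg_sin, neg_cos. ring. Qed.

Lemma dn_shift_Z u l : dn (2 * IZR l * ellK k + u) k = dn u k.
Proof.
revert l. apply Z.bi_induction.
- intros ? ? ->. tauto.
- f_equal. ring.
- intros l. rewrite succ_IZR.
  replace (2 * (IZR l + 1) * ellK k + u) with (2 * IZR l * ellK k + u + 2 * ellK k) by ring.
  rewrite dn_shift. tauto.
Qed.

Lemma dn'_shift_Z u l : dn' (2 * IZR l * ellK k + u) = dn' u.
Proof.
revert l. apply Z.bi_induction.
- intros ? ? ->. tauto.
- f_equal. ring.
- intros l. rewrite succ_IZR.
  replace (2 * (IZR l + 1) * ellK k + u) with (2 * IZR l * ellK k + u + 2 * ellK k) by ring.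
  rewrite dn'_shift. tauto.
Qed.

Lemma dn_0 : dn 0 k = 1.
Proof. unfold dn. rewrite am_0, sin_0. replace (1 - k ^ 2 * 0 ^ 2) with 1 by ring. apply sqrt_1. Qed.

Lemma dn_K : dn (ellK k) k = sqrt (1 - k ^ 2).
Proof. unfold dn. rewrite am_K, sin_PI2. f_equal. ring. Qed.

Lemma am_quarter u : 0 <= u <= ellK k -> 0 <= am u k <= PI / 2.
Proof.
intros [H1 H2]. rewrite <- (am_spec u) in H1, H2. rewrite ellK_eq in H2. rewrite <- ellPhi_0 in H1.
split.
- destruct (Rle_or_lt 0 (am u k)) as [H|H]; auto. apply ellPhi_incr in H. lra.
- destruct (Rle_or_lt (am u k) (PI / 2)) as [H|H]; auto. apply ellPhi_incr in H. lra.
Qed.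

Lemma dn'_quarter u : 0 <= u <= ellK k -> dn' u <= 0.
Proof.
intros H. apply am_quarter in H. pose proof modulus_sq. pose proof PI_RGT_0.
assert (0 <= sin (am u k)) by (apply sin_ge_0; lra).
assert (0 <= cos (am u k)) by (apply cos_ge_0; lra).
unfold dn'. assert (0 <= sin (am u k) * cos (am u k)) by now apply Rmult_le_pos. nra.
Qed.

Lemma dn'_quarter_lt u : 0 < u < ellK k -> dn' u < 0.
Proof.
intros H. pose proof modulus_sq. pose proof PI_RGT_0.
assert (Ha : 0 < am u k < PI / 2).
{ destruct H as [Hu1 Hu2]. rewrite <- (am_spec u) in Hu1, Hu2. rewrite ellK_eq in Hu2. rewrite <- ellPhi_0 in Hu1.
  split; apply ellPhi_incr_rev; auto. }
assert (0 < sin (am u k)) by (apply sin_gt_0; lra).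
assert (0 < cos (am u k)) by (apply cos_gt_0; lra).
unfold dn'. assert (0 < sin (am u k) * cos (am u k)) by now apply Rmult_lt_0_compat. nra.
Qed.

Lemma dn_quarter_inj u v : 0 <= u <= ellK k -> 0 <= v <= ellK k -> dn u k = dn v k -> u = v.
Proof.
intros Hu Hv H. apply (f_equal (fun x => x ^ 2)) in H. rewrite !dn_sq in H.
apply am_quarter in Hu. apply am_quarter in Hv. pose proof modulus_sq. pose proof PI_RGT_0.
rewrite <- (am_spec u), <- (am_spec v). f_equal.
assert (Hs : sin (am u k) ^ 2 = sin (am v k) ^ 2) by nra.
assert (0 <= sin (am u k)) by (apply sin_ge_0; lra).
assert (0 <= sin (am v k)) by (apply sin_ge_0; lra).
assert (Hs' : sin (am u k) = sin (am v k)) by nra.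
rewrite <- (asin_sin (am u k)), <- (asin_sin (am v k)) by lra. now rewrite Hs'.
Qed.

Lemma dn_inv_spec y : sqrt (1 - k ^ 2) <= y <= 1 -> 0 <= dn_inv y k <= ellK k /\ dn (dn_inv y k) k = y.
Proof.
intros Hy. unfold dn_inv.
apply (iota_correct (V := R_CompleteNormedModule) (fun u => 0 <= u <= ellK k /\ dn u k = y)).
pose proof ellK_pos.
destruct (IVT_gen (fun u => dn u k) 0 (ellK k) y) as [x [Hx1 Hx2]].
- intros t. eapply (is_derive_continuity (fun u => dn u k)), dn_derive.
- simpl. rewrite dn_0, dn_K. split; [eapply Rle_trans; [apply Rmin_r|]|eapply Rle_trans; [|apply Rmax_l]]; lra.
- rewrite Rmin_left, Rmax_right in Hx1 by lra. exists x. split; auto.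
  intros z [Hz1 Hz2]. apply dn_quarter_inj; auto. congruence.
Qed.

Lemma dn_inv_dn u : 0 <= u <= ellK k -> dn_inv (dn u k) k = u.
Proof.
intros Hu. destruct (dn_inv_spec (dn u k) (dn_bound u)) as [H1 H2]. apply dn_quarter_inj; auto.
Qed.

(** The interval contains [- ellK k] and not [ellK k]. At that end [dn'] vanishes, and the
    convention [sign1 0 = 1] then selects [- ellK k] in the formula for the length. *)
Lemma period_reduce u : exists l r, u = 2 * IZR l * ellK k + r /\ - ellK k <= r < ellK k.
Proof.
pose proof ellK_pos.
exists (up ((u - ellK k) / (2 * ellK k))), (u - 2 * IZR (up ((u - ellK k) / (2 * ellK k))) * ellK k).
split; [ring|].
destruct (archimed ((u - ellK k) / (2 * ellK k))) as [Ha Hb].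
set (x := (u - ellK k) / (2 * ellK k)) in *. set (n := IZR (up x)) in *.
assert (E : u = x * (2 * ellK k) + ellK k) by (unfold x; field; lra).
split; nra.
Qed.

End Elliptic.

(** * Jacobi's series *)

Lemma CSeries_ext f g : (forall n, f n = g n) -> CSeries f = CSeries g.
Proof. intros H. unfold CSeries. f_equal; apply Series_ext; intros n; now rewrite H. Qed.

Lemma CSeries_scal_R (r : R) f : (RtoC r * CSeries f)%C = CSeries (fun n => RtoC r * f n)%C.
Proof.
unfold CSeries. apply C_eq; unfold Re, Im; simpl.
- rewrite Rmult_0_l, Rminus_0_r, <- Series_scal_l. apply Series_ext. intros n. ring.
- rewrite Rmult_0_l, Rplus_0_r, <- Series_scal_l. apply Series_ext. intros n. ring.
Qed.

Lemma czsum_halves f : czsum f = CSeries (fun n => f (Z.of_nat n) + f (- Z.of_nat n - 1)%Z)%C.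
Proof. reflexivity. Qed.

Lemma czsum_sym M f : czdom M f ->
  czsum f = (f 0%Z + CSeries (fun n => f (Z.of_nat (S n)) + f (- Z.of_nat (S n))%Z))%C.
Proof.
intros H. unfold czsum. apply C_eq.
- apply (zsum_sym M (fun n => Re (f n))), czdom_re, H.
- apply (zsum_sym M (fun n => Im (f n))), czdom_im, H.
Qed.

Lemma RtoC_m1 : RtoC (-1) = (- RtoC 1)%C.
Proof. apply C_eq; unfold Re, Im; simpl; ring. Qed.

Lemma Cexp_nPI (n : nat) : Cexp (Ci * RtoC (INR n * PI)) = RtoC ((-1) ^ n).
Proof.
induction n as [|n IH].
- simpl. rewrite Rmult_0_l, Cmult_0_r. apply Cexp_0.
- rewrite S_INR. replace (Ci * RtoC ((INR n + 1) * PI))%C with (Ci * RtoC (INR n * PI) + Ci * RtoC (1 * PI))%C.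
  + rewrite Cexp_plus, IH, Cexp_PI. simpl. rewrite RtoC_mult, RtoC_m1. ring.
  + rewrite <- Cmult_plus_distr_l, <- RtoC_plus. f_equal. f_equal. ring.
Qed.

Lemma Cexp_sign_nPI (s : R) (n : nat) : s = 1 \/ s = -1 ->
  Cexp (RtoC s * (Ci * RtoC (INR n * PI))) = RtoC ((-1) ^ n).
Proof.
intros Hs. rewrite <- Cexp_nPI. destruct Hs as [-> | ->].
- f_equal. ring.
- replace (RtoC (-1) * (Ci * RtoC (INR n * PI)))%C
    with (Ci * RtoC (INR n * PI) + Ci * RtoC (IZR (- Z.of_nat n) * (2 * PI)))%C.
  + rewrite Cexp_plus, Cexp_2PI. ring.
  + rewrite opp_IZR, <- INR_IZR_INZ. apply C_eq; unfold Re, Im; simpl; ring.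
Qed.

Lemma exp_pow (x : R) (n : nat) : exp x ^ n = exp (INR n * x).
Proof.
induction n as [|n IH].
- simpl. now rewrite Rmult_0_l, exp_0.
- rewrite S_INR, Rmult_plus_distr_r, exp_plus, <- IH, Rmult_1_l. simpl. ring.
Qed.

Lemma Cexp_R (x : R) : Cexp (RtoC x) = RtoC (exp x).
Proof. unfold Cexp. simpl. rewrite cos_0, sin_0. apply C_eq; simpl; ring. Qed.

Lemma thT_series (d : R) (v : C) : 0 < d -> thT d v =
  (1 + 2 * CSeries (fun m => let n := S m in
     RtoC ((-1) ^ n * exp (- 4 * d) ^ (n * n)) * Ccos (RtoC (2 * INR n) * v)))%C.
Proof.
intros Hd. unfold thT, tht. erewrite czsum_sym by (apply thterm_dom; auto).
f_equal.
- unfold thterm. simpl. rewrite <- Cexp_0. f_equal. apply C_eq; unfold Re, Im; simpl; ring.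
- rewrite CSeries_scal_R. apply CSeries_ext. intros m. set (n := S m). cbv zeta.
  (* [s] is the sign of the index, so the terms [n] and [-n] are computed at once; the shift by
     [PI / 2] yields [(-1)^n] for both. *)
  assert (E : forall s : R, s = 1 \/ s = -1 -> forall z, IZR z = s * (2 * INR n) ->
     Cexp (RtoC (- d * IZR z ^ 2) + Ci * RtoC (IZR z) * (v + RtoC (PI / 2)))
     = (RtoC ((-1) ^ n * exp (- 4 * d) ^ (n * n)) * Cexp (RtoC s * (Ci * (RtoC (2 * INR n) * v))))%C).
  { intros s Hs z Hz. rewrite Hz, exp_pow, mult_INR, (RtoC_mult ((-1) ^ n)).
    replace (RtoC (- d * (s * (2 * INR n)) ^ 2) + Ci * RtoC (s * (2 * INR n)) * (v + RtoC (PI / 2)))%C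
      with (RtoC (INR n * INR n * (- 4 * d)) + RtoC s * (Ci * (RtoC (2 * INR n) * v)) + RtoC s * (Ci * RtoC (INR n * PI)))%C.
    - rewrite !Cexp_plus, Cexp_R, Cexp_sign_nPI by auto. ring.
    - replace (- d * (s * (2 * INR n)) ^ 2) with (INR n * INR n * (- 4 * d)).
      + apply C_eq; unfold Re, Im; simpl; field.
      + destruct Hs as [-> | ->]; ring. }
  unfold thterm.
  rewrite (E 1), (E (-1)).
  + unfold Ccos. replace (RtoC 1 * (Ci * (RtoC (2 * INR n) * v)))%C with (Ci * (RtoC (2 * INR n) * v))%C by ring.
    replace (RtoC (-1) * (Ci * (RtoC (2 * INR n) * v)))%C with (- (Ci * (RtoC (2 * INR n) * v)))%C.
    * field.
    * rewrite RtoC_m1. ring.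
  + now right.
  + rewrite plus_IZR, mult_IZR, opp_IZR, <- INR_IZR_INZ. ring.
  + now left.
  + rewrite plus_IZR, mult_IZR, <- INR_IZR_INZ. ring.
Qed.

Lemma thH_series (d : R) (v : C) : 0 < d -> thH d v =
  (2 * CSeries (fun n =>
     RtoC ((-1) ^ n * Rpower (exp (- 4 * d)) ((INR n + 1 / 2) ^ 2)) * Csin (RtoC (2 * INR n + 1) * v)))%C.
Proof.
intros Hd. unfold thH, tht. rewrite czsum_halves, CSeries_scal_R.
transitivity (RtoC (-1) * CSeries (fun n => thterm d 1 (v + RtoC (PI / 2)) (Z.of_nat n) +
   thterm d 1 (v + RtoC (PI / 2)) (- Z.of_nat n - 1)))%C.
{ rewrite RtoC_m1. ring. }
rewrite CSeries_scal_R. apply CSeries_ext. intros n.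
set (J := RtoC (2 * INR n + 1)).
(* For odd indices the shift by [PI / 2] yields [(-1)^n i s]; the sign [s] turns the sum of two
   exponentials into the difference in [Csin]. *)
assert (E : forall s : R, s = 1 \/ s = -1 -> forall z, IZR z = s * (2 * INR n + 1) ->
   Cexp (RtoC (- d * IZR z ^ 2) + Ci * RtoC (IZR z) * (v + RtoC (PI / 2)))
   = (RtoC ((-1) ^ n * Rpower (exp (- 4 * d)) ((INR n + 1 / 2) ^ 2)) * (Ci * RtoC s) * Cexp (RtoC s * (Ci * (J * v))))%C).
{ intros s Hs z Hz. rewrite Hz, (RtoC_mult ((-1) ^ n)). unfold Rpower. rewrite ln_exp.
  replace (RtoC (- d * (s * (2 * INR n + 1)) ^ 2) + Ci * RtoC (s * (2 * INR n + 1)) * (v + RtoC (PI / 2)))%C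
    with (RtoC ((INR n + 1 / 2) ^ 2 * (- 4 * d)) + RtoC s * (Ci * (J * v)) + RtoC s * (Ci * RtoC (INR n * PI)) + RtoC s * (Ci * RtoC (PI / 2)))%C.
  - rewrite !Cexp_plus, Cexp_R, Cexp_sign_nPI by auto.
    replace (Cexp (RtoC s * (Ci * RtoC (PI / 2)))) with (Ci * RtoC s)%C; [ring|].
    replace (RtoC s * (Ci * RtoC (PI / 2)))%C with (Ci * RtoC (s * (PI / 2)))%C by (rewrite RtoC_mult; ring).
    rewrite Cexp_angle. apply C_eq; unfold Re, Im; simpl; destruct Hs as [-> | ->];
    rewrite ?Rmult_1_l, <- ?Ropp_mult_distr_l, ?cos_neg, ?sin_neg, ?cos_PI2, ?sin_PI2; try ring.
    + replace (-1 * (PI / 2)) with (- (PI / 2)) by ring. rewrite cos_neg, cos_PI2. ring.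
    + replace (-1 * (PI / 2)) with (- (PI / 2)) by ring. rewrite sin_neg, sin_PI2. ring.
  - replace (- d * (s * (2 * INR n + 1)) ^ 2) with ((INR n + 1 / 2) ^ 2 * (- 4 * d)).
    + unfold J. apply C_eq; unfold Re, Im; simpl; field.
    + destruct Hs as [-> | ->]; field. }
unfold thterm. rewrite (E 1), (E (-1)).
+ unfold Csin. 
  replace (RtoC 1 * (Ci * (J * v)))%C with (Ci * (J * v))%C by ring.
  replace (RtoC (-1) * (Ci * (J * v)))%C with (- (Ci * (J * v)))%C.
  * rewrite RtoC_m1.
    set (r := RtoC ((-1) ^ n * Rpower (exp (-4 * d)) ((INR n + 1 / 2) ^ 2))).
    set (X := Cexp (Ci * (J * v))). set (Y := Cexp (- (Ci * (J * v)))).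
    replace (2 * (r * ((X - Y) / (2 * Ci))))%C with (r * (X - Y) * (1 / Ci))%C.
    -- replace (1 / Ci)%C with (- Ci)%C; [ring|].
       apply C_eq; unfold Re, Im; simpl; field.
    -- field. intros H. apply (f_equal Im) in H. unfold Im in H. simpl in H. lra.
  * rewrite RtoC_m1. ring.
+ now right.
+ rewrite plus_IZR, mult_IZR, minus_IZR, opp_IZR, <- INR_IZR_INZ. ring.
+ now left.
+ rewrite plus_IZR, mult_IZR, <- INR_IZR_INZ. ring.
Qed.

(** * The definitions of Theta, H, nome and alpha in terms of the theta series *)

Section Link.

Variable k : R.
Hypothesis hk : 0 < k < 1.

Lemma hk' : 0 < compl k < 1.
Proof.
unfold compl. pose proof (compl_pos k hk). split; auto.
pose proof (modulus_sq k hk). apply Rlt_le_trans with (sqrt 1); [apply sqrt_lt_1_alt; lra|].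
rewrite sqrt_1. lra.
Qed.

(** Chosen so that [exp (-4 thd)] is the nome and [z * thl = PI z / (2 K)] is the variable of the
    theta series. *)
Definition thd : R := PI * ellK (compl k) / (4 * ellK k).
Definition thl : R := PI / (2 * ellK k).

Lemma thd_pos : 0 < thd.
Proof.
unfold thd. pose proof PI_RGT_0. pose proof (ellK_pos k hk). pose proof (ellK_pos _ hk').
apply Rdiv_lt_0_compat; [apply Rmult_lt_0_compat; lra|lra].
Qed.

Lemma thl_pos : 0 < thl.
Proof. unfold thl. pose proof PI_RGT_0. pose proof (ellK_pos k hk). apply Rdiv_lt_0_compat; lra. Qed.

Lemma nome_eq : nome k = exp (- 4 * thd).
Proof. unfold nome, thd. f_equal. field. pose proof (ellK_pos k hk); lra. Qed.

Lemma ellK_C_neq : RtoC (ellK k) <> 0.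
Proof. intros H. apply RtoC_inj in H. pose proof (ellK_pos k hk); lra. Qed.

Lemma Theta_eq z : Theta z k = thT thd (z * RtoC thl).
Proof.
rewrite thT_series by apply thd_pos. unfold Theta. f_equal. f_equal. apply CSeries_ext.
intros m. cbv zeta. rewrite nome_eq. f_equal. f_equal. unfold thl.
rewrite RtoC_div by (pose proof (ellK_pos k hk); lra). rewrite !RtoC_mult.
field. apply ellK_C_neq.
Qed.

Lemma Eta_eq z : Eta z k = thH thd (z * RtoC thl).
Proof.
rewrite thH_series by apply thd_pos. unfold Eta. f_equal. apply CSeries_ext.
intros m. rewrite nome_eq. f_equal. f_equal. unfold thl.
rewrite RtoC_div by (pose proof (ellK_pos k hk); lra). rewrite !RtoC_mult.
field. apply ellK_C_neq.
Qed.

Lemma Theta_derive z : C_derive (fun y => Theta y k) z = (RtoC thl * thT' thd (z * RtoC thl))%C.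
Proof.
apply is_C_derive_unique, quad_diff_is_derive.
apply quad_diff_ext with (fun x => thT thd (RtoC thl * x + 0))%C.
- intros x. rewrite Theta_eq. f_equal. ring.
- apply quad_diff_affine. replace (RtoC thl * z + 0)%C with (z * RtoC thl)%C by ring.
  apply thT_diff, thd_pos.
Qed.

Lemma alpha_eq : alpha k = ellPhi (compl k) (asin (compl k)).
Proof. unfold alpha. apply ellF_eq; [apply hk'|]. pose proof hk'. lra. Qed.

End Link.

(** * Position of the first pole on the imaginary axis *)

Lemma is_derive_interior_max (f : R -> R) (a b c l : R) : a < c < b -> is_derive f c l ->
  (forall x, a < x < b -> f x <= f c) -> l = 0.
Proof.
intros Hc Hd Hm. apply is_derive_Reals in Hd.
assert (pr : derivable_pt f c) by (exists l; exact Hd).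
pose proof (deriv_maximum f a b c pr ltac:(lra) ltac:(lra)) as H.
rewrite <- (derive_pt_eq_0 f c l pr Hd). apply H. intros; apply Hm; lra.
Qed.

Lemma is_derive_left_max (f : R -> R) (a c l : R) : a < c -> is_derive f c l ->
  (forall x, a <= x <= c -> f x <= f c) -> 0 <= l.
Proof.
intros Hc Hd Hm. apply is_derive_Reals in Hd.
destruct (Rle_or_lt 0 l) as [H|H]; auto. exfalso.
destruct (Hd (- l / 2) ltac:(lra)) as [e He].
set (h := - Rmin (e / 2) (c - a)).
pose proof (Rmin_l (e / 2) (c - a)). pose proof (Rmin_r (e / 2) (c - a)).
pose proof (cond_pos e) as Hep.
assert (0 < Rmin (e / 2) (c - a)) by (apply Rmin_pos; lra).
specialize (He h ltac:(unfold h; lra)).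
assert (Hh : Rabs h < e) by (unfold h; rewrite Rabs_Ropp, Rabs_pos_eq by lra; lra).
specialize (He Hh).
assert (Hq : 0 <= (f (c + h) - f c) / h).
{ replace ((f (c + h) - f c) / h) with ((f c - f (c + h)) / - h) by (field; unfold h; lra).
  apply Rdiv_le_0_compat; [|unfold h; lra].
  specialize (Hm (c + h) ltac:(unfold h; lra)). lra. }
rewrite Rabs_pos_eq in He by lra. lra.
Qed.

Lemma continuity_nonzero (f : R -> R) (x : R) : continuity_pt f x -> f x <> 0 ->
  exists e, 0 < e /\ forall y, Rabs (y - x) < e -> f y <> 0.
Proof.
intros H Hx. destruct (H (Rabs (f x)) (Rabs_pos_lt _ Hx)) as [e [He Hc]].
exists e. split; auto. intros y Hy Hf.
destruct (Req_dec y x) as [-> |Hne]; [auto|].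
specialize (Hc y). simpl in Hc. unfold R_dist, D_x, no_cond in Hc.
assert (Hlt : Rabs (f y - f x) < Rabs (f x)) by (apply Hc; split; auto; split; auto).
rewrite Hf in Hlt. rewrite <- Rabs_Ropp in Hlt. replace (- (0 - f x)) with (f x) in Hlt by ring. lra.
Qed.

(** Let [M] be the supremum of the points up to which [u] has no zero. The last hypothesis gives
    [u M <> 0], and by continuity [M] cannot lie below [m]. *)
Lemma nonzero_continuation (u : R -> R) (m : R) : 0 <= m ->
  (forall x, continuity_pt u x) -> u 0 <> 0 ->
  (forall Y, 0 < Y <= m -> (forall z, 0 <= z < Y -> u z <> 0) -> u Y <> 0) ->
  forall z, 0 <= z <= m -> u z <> 0.
Proof.
intros Hm Hc H0 Hs.
set (E := fun x => 0 <= x <= m /\ forall z, 0 <= z <= x -> u z <> 0).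
assert (HE0 : E 0).
{ split; [lra|]. intros z Hz. now replace z with 0 by lra. }
destruct (completeness E) as [M [HM1 HM2]].
- exists m. intros x [Hx _]. lra.
- now exists 0.
- assert (HM0 : 0 <= M) by (apply HM1; auto).
  assert (HMm : M <= m) by (apply HM2; intros x [Hx _]; lra).
  assert (Hlt : forall z, 0 <= z < M -> u z <> 0).
  { intros z Hz Hu. assert (M <= z); [|lra]. apply HM2. intros x [Hx Hx'].
    destruct (Rle_or_lt x z); auto. exfalso. apply (Hx' z); auto. lra. }
  assert (HuM : u M <> 0).
  { destruct (Req_dec M 0) as [-> |Hne]; auto. apply Hs; auto. lra. }
  destruct (Rle_or_lt m M) as [Hle|Hlt'].
  + replace M with m in * by lra. intros z Hz. destruct (Req_dec z m) as [-> |]; auto. apply Hlt. lra.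
  + exfalso. destruct (continuity_nonzero u M (Hc M) HuM) as [e [He Hey]].
    set (x := Rmin m (M + e / 2)).
    assert (Hx1 : x <= m) by apply Rmin_l. assert (Hx2 : x <= M + e / 2) by apply Rmin_r.
    assert (Hx3 : M < x) by (unfold x; apply Rmin_glb_lt; lra).
    assert (E x).
    { split; [lra|]. intros z Hz. destruct (Rlt_or_le z M) as [Hz'|Hz'].
      - apply Hlt; lra.
      - apply Hey. rewrite Rabs_pos_eq; lra. }
    assert (x <= M) by (apply HM1; auto). lra.
Qed.

Lemma sin_atan_sqrt_sq (G : R) : 0 <= G -> sin (atan (sqrt G)) ^ 2 = G / (1 + G).
Proof.
intros HG. rewrite sin_atan, <- Rsqr_pow2, Rsqr_div'. unfold Rsqr. now rewrite !sqrt_sqrt by (rewrite ?sqrt_sqrt; lra).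
Qed.

(* [g = v / u] is the square of [sqrt C * sc (., k')]: the amplitude
   [atan (sqrt (g / C))] moves as [am (., k')], so that [g] has no pole before
   [K(k')], and in particular none before [alpha]. *)
Lemma elliptic_time (k kc : R) (C : R) (u v u' v' : R -> R) :
  0 < k < 1 -> kc = sqrt (1 - k ^ 2) -> 0 < C ->
  (forall y, is_derive u y (u' y)) -> (forall y, is_derive v y (v' y)) ->
  (forall y, 0 <= u y) -> (forall y, 0 <= v y) -> (forall y, u y <> 0 \/ v y <> 0) ->
  v 0 = 0 ->
  (forall e, 0 < e -> exists y, 0 <= y <= e /\ v y <> 0) ->
  (forall y, u y <> 0 -> ((v' y * u y - v y * u' y) / u y ^ 2) ^ 2 =
     4 * (v y / u y) * (1 + (v y / u y) / C) * (C + k ^ 2 * (v y / u y))) ->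
  let m := ellPhi kc (asin kc) in
  u m <> 0 /\ 0 < (v' m * u m - v m * u' m) / u m ^ 2.
Proof.
intros hk Hkc HC Hu Hv Hu0 Hv0 Huv Hv00 Hnz Hode m.
assert (hkc : 0 < kc < 1).
{ rewrite Hkc. pose proof (compl_pos k hk). pose proof (modulus_sq k hk). split; auto.
  apply Rlt_le_trans with (sqrt 1); [apply sqrt_lt_1_alt; lra|rewrite sqrt_1; lra]. }
assert (Hkc2 : kc ^ 2 = 1 - k ^ 2) by (rewrite Hkc; now apply compl_sq).
pose proof (modulus_sq k hk) as Hk2.
set (g := fun y => v y / u y). set (g' := fun y => (v' y * u y - v y * u' y) / u y ^ 2).
assert (Hg : forall y, u y <> 0 -> is_derive g y (g' y)).
{ intros y Hy. unfold g, g'. apply is_derive_div; auto. }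
assert (HgC : forall y, u y <> 0 -> is_derive (fun x => g x / C) y (g' y / C)).
{ intros y Hy. apply (is_derive_ext (fun x => / C * g x)); [intros; unfold Rdiv; simpl; ring|].
  replace (g' y / C) with (/ C * g' y) by (unfold Rdiv; ring). apply is_derive_scal. now apply Hg. }
assert (Hg0 : forall y, u y <> 0 -> 0 <= g y).
{ intros y Hy. unfold g. apply Rdiv_le_0_compat; auto. specialize (Hu0 y). lra. }
assert (Hgv : forall y, u y <> 0 -> v y = g y * u y) by (intros y Hy; unfold g; field; auto).
assert (Hg' : forall y, u y <> 0 -> g' y ^ 2 = 4 * g y * (1 + g y / C) * (C + k ^ 2 * g y)).
{ intros y Hy. apply (Hode y Hy). }
assert (Hg'nz : forall y, u y <> 0 -> 0 < g y -> g' y <> 0).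
{ intros y Hy Hgy Hz. specialize (Hg' y Hy). rewrite Hz in Hg'.
  assert (0 < g y / C) by (apply Rdiv_lt_0_compat; auto).
  assert (0 < 4 * g y * (1 + g y / C) * (C + k ^ 2 * g y)).
  { assert (0 < k ^ 2 * g y) by (apply Rmult_lt_0_compat; lra). apply Rmult_lt_0_compat; [apply Rmult_lt_0_compat|]; lra. }
  lra. }
(* The squared equation does not give the sign of [g'], but it forces [g' <> 0] wherever [g > 0].
   Hence a positive maximum over [[0, y]] is not interior and lies at [y]. *)
assert (Hmax : forall y, 0 < y -> (forall z, 0 <= z <= y -> u z <> 0) ->
   exists M, 0 <= M <= y /\ (forall z, 0 <= z <= y -> g z <= g M) /\ (0 < g M -> M = y)).
{ intros y Hy Hz.
  destruct (continuity_ab_maj g 0 y) as [M [HM1 HM2]]; [lra| |].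
  - intros c Hc. eapply is_derive_continuity, Hg, Hz, Hc.
  - exists M. repeat split; try tauto. intros HgM.
    destruct (Req_dec M y) as [|Hne]; auto. exfalso.
    assert (M <> 0).
    { intros E. rewrite E in HgM. unfold g in HgM. rewrite Hv00 in HgM. unfold Rdiv in HgM. lra. }
    apply (Hg'nz M); auto.
    apply (is_derive_interior_max g 0 y M); [lra|apply Hg; auto|].
    intros x Hx. apply HM1. lra. }
assert (Hpos : forall y, 0 < y -> (forall z, 0 <= z <= y -> u z <> 0) -> 0 < g y).
{ intros y Hy Hz. destruct (Hmax y Hy Hz) as [M [HM1 [HM2 HM3]]].
  assert (HgM : 0 < g M).
  { destruct (Hnz y Hy) as [z [Hz1 Hz2]].
    assert (0 < g z).
    { unfold g. apply Rdiv_lt_0_compat.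
      - specialize (Hv0 z). lra.
      - specialize (Hu0 z). specialize (Hz z Hz1). lra. }
    specialize (HM2 z Hz1). lra. }
  rewrite (HM3 HgM) in HgM. auto. }
assert (Hg'pos : forall y, 0 < y -> (forall z, 0 <= z <= y -> u z <> 0) -> 0 < g' y).
{ intros y Hy Hz. pose proof (Hpos y Hy Hz) as Hgy.
  destruct (Hmax y Hy Hz) as [M [HM1 [HM2 HM3]]].
  assert (HgM : 0 < g M) by (specialize (HM2 y ltac:(lra)); lra).
  assert (Huy : u y <> 0) by (apply Hz; lra).
  specialize (HM3 HgM). subst M.
  pose proof (is_derive_left_max g 0 y (g' y) Hy (Hg y Huy)) as H.
  pose proof (Hg'nz y Huy Hgy). specialize (H HM2). lra. }
assert (Htime : forall y, 0 <= y -> (forall z, 0 <= z <= y -> u z <> 0) ->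
   ellPhi kc (atan (sqrt (g y / C))) = y).
{ intros y Hy Hz.
  destruct Hy as [Hy|Hy].
  2:{ subst y. unfold g. rewrite Hv00. unfold Rdiv. rewrite !Rmult_0_l, sqrt_0, atan_0. apply ellPhi_0. }
  set (q := fun y => ellPhi kc (atan (sqrt (g y / C)))).
  assert (Hder : forall x, 0 < x -> x <= y -> is_derive q x 1).
  { intros x Hx Hxy. assert (Hzx : forall z, 0 <= z <= x -> u z <> 0) by (intros; apply Hz; lra).
    assert (Hux : u x <> 0) by (apply Hz; lra).
    pose proof (Hpos x Hx Hzx) as Hgx. pose proof (Hg'pos x Hx Hzx) as Hgx'.
    set (G := g x / C). assert (HG : 0 < G) by (apply Rdiv_lt_0_compat; auto).
    pose proof (sqrt_lt_R0 G HG) as HsG.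
    assert (HsG2 : sqrt G * sqrt G = G) by (apply sqrt_sqrt; lra).
    set (D := g' x / C / (2 * sqrt G) / (1 + G)).
    assert (Hd1 : is_derive (fun x => atan (sqrt (g x / C))) x D).
    { assert (Hd0 : is_derive (fun x => g x / C) x (g' x / C)).
      { now apply HgC. }
      replace D with (g' x / C * (/ (2 * sqrt G) * / (1 + sqrt G ^ 2))).
      - apply (is_derive_comp (fun t => atan (sqrt t)) (fun x => g x / C) x); auto.
        fold G. 
        apply (is_derive_comp atan sqrt G (/ (1 + sqrt G ^ 2))).
        + apply is_derive_Reals. apply derivable_pt_lim_atan.
        + apply is_derive_Reals. apply derivable_pt_lim_sqrt. auto.
      - unfold D. replace (sqrt G ^ 2) with G by (rewrite <- HsG2 at 1; ring). field. lra. }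
    replace 1 with (D * / dlt kc (atan (sqrt G))).
    - apply (is_derive_comp (ellPhi kc) (fun x => atan (sqrt (g x / C))) x); auto.
      apply ellPhi_derive. auto.
    - assert (Hdl : 0 < dlt kc (atan (sqrt G))) by (apply dlt_pos; auto).
      assert (HD : 0 < D).
      { unfold D. apply Rdiv_lt_0_compat; [apply Rdiv_lt_0_compat; [apply Rdiv_lt_0_compat|]|]; lra. }
      assert (HE : D = dlt kc (atan (sqrt G))); [|rewrite HE; field; lra].
      assert (HE2 : D ^ 2 = dlt kc (atan (sqrt G)) ^ 2).
      { rewrite dlt_sq by auto.
        rewrite sin_atan_sqrt_sq, Hkc2 by lra.
        replace (D ^ 2) with (g' x ^ 2 / (C ^ 2 * 4 * (sqrt G * sqrt G) * (1 + G) ^ 2)).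
        2:{ unfold D. field. lra. }
        rewrite (Hg' x Hux), HsG2.
        replace (g x) with (G * C) by (unfold G; field; lra). field. lra. }
      nra. }
  assert (Hcont : forall x, 0 <= x <= y -> continuity_pt q x).
  { intros x [[Hx|Hx] Hxy].
    - eapply is_derive_continuity, Hder; auto.
    - subst x. 
      assert (Hu00 : u 0 <> 0) by (apply Hz; lra).
      assert (HCg : continuity_pt (fun x => g x / C) 0).
      { apply (is_derive_continuity _ _ (g' 0 / C)). now apply HgC. }
      apply (continuity_pt_comp (fun x => sqrt (g x / C)) (fun t => ellPhi kc (atan t))).
      + apply (continuity_pt_comp (fun x => g x / C) sqrt); auto.
        apply continuity_pt_sqrt. apply Rdiv_le_0_compat; auto.
      + apply (continuity_pt_comp atan (ellPhi kc)).
        * apply derivable_continuous_pt, derivable_pt_atan.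
        * eapply is_derive_continuity, ellPhi_derive; auto. }
  destruct (MVT_gen q 0 y (fun _ => 1)) as [c [_ Hc]].
  - intros x Hx. rewrite Rmin_left, Rmax_right in Hx by lra. apply Hder; lra.
  - intros x Hx. rewrite Rmin_left, Rmax_right in Hx by lra. apply Hcont; lra.
  - assert (q 0 = 0).
    { unfold q, g. rewrite Hv00. unfold Rdiv. rewrite !Rmult_0_l, sqrt_0, atan_0. apply ellPhi_0. }
    change (q y = y). lra. }
assert (Hm0 : 0 < m).
{ unfold m. rewrite <- (ellPhi_0 kc). apply ellPhi_incr; auto.
  rewrite <- asin_0. 
  destruct (Rlt_or_le (asin 0) (asin kc)) as [|Hle]; auto. exfalso.
  pose proof (asin_bound kc). pose proof PI_RGT_0. rewrite asin_0 in Hle.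
  assert (sin (asin kc) <= sin 0) by (apply sin_incr_1; lra).
  rewrite sin_asin, sin_0 in H1; lra. }
assert (Hucont : forall x, continuity_pt u x) by (intros x; eapply is_derive_continuity, Hu).
assert (Hvcont : forall x, continuity_pt v x) by (intros x; eapply is_derive_continuity, Hv).
assert (Hall : forall z, 0 <= z <= m -> u z <> 0).
{ apply nonzero_continuation; auto; [lra| |].
  - destruct (Huv 0); auto.
  - intros Y HY Hz HuY.
    (* Before time [m] the amplitude is below [asin kc], so [g / C <= kc^2 / (1 - kc^2) = (1 - k^2)
       / k^2]. The bound is multiplied by [u] so that it still makes sense at a zero of [u]. *)
    assert (Hbd : forall y, 0 <= y < Y -> v y <= C * (1 - k ^ 2) / k ^ 2 * u y).
    { intros y Hy.
      assert (Hzy : forall z, 0 <= z <= y -> u z <> 0) by (intros; apply Hz; lra).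
      pose proof (Htime y ltac:(lra) Hzy) as Ht.
      set (chi := atan (sqrt (g y / C))) in *.
      assert (Hchi : chi < asin kc).
      { apply (ellPhi_incr_rev kc); auto. fold m. lra. }
      assert (Huy : u y <> 0) by (apply Hz; lra).
      pose proof (Hg0 y Huy) as Hgy.
      set (G := g y / C) in *. assert (HG : 0 <= G) by (apply Rdiv_le_0_compat; auto).
      assert (Hs : sin chi ^ 2 = G / (1 + G)) by now apply sin_atan_sqrt_sq.
      assert (Hchi0 : 0 <= chi).
      { unfold chi. rewrite <- atan_0. destruct (sqrt_pos G) as [H|H].
        - left. now apply atan_increasing.
        - rewrite <- H. lra. }
      assert (Hsin : sin chi <= kc).
      { rewrite <- (sin_asin kc) by lra. pose proof (asin_bound kc). pose proof PI_RGT_0.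
        apply sin_incr_1; lra. }
      assert (Hsin0 : 0 <= sin chi).
      { pose proof (asin_bound kc). pose proof PI_RGT_0. apply sin_ge_0; lra. }
      assert (HG1 : G / (1 + G) <= 1 - k ^ 2) by (rewrite <- Hs, <- Hkc2; nra).
      assert (HG2 : G <= (1 - k ^ 2) / k ^ 2).
      { assert (G <= (1 - k ^ 2) * (1 + G)).
        { apply (Rmult_le_compat_r (1 + G)) in HG1; [|lra].
          replace (G / (1 + G) * (1 + G)) with G in HG1 by (field; lra). lra. }
        apply (Rmult_le_reg_r (k ^ 2)); [lra|].
        replace ((1 - k ^ 2) / k ^ 2 * k ^ 2) with (1 - k ^ 2) by (field; lra). lra. }
      rewrite (Hgv y Huy). apply Rmult_le_compat_r; auto.
      replace (g y) with (C * G) by (unfold G; field; lra).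
      replace (C * (1 - k ^ 2) / k ^ 2) with (C * ((1 - k ^ 2) / k ^ 2)) by (field; lra).
      apply Rmult_le_compat_l; lra. }
    set (c0 := C * (1 - k ^ 2) / k ^ 2) in *.
    assert (HvY : v Y <> 0) by (destruct (Huv Y); auto; contradiction).
    assert (HvY0 : 0 < v Y) by (specialize (Hv0 Y); lra).
    (* [h >= 0] before [Y], but [u Y = 0] would give [h Y = - v Y < 0], against continuity. *)
    set (h := fun y => c0 * u y - v y).
    assert (Hh : is_derive h Y (c0 * u' Y - v' Y)).
    { apply (is_derive_minus (fun y => c0 * u y) v); auto. apply is_derive_scal; auto. }
    apply is_derive_continuity in Hh.
    assert (HhY : h Y = - v Y) by (unfold h; rewrite HuY; ring).
    destruct (Hh (v Y) HvY0) as [e [He Hc]].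
    set (y := Rmax 0 (Y - e / 2)).
    assert (Hy1 : 0 <= y) by apply Rmax_l. assert (Hy2 : Y - e / 2 <= y) by apply Rmax_r.
    assert (Hy3 : y < Y) by (unfold y; apply Rmax_lub_lt; lra).
    specialize (Hc y). simpl in Hc. unfold R_dist, D_x, no_cond in Hc.
    assert (Rabs (h y - h Y) < v Y).
    { apply Hc. split; [split; auto; lra|]. rewrite Rabs_left; lra. }
    specialize (Hbd y ltac:(lra)). apply Rabs_def2 in H. unfold h in H at 1 3. rewrite HhY in H. lra. }
split.
- apply Hall. lra.
- apply Hg'pos; auto.
Qed.

(** * The Wronskian of w_1 and w_2 *)

(** The difference of squares is a product of four linear forms in [A] and [B]. Two are the
    numerator and denominator of [f], the other two become linear in [f] after division by [N]. If
    [D] is the Wronskian [A' B - B' A], then [p * D / N ^ 2] is the derivative of [f]. *)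
Lemma quartic_ratio (A B a b D c : R) :
  let N := A * a - B * b in let f := (A * b - B * a) / N in
  let p := a * a - b * b in let s := a * a + b * b in
  N <> 0 -> p <> 0 -> 0 < a -> 0 < b ->
  a * b * s * p * D ^ 2 = c * ((a * b * (A * A + B * B)) ^ 2 - (s * (A * B)) ^ 2) ->
  (p * D / N ^ 2) ^ 2 = c / (a * b * s * p) * f * (2 * a * b - s * f) * (s - 2 * a * b * f).
Proof.
intros N f p s HN Hp Ha Hb H.
assert (Hs : 0 < s) by (unfold s; nra).
assert (HD : D ^ 2 = c * ((a * b * (A * A + B * B)) ^ 2 - (s * (A * B)) ^ 2) / (a * b * s * p)).
{ rewrite <- H. field. repeat split; lra. }
replace ((p * D / N ^ 2) ^ 2) with (p ^ 2 * D ^ 2 / N ^ 4) by (field; auto).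
rewrite HD. 
assert (E1 : 2 * a * b - s * f = p * (b * A + a * B) / N) by (unfold f, s, p, N in *; field; auto).
assert (E2 : s - 2 * a * b * f = p * (a * A + b * B) / N) by (unfold f, s, p, N in *; field; auto).
rewrite E1, E2. unfold f.
replace ((a * b * (A * A + B * B)) ^ 2 - (s * (A * B)) ^ 2) with
  ((A * b - B * a) * N * ((b * A + a * B) * (a * A + b * B))) by (unfold N, s; ring).
field. repeat split; lra.
Qed.

Lemma is_derive_lincomb (f g : R -> R) (x f' g' u v : R) : is_derive f x f' -> is_derive g x g' ->
  is_derive (fun t => f t * u - g t * v) x (f' * u - g' * v).
Proof.
intros Hf Hg. replace (f' * u - g' * v) with ((f' * u + f x * 0) - (g' * v + g x * 0)) by ring.
apply (is_derive_minus (fun t => f t * u) (fun t => g t * v));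
 apply (is_derive_Rmult _ (fun _ => _)); auto using is_derive_cst.
Qed.

Section Wronskian.

Variable k : R.
Hypothesis hk : 0 < k < 1.

(** By the quarter-period formula this is [dn t k], written in the form in which the modulus of
    [w12] produces it; [dnq_ode] is the equation of [dn]. *)
Definition dnq (t : R) : R := sqrt (1 - k ^ 2) / dn (t + ellK k) k.

(** Supplied later by [w12_mod]: it is [1 - mu / kappa^2], multiplied by [2 - k^2] because of the
    prefactor in [W1] and [W2]. *)
Hypothesis Hmod : forall t, Cmod (w12 k t) ^ 2 = 2 - k ^ 2 - dnq t ^ 2.

Let d := thd k.
Let l := thl k.
Let Hd : 0 < d. Proof. apply thd_pos, hk. Qed.
Let Hl : 0 < l. Proof. apply thl_pos, hk. Qed.
Let er : C := RtoC l.
Let ei : C := (Ci * RtoC l)%C.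
Let Her : axis er. Proof. apply axis_real. Qed.
Let Hei : axis ei. Proof. apply axis_imag. Qed.
Let a := thA0 d.
Let b := thB0 d.
Let m := alpha k.
Let Ha : 0 < a. Proof. apply thA0_pos, Hd. Qed.
Let Hb : 0 < b. Proof. apply thB0_pos, Hd. Qed.

(* On the real axis [T ^ 2] is [Nr] and [H ^ 2] is [Mr]; on the imaginary axis
   [T ^ 2] is [Ni] and [H ^ 2] is [- Mi]. *)
Let Nr t := axA d er t * a - axB d er t * b.
Let Mr t := axA d er t * b - axB d er t * a.
Let Ni y := axA d ei y * a - axB d ei y * b.
Let Mi y := axB d ei y * a - axA d ei y * b.

Lemma Nr_eq t : Nr t = axT d er t ^ 2.
Proof. unfold Nr, a, b. symmetry. apply axT_sq; auto. Qed.

Lemma Ni_eq y : Ni y = axT d ei y ^ 2.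
Proof. unfold Ni, a, b. symmetry. apply axT_sq; auto. Qed.

Lemma Mi_eq y : Mi y = Im (thH d (Ci * RtoC (y * l))) ^ 2.
Proof.
apply RtoC_inj. pose proof (thH_sq d Hd (RtoC y * ei)) as H.
rewrite axA_eq, axB_eq in H by auto. unfold ei in H at 1 2.
replace (RtoC y * (Ci * RtoC l))%C with (Ci * RtoC (y * l))%C in H by (rewrite RtoC_mult; ring).
rewrite thH_imag in H by auto. fold a b in H.
set (h := Im (thH d (Ci * RtoC (y * l)))) in *.
unfold Mi. rewrite RtoC_minus, !RtoC_mult.
transitivity (- (Ci * RtoC h * (Ci * RtoC h)))%C; [rewrite H; ring|].
replace (- (Ci * RtoC h * (Ci * RtoC h)))%C with (- (Ci * Ci) * (RtoC h * RtoC h))%C by ring.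
replace (- (Ci * Ci))%C with (RtoC 1) by (apply C_eq; unfold Re, Im; simpl; ring).
rewrite <- !RtoC_mult. f_equal. ring.
Qed.

(** [Theta] is real on the imaginary axis, so [zeta (i alpha)] is imaginary and the exponential
    factor of [w_plus] is a pure rotation; this is its speed. *)
Definition phase_rate : R := - axT' d ei m / axT d ei m.

Lemma zeta_alpha : zeta (Ci * RtoC (alpha k)) k = (Ci * RtoC phase_rate)%C.
Proof.
unfold zeta. rewrite Theta_derive, Theta_eq by auto. fold d l m.
replace (Ci * RtoC m * RtoC l)%C with (RtoC m * ei)%C by (unfold ei; ring).
rewrite axT_eq by auto.
assert (H : (RtoC l * thT' d (RtoC m * ei))%C = (- Ci * RtoC (axT' d ei m))%C).
{ rewrite <- axT'_eq by auto. unfold ei at 2.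
  replace (- Ci * (Ci * RtoC l * thT' d (RtoC m * ei)))%C with (- (Ci * Ci) * (RtoC l * thT' d (RtoC m * ei)))%C by ring.
  replace (- (Ci * Ci))%C with (RtoC 1) by (apply C_eq; unfold Re, Im; simpl; ring). ring. }
rewrite H. unfold phase_rate. 
set (x := axT' d ei m). set (y := axT d ei m).
(* [Theta (i alpha) <> 0] is not yet known; if it vanishes, both quotients are 0 by convention. *)
destruct (Req_dec y 0) as [-> |Hy].
- apply C_eq; unfold Re, Im; simpl; unfold Rdiv; rewrite ?Ropp_0, ?Rinv_0; ring_simplify; rewrite ?Rinv_0; ring.
- rewrite RtoC_div by auto. rewrite RtoC_opp. field. intros E. apply RtoC_inj in E. auto.
Qed.

Lemma w_plus_eq t : w_plus k t =
  (thH d (RtoC t * er - RtoC m * ei) / RtoC (axT d er t) * Cexp (Ci * RtoC (phase_rate * t)))%C.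
Proof.
unfold w_plus. rewrite zeta_alpha, Eta_eq, Theta_eq by auto. fold d l m.
rewrite <- (axT_eq d Hd er t Her). unfold er, ei. f_equal; f_equal.
- f_equal. ring.
- rewrite RtoC_mult. ring.
Qed.

Lemma Cmod_Cexp_Ci (x : R) : Cmod (Cexp (Ci * RtoC x)) = 1.
Proof. rewrite Cmod_Cexp. unfold Re. simpl. replace (0 * x - 1 * 0) with 0 by ring. apply exp_0. Qed.

(** * The modulus of w_+ and the function f on the real axis *)

Let q0 := Im (w_plus k 0).
Let Nx t := axA d er t * axB d ei m - axB d er t * axA d ei m.

Lemma dnq_bound t : sqrt (1 - k ^ 2) <= dnq t <= 1.
Proof.
unfold dnq. pose proof (dn_bound k hk (t + ellK k)) as H. pose proof (compl_pos k hk) as Hc.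
split.
- apply Rle_trans with (sqrt (1 - k ^ 2) / 1); [right; field|].
  unfold Rdiv. apply Rmult_le_compat_l; [lra|]. apply Rinv_le_contravar; lra.
- apply (Rmult_le_reg_r (dn (t + ellK k) k)); [lra|].
  unfold Rdiv. rewrite Rmult_assoc, Rinv_l by lra. lra.
Qed.

Lemma dnq_pos t : 0 < dnq t.
Proof. pose proof (dnq_bound t). pose proof (compl_pos k hk). lra. Qed.

Lemma dnq_0 : dnq 0 = 1.
Proof.
unfold dnq. rewrite Rplus_0_l, dn_K by auto. field. pose proof (compl_pos k hk). lra.
Qed.

Lemma dnq_K : dnq (ellK k) = sqrt (1 - k ^ 2).
Proof.
unfold dnq. replace (ellK k + ellK k) with (0 + 2 * ellK k) by ring.
rewrite dn_shift, dn_0 by auto. field.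
Qed.

Lemma Hmod_pos t : 0 < 2 - k ^ 2 - dnq t ^ 2.
Proof.
pose proof (dnq_bound t). pose proof (dnq_pos t). pose proof (modulus_sq k hk). nra.
Qed.

(** Otherwise the normalising factor of [w12] would be 0 by convention, and [w12] could not have the
    positive modulus [Hmod]. *)
Lemma w_plus_0_nonzero : q0 <> 0.
Proof.
intros H. pose proof (Hmod 0) as H0. pose proof (Hmod_pos 0) as H1.
unfold w12 in H0. fold q0 in H0. rewrite H in H0. unfold Rdiv in H0.
rewrite Rinv_0, Rmult_0_r, Cmult_0_l, Cmod_0 in H0. simpl in *. lra.
Qed.

Lemma axT_real_nonzero t : axT d er t <> 0.
Proof.
intros H. pose proof (Hmod t) as H0. pose proof (Hmod_pos t) as H1.
unfold w12 in H0. rewrite (w_plus_eq t), H in H0.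
assert (E : (RtoC (sqrt (1 - k ^ 2) / Im (w_plus k 0)) * (thH d (RtoC t * er - RtoC m * ei) / RtoC 0 * Cexp (Ci * RtoC (phase_rate * t))))%C = 0).
{ unfold Cdiv. replace (/ RtoC 0)%C with (RtoC 0); [ring|].
  unfold Cinv, RtoC. simpl. unfold Rdiv. f_equal; ring. }
rewrite E, Cmod_0 in H0. simpl in *. lra.
Qed.

Lemma w12_mod_theta t : (1 - k ^ 2) / q0 ^ 2 * (Nx t / axT d er t ^ 2) = 2 - k ^ 2 - dnq t ^ 2.
Proof.
rewrite <- Hmod. unfold w12. fold q0. rewrite (w_plus_eq t).
pose proof (axT_real_nonzero t) as HT. pose proof w_plus_0_nonzero as Hq.
rewrite !Cmod_mult, Cmod_Cexp_Ci, Cmod_div, !Cmod_R.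
2:{ intros E. apply RtoC_inj in E. auto. }
assert (HM : Cmod (thH d (RtoC t * er - RtoC m * ei)) ^ 2 = Nx t) by (unfold er, ei; now rewrite thH_mixed).
set (M := Cmod (thH d (RtoC t * er - RtoC m * ei))) in *.
transitivity (Rabs (sqrt (1 - k ^ 2) / q0) ^ 2 * M ^ 2 / Rabs (axT d er t) ^ 2).
- rewrite !pow2_abs, HM. unfold Rdiv at 4. rewrite Rpow_mult_distr, (compl_sq k hk). field. auto.
- field. now apply Rabs_no_R0.
Qed.

Lemma Nr_pos t : 0 < Nr t.
Proof.
rewrite Nr_eq. pose proof (axT_real_nonzero t). rewrite <- Rsqr_pow2. now apply Rsqr_pos_lt.
Qed.

Let p := a * a - b * b.
Let s := a * a + b * b.

Lemma p_pos : 0 < p.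
Proof. pose proof (Nr_pos 0) as H. unfold Nr in H. rewrite axA_0, axB_0 in H. exact H. Qed.

Lemma s_pos : 0 < s.
Proof. unfold s. nra. Qed.

(** The classical [H(x+y) H(x-y) T(0)^2 = H(x)^2 T(y)^2 - T(x)^2 H(y)^2], with [p = T(0)^2] and
    [Mi = - H^2] on the imaginary axis. It separates the ratio at the real point from the constants
    at [i alpha]. *)
Lemma Nx_decomposition t : p * Nx t = Mr t * Ni m + Nr t * Mi m.
Proof. unfold p, Nx, Mr, Ni, Nr, Mi. ring. Qed.

Lemma Nr_0 : Nr 0 = p.
Proof. unfold Nr. now rewrite axA_0, axB_0. Qed.

Lemma Nx_0 : Nx 0 = Mi m.
Proof.
pose proof (Nx_decomposition 0) as H. pose proof p_pos as Hp. rewrite Nr_0 in H.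
assert (HM0 : Mr 0 = 0) by (unfold Mr; rewrite axA_0, axB_0; unfold a, b; ring).
rewrite HM0 in H. apply (Rmult_eq_reg_l p); lra.
Qed.

Lemma w_plus_0_sq : q0 ^ 2 * p = Mi m.
Proof.
pose proof (w12_mod_theta 0) as H. pose proof w_plus_0_nonzero as Hq. pose proof p_pos as Hp.
rewrite dnq_0, <- Nr_eq, Nx_0, Nr_0 in H.
replace (2 - k ^ 2 - 1 ^ 2) with (1 - k ^ 2) in H by ring.
pose proof (modulus_sq k hk).
apply (Rmult_eq_reg_l ((1 - k ^ 2) / q0 ^ 2 / p)).
- transitivity (1 - k ^ 2); [field; split; auto; lra|]. rewrite <- H at 1. field. split; auto; lra.
- apply Rgt_not_eq. assert (Hq2 : 0 < q0 ^ 2) by (rewrite <- Rsqr_pow2; now apply Rsqr_pos_lt).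
  apply Rdiv_lt_0_compat; [apply Rdiv_lt_0_compat|]; lra.
Qed.

Lemma Mi_alpha_pos : 0 < Mi m.
Proof.
rewrite <- w_plus_0_sq. apply Rmult_lt_0_compat; [|apply p_pos].
rewrite <- Rsqr_pow2. apply Rsqr_pos_lt, w_plus_0_nonzero.
Qed.

(** The modulus formula solved for [Mr / Nr]; the normalisation [q0] is eliminated by the same
    formula at [t = 0]. *)
Lemma theta_ratio_dnq t : Mr t * Ni m * (1 - k ^ 2) = Mi m * (1 - dnq t ^ 2) * Nr t.
Proof.
pose proof (w12_mod_theta t) as H. rewrite <- Nr_eq in H. pose proof w_plus_0_sq as Hq.
pose proof w_plus_0_nonzero as Hq0. pose proof p_pos as Hp. pose proof Mi_alpha_pos as HM. pose proof (Nr_pos t) as HN.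
pose proof (Nx_decomposition t) as HX.
replace (q0 ^ 2) with (Mi m / p) in H by (rewrite <- Hq; field; lra).
assert (HX' : Nx t = (Mr t * Ni m + Nr t * Mi m) / p) by (rewrite <- HX; field; lra).
rewrite HX' in H.
assert (E : (1 - k ^ 2) * (Mr t * Ni m + Nr t * Mi m) = (2 - k ^ 2 - dnq t ^ 2) * (Mi m * Nr t)).
{ rewrite <- H. field. repeat split; lra. }
lra.
Qed.

(** At [t = ellK k] one has [dnq^2 = 1 - k^2 < 1], so the right side of [theta_ratio_dnq] is
    positive there and the factor [Ni m] on the left cannot vanish. *)
Lemma Ni_alpha_pos : 0 < Ni m.
Proof.
assert (H0 : 0 <= Ni m) by (rewrite Ni_eq; apply pow2_ge_0).
destruct H0 as [H0|H0]; auto. exfalso.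
pose proof (theta_ratio_dnq (ellK k)) as H. rewrite <- H0, dnq_K, compl_sq in H by auto.
pose proof Mi_alpha_pos. pose proof (Nr_pos (ellK k)). pose proof (modulus_sq k hk).
assert (0 < Mi m * (1 - (1 - k ^ 2)) * Nr (ellK k)); [|lra].
apply Rmult_lt_0_compat; [apply Rmult_lt_0_compat|]; lra.
Qed.

(** The maximum of [f] on the real axis, attained at [ellK k]; classically [f = k sn^2], and the
    constant is [k]. *)
Let Cc := Mi m / Ni m * (k ^ 2 / (1 - k ^ 2)).
Let f t := Mr t / Nr t.

Lemma Cc_pos : 0 < Cc.
Proof.
pose proof Mi_alpha_pos. pose proof Ni_alpha_pos. pose proof (modulus_sq k hk).
unfold Cc. apply Rmult_lt_0_compat; apply Rdiv_lt_0_compat; lra.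
Qed.

Lemma f_dnq t : f t = Cc / k ^ 2 * (1 - dnq t ^ 2).
Proof.
unfold f, Cc. pose proof (theta_ratio_dnq t) as H. pose proof Ni_alpha_pos. pose proof (Nr_pos t).
pose proof (modulus_sq k hk).
replace (Mr t) with (Mr t * Ni m * (1 - k ^ 2) / (Ni m * (1 - k ^ 2))) by (field; lra).
rewrite H. field. repeat split; lra.
Qed.

Let dnq' t := - sqrt (1 - k ^ 2) * dn' k (t + ellK k) / dn (t + ellK k) k ^ 2.

Lemma dnq_derive t : is_derive dnq t (dnq' t).
Proof.
pose proof (dn_pos k hk (t + ellK k)) as Hp.
assert (H : is_derive (fun t => dn (t + ellK k) k) t (dn' k (t + ellK k))).
{ replace (dn' k (t + ellK k)) with (1 * dn' k (t + ellK k)) by ring.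
  apply (is_derive_comp (fun u => dn u k) (fun t => t + ellK k) t (dn' k (t + ellK k)) 1); [now apply dn_derive|].
  auto_derive; trivial. }
unfold dnq.
replace (dnq' t) with ((0 * dn (t + ellK k) k - sqrt (1 - k ^ 2) * dn' k (t + ellK k)) / dn (t + ellK k) k ^ 2).
- apply (is_derive_div (fun _ => sqrt (1 - k ^ 2)) (fun t => dn (t + ellK k) k)); auto; [|lra].
  apply is_derive_cst.
- unfold dnq'. field. lra.
Qed.

Lemma dnq_ode t : dnq' t ^ 2 = (1 - dnq t ^ 2) * (dnq t ^ 2 - (1 - k ^ 2)).
Proof.
pose proof (dn_pos k hk (t + ellK k)) as Hp. pose proof (dn_ode k hk (t + ellK k)) as H.
pose proof (compl_sq k hk) as Hc.
unfold dnq', dnq. set (D := dn (t + ellK k) k) in *. set (D' := dn' k (t + ellK k)) in *.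
set (c := sqrt (1 - k ^ 2)) in *.
replace ((- c * D' / D ^ 2) ^ 2) with (c ^ 2 * D' ^ 2 / D ^ 4) by (field; lra).
rewrite H, <- Hc. field. lra.
Qed.

Let E := 2 * l ^ 2 * thH0' d ^ 2 / (a * b * s * p).

Lemma f_theta_ode t : exists f', is_derive f t f' /\ f' ^ 2 = E * f t * (2 * a * b - s * f t) * (s - 2 * a * b * f t).
Proof.
pose proof (Nr_pos t) as HN. pose proof p_pos as Hp. pose proof s_pos as Hs.
set (D := axA' d er t * axB d er t - axB' d er t * axA d er t).
exists (p * D / Nr t ^ 2). split.
- replace (p * D / Nr t ^ 2) with (((axA' d er t * b - axB' d er t * a) * Nr t - Mr t * (axA' d er t * a - axB' d er t * b)) / Nr t ^ 2).
  + apply is_derive_div; [| |lra].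
    * apply is_derive_lincomb; [apply axA_derive|apply axB_derive]; apply Hd.
    * apply is_derive_lincomb; [apply axA_derive|apply axB_derive]; apply Hd.
  + unfold D, p, Nr, Mr. f_equal. ring.
- pose proof (quartic_ratio (axA d er t) (axB d er t) a b D (l ^ 2 * 2 * thH0' d ^ 2)) as H. cbv zeta in H.
  fold p s in H. fold (Nr t) in H. fold (Mr t) in H. fold (f t) in H.
  rewrite H; try lra.
  + unfold E. f_equal. f_equal. f_equal. f_equal. ring.
  + apply (axis_quartic d Hd er (l ^ 2) t Her). unfold er. rewrite <- RtoC_mult. f_equal. ring.
Qed.

Lemma f_derive t : is_derive f t (- 2 * (Cc / k ^ 2) * (dnq t * dnq' t)).
Proof.
apply (is_derive_ext (fun t => Cc / k ^ 2 * (1 - dnq t ^ 2))).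
- intros x. symmetry. apply f_dnq.
- replace (- 2 * (Cc / k ^ 2) * (dnq t * dnq' t)) with (Cc / k ^ 2 * (0 - INR 2 * dnq' t * dnq t ^ Init.Nat.pred 2)) by (simpl; ring).
  apply is_derive_scal. apply (is_derive_minus (fun _ => 1) (fun t => dnq t ^ 2)).
  + apply is_derive_cst.
  + apply is_derive_pow, dnq_derive.
Qed.

Lemma f_two_odes t :
  E * f t * (2 * a * b - s * f t) * (s - 2 * a * b * f t) = 4 * f t * (1 - f t / Cc) * (Cc - k ^ 2 * f t).
Proof.
destruct (f_theta_ode t) as [f' [H1 H2]]. rewrite <- H2.
pose proof (f_derive t) as H3. apply is_derive_unique in H1. apply is_derive_unique in H3.
rewrite H1 in H3. rewrite H3.
replace ((-2 * (Cc / k ^ 2) * (dnq t * dnq' t)) ^ 2) with (4 * (Cc / k ^ 2) ^ 2 * dnq t ^ 2 * dnq' t ^ 2) by ring.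
rewrite dnq_ode, f_dnq. pose proof Cc_pos. pose proof (modulus_sq k hk). field. split; lra.
Qed.

Lemma f_surj x : 0 <= x <= Cc -> exists t, f t = x.
Proof.
intros Hx. pose proof Cc_pos. pose proof (modulus_sq k hk).
destruct (IVT_gen f 0 (ellK k) x) as [t [_ Ht]]; eauto.
- intros t. eapply is_derive_continuity, f_derive.
- rewrite !f_dnq, dnq_0, dnq_K, compl_sq by auto.
  replace (Cc / k ^ 2 * (1 - 1 ^ 2)) with 0 by ring.
  replace (Cc / k ^ 2 * (1 - (1 - k ^ 2))) with Cc by (field; lra).
  rewrite Rmin_left, Rmax_right by lra. lra.
Qed.

(** Since [f] takes every value in [[0, Cc]], the two cubics of [f_two_odes] have equal
    coefficients. This expresses the theta constants by [k] and [Cc], which is all that the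
    imaginary axis requires. *)
Lemma ode_coefficients : E * (2 * a * b * s) = 4 * Cc /\ E * (s * s + 4 * a * b * a * b) = 4 * (1 + k ^ 2) /\
  E * (2 * a * b * s) = 4 * k ^ 2 / Cc.
Proof.
pose proof Cc_pos as HC.
assert (HP : forall x, 0 < x <= Cc -> (E * (2 * a * b * s) - 4 * Cc) + (4 * (1 + k ^ 2) - E * (s * s + 4 * a * b * a * b)) * x
   + (E * (2 * a * b * s) - 4 * k ^ 2 / Cc) * (x * x) = 0).
{ intros x Hx. destruct (f_surj x ltac:(lra)) as [t Ht].
  pose proof (f_two_odes t) as H. rewrite Ht in H.
  apply (Rmult_eq_reg_l x); [|lra].
  apply Rminus_diag_eq in H. rewrite Rmult_0_r, <- H. field. lra. }
(* A quadratic polynomial with three distinct zeros is 0. *)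
pose proof (HP Cc ltac:(lra)) as H1. pose proof (HP (Cc / 2) ltac:(lra)) as H2. pose proof (HP (Cc / 4) ltac:(lra)) as H3.
set (p0 := E * (2 * a * b * s) - 4 * Cc) in *. set (p1 := 4 * (1 + k ^ 2) - E * (s * s + 4 * a * b * a * b)) in *.
set (p2 := E * (2 * a * b * s) - 4 * k ^ 2 / Cc) in *.
assert (G1 : p0 + p1 * Cc + p2 * (Cc * Cc) = 0) by lra.
assert (G2 : p0 + p1 * Cc / 2 + p2 * (Cc * Cc) / 4 = 0) by (rewrite <- H2; field).
assert (G3 : p0 + p1 * Cc / 4 + p2 * (Cc * Cc) / 16 = 0) by (rewrite <- H3; field).
assert (P0 : p0 = 0) by lra.
assert (P1 : p1 * Cc = 0) by lra. assert (P2 : p2 * (Cc * Cc) = 0) by lra.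
apply Rmult_integral in P1. apply Rmult_integral in P2.
assert (0 < Cc * Cc) by nra.
destruct P1 as [P1|P1]; [|lra]. destruct P2 as [P2|P2]; [|lra].
unfold p0, p1, p2 in *. repeat split; lra.
Qed.

Lemma thH0'_nonzero : thH0' d <> 0.
Proof.
intros H. destruct ode_coefficients as [H1 _]. unfold E in H1. rewrite H in H1.
pose proof Cc_pos. simpl in H1. unfold Rdiv in H1. rewrite !Rmult_0_l, !Rmult_0_r, !Rmult_0_l in H1. lra.
Qed.

(** * The ratio of theta functions on the imaginary axis *)

Let Ni' y := axA' d ei y * a - axB' d ei y * b.
Let Mi' y := axB' d ei y * a - axA' d ei y * b.

Lemma Ni_derive y : is_derive Ni y (Ni' y).
Proof. apply is_derive_lincomb; [apply axA_derive|apply axB_derive]; apply Hd. Qed.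

Lemma Mi_derive y : is_derive Mi y (Mi' y).
Proof. apply is_derive_lincomb; [apply axB_derive|apply axA_derive]; apply Hd. Qed.

(** The quartic of the real axis again, now with [eps = - l ^ 2] and with [- Mi / Ni] in the place
    of [f]; the coefficients are those found in [ode_coefficients]. *)
Lemma imag_ratio_ode y : Ni y <> 0 -> ((Mi' y * Ni y - Mi y * Ni' y) / Ni y ^ 2) ^ 2 =
  4 * (Mi y / Ni y) * (1 + (Mi y / Ni y) / Cc) * (Cc + k ^ 2 * (Mi y / Ni y)).
Proof.
intros HN. pose proof p_pos as Hp. pose proof s_pos as Hs.
set (D := axA' d ei y * axB d ei y - axB' d ei y * axA d ei y).
pose proof (quartic_ratio (axA d ei y) (axB d ei y) a b D (- l ^ 2 * 2 * thH0' d ^ 2)) as H. cbv zeta in H.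
fold p s in H. fold (Ni y) in H.
replace ((axA d ei y * b - axB d ei y * a) / Ni y) with (- (Mi y / Ni y)) in H by (unfold Mi; field; auto).
replace ((Mi' y * Ni y - Mi y * Ni' y) / Ni y ^ 2) with (- (p * D / Ni y ^ 2)).
2:{ replace (Mi' y * Ni y - Mi y * Ni' y) with (- (p * D)) by (unfold Mi', Ni', Mi, Ni, p, D; ring). field; auto. }
replace ((- (p * D / Ni y ^ 2)) ^ 2) with ((p * D / Ni y ^ 2) ^ 2) by ring.
rewrite H; auto; [|lra|].
- set (g := Mi y / Ni y). destruct ode_coefficients as [C1 [C2 C3]].
  pose proof Cc_pos as HC.
  replace (- l ^ 2 * 2 * thH0' d ^ 2 / (a * b * s * p)) with (- E) by (unfold E; field; repeat split; lra).
  transitivity (g * (E * (2 * a * b * s) + E * (s * s + 4 * a * b * a * b) * g + E * (2 * a * b * s) * (g * g))); [ring|].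
  rewrite C2. rewrite C1 at 1. rewrite C3. field. lra.
- apply (axis_quartic d Hd ei (- l ^ 2) y Hei). unfold ei.
  replace (Ci * RtoC l * (Ci * RtoC l))%C with ((Ci * Ci) * (RtoC l * RtoC l))%C by ring.
  rewrite <- RtoC_mult. apply C_eq; unfold Re, Im; simpl; ring.
Qed.

(** [Mi] is the square of a function whose derivative at 0 is [l * thH0' d], which is not 0. This
    excludes the constant solution 0 of the differential equation. *)
Lemma Mi_nonzero_near_0 e : 0 < e -> exists y, 0 <= y <= e /\ Mi y <> 0.
Proof.
intros He.
assert (Hdiff : is_derive (fun y => Im (thH d (RtoC y * ei))) 0 (l * thH0' d)).
{ destruct (axis_derive (thH d) (thH' d) (thH_diff d Hd) ei 0) as [_ H].
  rewrite Cmult_0_l, thH0'_eq in H by auto. unfold ei at 2 in H.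
  replace (Im (Ci * RtoC l * RtoC (thH0' d)))%C with (l * thH0' d) in H by (unfold Im; simpl; ring).
  exact H. }
apply is_derive_Reals in Hdiff.
set (L := l * thH0' d) in *.
assert (HL : L <> 0) by (apply Rmult_integral_contrapositive_currified; [lra|apply thH0'_nonzero]).
destruct (Hdiff (Rabs L) (Rabs_pos_lt _ HL)) as [del Hdel].
set (y := Rmin e (del / 2)). pose proof (cond_pos del).
assert (Hy : 0 < y) by (apply Rmin_pos; lra).
assert (Hy1 : y <= e) by apply Rmin_l. assert (Hy2 : y <= del / 2) by apply Rmin_r.
exists y. split; [lra|]. rewrite Mi_eq. intros Hz.
specialize (Hdel y ltac:(lra) ltac:(rewrite Rabs_pos_eq; lra)).
rewrite Rplus_0_l, Cmult_0_l, thH_0 in Hdel by auto.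
replace (RtoC y * ei)%C with (Ci * RtoC (y * l))%C in Hdel by (unfold ei; rewrite RtoC_mult; ring).
assert (Hz' : Im (thH d (Ci * RtoC (y * l))) = 0).
{ rewrite <- Rsqr_pow2 in Hz. now apply Rsqr_0_uniq. }
rewrite Hz' in Hdel. change (Im (RtoC 0)) with 0 in Hdel.
replace ((0 - 0) / y - L) with (- L) in Hdel by (field; lra). rewrite Rabs_Ropp in Hdel. lra.
Qed.

Lemma imag_ratio_derive_pos : 0 < (Mi' m * Ni m - Mi m * Ni' m) / Ni m ^ 2.
Proof.
destruct (elliptic_time k (compl k) Cc Ni Mi Ni' Mi' hk eq_refl Cc_pos Ni_derive Mi_derive) as [_ H].
- intros y. rewrite Ni_eq. apply pow2_ge_0.
- intros y. rewrite Mi_eq. apply pow2_ge_0.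
(* [a Ni + b Mi = p axA], and both factors on the right are positive. *)
- intros y. destruct (Req_dec (Ni y) 0) as [H1|]; auto. destruct (Req_dec (Mi y) 0) as [H2|]; auto. exfalso.
  unfold Ni, Mi in *. pose proof (axA_imag_pos d Hd l y) as HA. fold ei in HA.
  assert (p * axA d ei y = 0); [|pose proof p_pos; nra].
  transitivity (a * (axA d ei y * a - axB d ei y * b) + b * (axB d ei y * a - axA d ei y * b)).
  + unfold p. ring.
  + rewrite H1, H2. ring.
- unfold Mi. rewrite axA_0, axB_0. unfold a, b. ring.
- apply Mi_nonzero_near_0.
- apply imag_ratio_ode.
- rewrite <- alpha_eq in H by auto. exact H.
Qed.

(** Put [g = Mi m / Ni m]. By definition of [Cc], [g / Cc = (1 - k^2) / k^2], so the cubic gives the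
    squared logarithmic derivative [4 (2 - k^2) / (1 - k^2)]; [imag_ratio_derive_pos] picks the
    positive root. *)
Lemma imag_ratio_log_derive : (Mi' m * Ni m - Mi m * Ni' m) / (2 * Ni m * Mi m) = sqrt (2 - k ^ 2) / sqrt (1 - k ^ 2).
Proof.
pose proof Ni_alpha_pos as HN. pose proof Mi_alpha_pos as HM. pose proof imag_ratio_derive_pos as H.
pose proof (imag_ratio_ode m ltac:(lra)) as Ho. pose proof (modulus_sq k hk) as Hk2.
pose proof (compl_pos k hk) as Hc. pose proof (compl_sq k hk) as Hc2.
assert (Hm : 0 < sqrt (2 - k ^ 2)) by (apply sqrt_lt_R0; lra).
assert (Hm2 : sqrt (2 - k ^ 2) ^ 2 = 2 - k ^ 2) by (apply pow2_sqrt; lra).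
set (x := (Mi' m * Ni m - Mi m * Ni' m) / Ni m ^ 2) in *.
replace ((Mi' m * Ni m - Mi m * Ni' m) / (2 * Ni m * Mi m)) with (x * Ni m / (2 * Mi m)) by (unfold x; field; lra).
assert (HL : 0 < x * Ni m / (2 * Mi m)) by (apply Rdiv_lt_0_compat; [apply Rmult_lt_0_compat|]; lra).
assert (HR : 0 < sqrt (2 - k ^ 2) / sqrt (1 - k ^ 2)) by (apply Rdiv_lt_0_compat; lra).
assert (HS : (x * Ni m / (2 * Mi m)) ^ 2 = (sqrt (2 - k ^ 2) / sqrt (1 - k ^ 2)) ^ 2).
{ unfold Rdiv. rewrite !Rpow_mult_distr, Ho, !pow_inv, Hc2, Hm2. unfold Cc. field. repeat split; lra. }
nra.
Qed.

(** * The angular velocity of w_+ *)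

Let u t := thH d (RtoC t * er - RtoC m * ei).
Let u' t := (er * thH' d (RtoC t * er - RtoC m * ei))%C.

Lemma u_derive t : is_derive (fun t => Re (u t)) t (Re (u' t)) /\ is_derive (fun t => Im (u t)) t (Im (u' t)).
Proof.
unfold u, u'. destruct (quad_diff_line (thH d) (- (RtoC m * ei)) er (thH' d (RtoC t * er - RtoC m * ei)) t) as [H1 H2].
- replace (- (RtoC m * ei) + RtoC t * er)%C with (RtoC t * er - RtoC m * ei)%C by ring. apply thH_diff; auto.
- split; (eapply is_derive_ext; [|eassumption]); intros x; cbv beta; do 2 f_equal; ring.
Qed.

(* By the Cauchy-Riemann equations the angular derivative of [u] along the real
   direction is half the derivative of its squared modulus along the imaginary one. *)
Lemma u_angular t : 2 * (Re (u t) * Im (u' t) - Im (u t) * Re (u' t)) =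
  axA d er t * axB' d ei m - axB d er t * axA' d ei m.
Proof.
set (G := fun y => Re (thH d (RtoC t * er + RtoC y * (- ei))) ^ 2 + Im (thH d (RtoC t * er + RtoC y * (- ei))) ^ 2).
assert (H1 : is_derive G m (axA d er t * axB' d ei m - axB d er t * axA' d ei m)).
{ apply (is_derive_ext (fun y => axA d er t * axB d ei y - axB d er t * axA d ei y)).
  - intros y. unfold G. rewrite <- Cmod2_alt.
    replace (RtoC t * er + RtoC y * - ei)%C with (RtoC t * er - RtoC y * ei)%C by ring.
    unfold er, ei. now rewrite thH_mixed.
  - apply (is_derive_minus (fun y => axA d er t * axB d ei y)).
    + apply is_derive_scal, axB_derive, Hd.
    + apply is_derive_scal, axA_derive, Hd. }
destruct (quad_diff_line (thH d) (RtoC t * er) (- ei) (thH' d (RtoC t * er - RtoC m * ei)) m) as [D1 D2].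
{ replace (RtoC t * er + RtoC m * - ei)%C with (RtoC t * er - RtoC m * ei)%C by ring. apply thH_diff; auto. }
assert (H2 : is_derive G m (INR 2 * Re (- ei * thH' d (RtoC t * er - RtoC m * ei))%C * Re (u t) ^ Init.Nat.pred 2
   + INR 2 * Im (- ei * thH' d (RtoC t * er - RtoC m * ei))%C * Im (u t) ^ Init.Nat.pred 2)).
{ unfold u. replace (RtoC t * er - RtoC m * ei)%C with (RtoC t * er + RtoC m * - ei)%C by ring.
  replace (RtoC t * er - RtoC m * ei)%C with (RtoC t * er + RtoC m * - ei)%C in D1, D2 by ring.
  apply (is_derive_plus (fun y => Re (thH d (RtoC t * er + RtoC y * (- ei))) ^ 2)).
  - apply is_derive_pow. exact D1.
  - apply is_derive_pow. exact D2. }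
apply is_derive_unique in H1. apply is_derive_unique in H2. rewrite <- H1, H2.
unfold u'. generalize (thH' d (RtoC t * er - RtoC m * ei)). generalize (u t).
intros [ux uy] [vx vy]. unfold er, ei, Re, Im. simpl. ring.
Qed.

Definition w_wronskian : R := sqrt (1 - k ^ 2) * sqrt (2 - k ^ 2).

(** In [w = c e^(i xi t) u / T] the numbers [c] and [T] are real, so the Wronskian is [c^2 / T^2]
    times the angular derivative of [u] plus [xi |u|^2]. *)
Lemma w12_wronskian t : exists w1' w2', is_derive (w1 k) t w1' /\ is_derive (w2 k) t w2' /\
  w1 k t * w2' - w2 k t * w1' = w_wronskian.
Proof.
set (c := sqrt (1 - k ^ 2) / q0).
set (T := axT d er). set (T' := axT' d er). set (xi := phase_rate).
destruct (u_derive t) as [Du1 Du2].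
pose proof (axT_derive d Hd er) as DT. fold T T' in DT.
assert (HT : forall x, T x <> 0) by apply axT_real_nonzero.
set (P := fun x => Re (u x)) in *. set (Q := fun x => Im (u x)) in *.
assert (Hw1 : forall x, c * ((P x * cos (xi * x) - Q x * sin (xi * x)) / T x) = w1 k x).
{ intros x. unfold w1, w12. fold q0 c. rewrite (w_plus_eq x). fold (u x) T xi. unfold P, Q.
  unfold Cdiv. rewrite <- RtoC_inv by auto.
  unfold Cexp. destruct (u x) as [ux uy]. unfold Re, Im. simpl.
  replace (0 * (xi * x) - 1 * 0) with 0 by ring. replace (0 * 0 + 1 * (xi * x)) with (xi * x) by ring.
  rewrite exp_0. field. auto. }
assert (Hw2 : forall x, c * ((P x * sin (xi * x) + Q x * cos (xi * x)) / T x) = w2 k x).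
{ intros x. unfold w2, w12. fold q0 c. rewrite (w_plus_eq x). fold (u x) T xi. unfold P, Q.
  unfold Cdiv. rewrite <- RtoC_inv by auto.
  unfold Cexp. destruct (u x) as [ux uy]. unfold Re, Im. simpl.
  replace (0 * (xi * x) - 1 * 0) with 0 by ring. replace (0 * 0 + 1 * (xi * x)) with (xi * x) by ring.
  rewrite exp_0. field. auto. }
set (P' := Re (u' t)) in *. set (Q' := Im (u' t)) in *.
assert (Dc : is_derive (fun x => cos (xi * x)) t (- xi * sin (xi * t))) by (auto_derive; trivial; ring).
assert (Ds : is_derive (fun x => sin (xi * x)) t (xi * cos (xi * t))) by (auto_derive; trivial; ring).
set (co := cos (xi * t)) in *. set (si := sin (xi * t)) in *.
set (n1' := (P' * co + P t * (- xi * si)) - (Q' * si + Q t * (xi * co))).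
set (n2' := (P' * si + P t * (xi * co)) + (Q' * co + Q t * (- xi * si))).
exists (c * ((n1' * T t - (P t * co - Q t * si) * T' t) / T t ^ 2)),
  (c * ((n2' * T t - (P t * si + Q t * co) * T' t) / T t ^ 2)).
split; [|split].
- apply (is_derive_ext _ _ t _ Hw1). apply is_derive_scal.
  apply (is_derive_div (fun x => P x * cos (xi * x) - Q x * sin (xi * x)) T); auto.
  apply (is_derive_minus (fun x => P x * cos (xi * x)) (fun x => Q x * sin (xi * x))); apply is_derive_Rmult; auto.
- apply (is_derive_ext _ _ t _ Hw2). apply is_derive_scal.
  apply (is_derive_div (fun x => P x * sin (xi * x) + Q x * cos (xi * x)) T); auto.
  apply (is_derive_plus (fun x => P x * sin (xi * x)) (fun x => Q x * cos (xi * x))); apply is_derive_Rmult; auto.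
- rewrite <- Hw1, <- Hw2. fold co si.
  assert (Hcs : co ^ 2 + si ^ 2 = 1).
  { unfold co, si. pose proof (sin2_cos2 (xi * t)) as H. unfold Rsqr in H. simpl. lra. }
  transitivity (c ^ 2 / T t ^ 2 * (co ^ 2 + si ^ 2) * ((P t * Q' - Q t * P') + xi * (P t ^ 2 + Q t ^ 2))).
  { unfold n1', n2'. field. auto. }
  rewrite Hcs.
  assert (Hang : P t * Q' - Q t * P' = (axA d er t * axB' d ei m - axB d er t * axA' d ei m) / 2).
  { rewrite <- u_angular. unfold P, Q, P', Q'. field. }
  assert (Hmodu : P t ^ 2 + Q t ^ 2 = Nx t).
  { unfold P, Q. rewrite <- Cmod2_alt. unfold u, er, ei. rewrite thH_mixed by auto. reflexivity. }
  rewrite Hang, Hmodu.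
  pose proof Ni_alpha_pos as HN. pose proof Mi_alpha_pos as HM. pose proof p_pos as Hp.
  pose proof (Nr_pos t) as HNr. pose proof w_plus_0_sq as Hq. pose proof w_plus_0_nonzero as Hq0.
  pose proof imag_ratio_log_derive as HD. pose proof (Nx_decomposition t) as HNx.
  (* [Ni] is the square of [Theta] on the imaginary axis, hence the factor 2. *)
  assert (Hxi : xi = - (Ni' m / (2 * Ni m))).
  { assert (HT2 : Ni' m = 2 * axT d ei m * axT' d ei m).
    { pose proof (Ni_derive m) as D1.
      assert (D2 : is_derive Ni m (INR 2 * axT' d ei m * axT d ei m ^ Init.Nat.pred 2)).
      { apply (is_derive_ext (fun y => axT d ei y ^ 2)); [intros; symmetry; apply Ni_eq|].
        apply is_derive_pow, axT_derive, Hd. }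
      apply is_derive_unique in D1. apply is_derive_unique in D2. rewrite <- D1, D2. simpl. ring. }
    rewrite HT2, Ni_eq. unfold xi, phase_rate.
    assert (axT d ei m <> 0). { intros H0. rewrite Ni_eq, H0 in HN. simpl in HN. lra. }
    field. auto. }
  assert (HNx' : p * (axA d er t * axB' d ei m - axB d er t * axA' d ei m) = Mr t * Ni' m + Nr t * Mi' m).
  { unfold p, Mr, Ni', Nr, Mi'. ring. }
  (* The terms with [Mr] cancel because of the value of [xi]. What remains is proportional to
     [Nr = T^2], so the Wronskian does not depend on [t]. *)
  assert (E1 : (axA d er t * axB' d ei m - axB d er t * axA' d ei m) / 2 + xi * Nx t =
     Nr t * ((Mi' m * Ni m - Mi m * Ni' m) / (2 * Ni m * Mi m)) * (Mi m / p)).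
  { apply (Rmult_eq_reg_l p); [|lra].
    transitivity ((p * (axA d er t * axB' d ei m - axB d er t * axA' d ei m)) / 2 + xi * (p * Nx t)); [field|].
    rewrite HNx', HNx, Hxi. field. lra. }
  rewrite E1, HD.
  replace (T t ^ 2) with (Nr t) by apply Nr_eq.
  unfold c. replace (Mi m / p) with (q0 ^ 2) by (rewrite <- Hq; field; lra).
  unfold w_wronskian. pose proof (compl_pos k hk). field. repeat split; lra.
Qed.

End Wronskian.

(** * The elastica *)

Section Kappa.

Variables k sstar : R.
Hypothesis hk : 0 < k < 1.

Let M := sqrt (2 - k ^ 2).

Lemma sqrtm_pos : 0 < sqrt (2 - k ^ 2).
Proof. apply sqrt_lt_R0. pose proof (modulus_sq k hk). lra. Qed.

Lemma sqrtm_sq : sqrt (2 - k ^ 2) ^ 2 = 2 - k ^ 2.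
Proof. apply pow2_sqrt. pose proof (modulus_sq k hk). lra. Qed.

Definition kappa' (s : R) : R := 2 / (2 - k ^ 2) * dn' k ((s + sstar) / sqrt (2 - k ^ 2)).

Lemma kappa_derive s : is_derive (kappa k sstar) s (kappa' s).
Proof.
pose proof sqrtm_pos as HM. pose proof sqrtm_sq as HM2.
unfold kappa, kappa'. fold M in HM, HM2 |- *.
replace (2 / (2 - k ^ 2) * dn' k ((s + sstar) / M)) with (2 / M * (/ M * dn' k ((s + sstar) / M))).
- apply is_derive_scal.
  apply (is_derive_comp (fun u => dn u k) (fun s => (s + sstar) / M) s (dn' k ((s + sstar) / M)) (/ M)).
  + now apply dn_derive.
  + auto_derive; trivial. field. lra.
- rewrite <- HM2. field. lra.
Qed.

(** The elastica equation [kappa'' = kappa - kappa^3 / 2]; [kappa_ode] is its first integral, with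
    [mu] as the constant. *)
Lemma kappa'_derive s : is_derive kappa' s (kappa k sstar s - kappa k sstar s ^ 3 / 2).
Proof.
pose proof sqrtm_pos as HM. pose proof sqrtm_sq as HM2.
unfold kappa, kappa'. fold M in HM, HM2 |- *. set (u := (s + sstar) / M).
replace (2 / M * dn u k - (2 / M * dn u k) ^ 3 / 2) with
  (2 / (2 - k ^ 2) * (/ M * ((2 - k ^ 2) * dn u k - 2 * dn u k ^ 3))).
- apply is_derive_scal.
  apply (is_derive_comp (dn' k) (fun s => (s + sstar) / M) s ((2 - k ^ 2) * dn u k - 2 * dn u k ^ 3) (/ M)).
  + now apply dn'_derive.
  + auto_derive; trivial. field. lra.
- rewrite <- HM2. field. lra.
Qed.

Lemma kappa_pos s : 0 < kappa k sstar s.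
Proof.
unfold kappa. pose proof sqrtm_pos. apply Rmult_lt_0_compat.
- apply Rdiv_lt_0_compat; lra.
- now apply dn_pos.
Qed.

Lemma mu_pos : 0 < mu k.
Proof.
unfold mu. pose proof (modulus_sq k hk). apply Rdiv_lt_0_compat; [lra|]. apply pow_lt. lra.
Qed.

Lemma kappa_sq s : kappa k sstar s ^ 2 = 4 / (2 - k ^ 2) * dn ((s + sstar) / sqrt (2 - k ^ 2)) k ^ 2.
Proof.
unfold kappa. pose proof sqrtm_pos as HM. pose proof sqrtm_sq as HM2. fold M in HM, HM2 |- *.
rewrite <- HM2 at 1. field. lra.
Qed.

Lemma kappa_sq_mu s : 0 < kappa k sstar s ^ 2 - mu k.
Proof.
rewrite kappa_sq. unfold mu. pose proof (modulus_sq k hk) as Hk2.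
set (u := (s + sstar) / sqrt (2 - k ^ 2)).
pose proof (dn_bound k hk u) as Hd. pose proof (compl_pos k hk) as Hc. pose proof (compl_sq k hk) as Hc2.
assert (Hd2 : 1 - k ^ 2 <= dn u k ^ 2) by (rewrite <- Hc2; nra).
replace (4 / (2 - k ^ 2) * dn u k ^ 2 - 4 * (1 - k ^ 2) / (2 - k ^ 2) ^ 2)
  with (4 / (2 - k ^ 2) ^ 2 * ((2 - k ^ 2) * dn u k ^ 2 - (1 - k ^ 2))) by (field; lra).
apply Rmult_lt_0_compat; [apply Rdiv_lt_0_compat; [lra|apply pow_lt; lra]|]. nra.
Qed.

Lemma kappa_ode s : kappa' s ^ 2 = kappa k sstar s ^ 2 - kappa k sstar s ^ 4 / 4 - mu k.
Proof.
replace (kappa k sstar s ^ 4) with ((kappa k sstar s ^ 2) ^ 2) by ring. rewrite kappa_sq.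
unfold kappa', mu. set (u := (s + sstar) / sqrt (2 - k ^ 2)).
replace ((2 / (2 - k ^ 2) * dn' k u) ^ 2) with (4 / (2 - k ^ 2) ^ 2 * dn' k u ^ 2).
- rewrite dn_ode by auto. field. pose proof (modulus_sq k hk). lra.
- field. pose proof (modulus_sq k hk). lra.
Qed.

Lemma sqrt_mu : sqrt (mu k) = 2 * sqrt (1 - k ^ 2) / (2 - k ^ 2).
Proof.
pose proof (compl_pos k hk) as Hc. pose proof (compl_sq k hk) as Hc2. pose proof (modulus_sq k hk) as Hk2.
rewrite <- (sqrt_pow2 (2 * sqrt (1 - k ^ 2) / (2 - k ^ 2))).
- f_equal. unfold mu. replace ((2 * sqrt (1 - k ^ 2) / (2 - k ^ 2)) ^ 2) with (4 * sqrt (1 - k ^ 2) ^ 2 / (2 - k ^ 2) ^ 2) by (field; lra).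
  now rewrite Hc2.
- apply Rdiv_le_0_compat; lra.
Qed.

Variable vartheta : R -> R.
Hypothesis hv : is_vartheta k sstar vartheta.

Lemma W_polar s : W2 k sstar s = sqrt (kappa k sstar s ^ 2 - mu k) / kappa k sstar s * cos (vartheta s) /\
  - W1 k sstar s = sqrt (kappa k sstar s ^ 2 - mu k) / kappa k sstar s * sin (vartheta s).
Proof.
destruct hv as [_ [H _]]. specialize (H s).
set (rho := sqrt (kappa k sstar s ^ 2 - mu k) / kappa k sstar s) in *.
unfold Cexp in H.
replace (Re (Ci * RtoC (vartheta s))%C) with 0 in H by (unfold Re; simpl; ring).
replace (Im (Ci * RtoC (vartheta s))%C) with (vartheta s) in H by (unfold Im; simpl; ring).
rewrite exp_0 in H. pose proof (f_equal Re H) as H1. pose proof (f_equal Im H) as H2.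
unfold Re, Im in H1, H2. simpl in H1, H2. split; lra.
Qed.

Lemma W_sq s : W1 k sstar s ^ 2 + W2 k sstar s ^ 2 = (kappa k sstar s ^ 2 - mu k) / kappa k sstar s ^ 2.
Proof.
destruct (W_polar s) as [H2 H1]. pose proof (kappa_pos s). pose proof (kappa_sq_mu s).
replace (W1 k sstar s ^ 2) with ((- W1 k sstar s) ^ 2) by ring. rewrite H1, H2.
set (rho := sqrt (kappa k sstar s ^ 2 - mu k) / kappa k sstar s).
transitivity (rho ^ 2 * (Rsqr (sin (vartheta s)) + Rsqr (cos (vartheta s)))); [unfold Rsqr; ring|].
rewrite sin2_cos2. unfold rho, Rdiv. rewrite Rpow_mult_distr, pow2_sqrt by lra.
rewrite pow_inv. ring.
Qed.

(** The point [s = M (t + K) - sstar] undoes the change of variable in [W1] and [W2], so the modulus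
    prescribed at every [s] is known at every [t]. *)
Lemma w12_mod t : Cmod (w12 k t) ^ 2 = 2 - k ^ 2 - dnq k t ^ 2.
Proof.
pose proof sqrtm_pos as HM. pose proof sqrtm_sq as HM2. fold M in HM, HM2 |- *.
pose proof (W_sq (M * (t + ellK k) - sstar)) as H. pose proof (kappa_pos (M * (t + ellK k) - sstar)) as Hp.
rewrite kappa_sq in H. unfold W1, W2 in H. fold M in H.
replace ((M * (t + ellK k) - sstar + sstar) / M) with (t + ellK k) in H by (field; lra).
replace (- ellK k + (t + ellK k)) with t in H by ring.
rewrite Cmod2_alt. change (Re (w12 k t)) with (w1 k t). change (Im (w12 k t)) with (w2 k t).
assert (E : (w1 k t ^ 2 + w2 k t ^ 2) = M ^ 2 * ((/ M * w1 k t) ^ 2 + (/ M * w2 k t) ^ 2)) by (field; lra).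
rewrite E, H, HM2. unfold dnq, mu. pose proof (dn_pos k hk (t + ellK k)) as Hd.
pose proof (modulus_sq k hk).
replace ((sqrt (1 - k ^ 2) / dn (t + ellK k) k) ^ 2) with (sqrt (1 - k ^ 2) ^ 2 / dn (t + ellK k) k ^ 2) by (field; lra).
rewrite compl_sq by auto. field. repeat split; lra.
Qed.

(** Two factors [1 / M] come from the definition of [W1], [W2] and one from the chain rule:
    [sqrt (1 - k^2) M / M^3 = sqrt mu / 2]. *)
Lemma W_wronskian s : exists W1' W2', is_derive (W1 k sstar) s W1' /\ is_derive (W2 k sstar) s W2' /\
  W1 k sstar s * W2' - W2 k sstar s * W1' = sqrt (mu k) / 2.
Proof.
pose proof sqrtm_pos as HM. pose proof sqrtm_sq as HM2. fold M in HM, HM2 |- *.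
set (t := - ellK k + (s + sstar) / M).
destruct (w12_wronskian k hk w12_mod t) as [w1' [w2' [D1 [D2 HW]]]].
assert (Dt : is_derive (fun s => - ellK k + (s + sstar) / M) s (/ M)) by (auto_derive; trivial; field; lra).
exists (/ M * (/ M * w1')), (/ M * (/ M * w2')).
split; [|split].
- apply is_derive_scal.
  apply (is_derive_comp (w1 k) (fun s => - ellK k + (s + sstar) / M) s w1' (/ M)); auto.
- apply is_derive_scal.
  apply (is_derive_comp (w2 k) (fun s => - ellK k + (s + sstar) / M) s w2' (/ M)); auto.
- unfold W1, W2. fold M t.
  transitivity (/ M ^ 3 * (w1 k t * w2' - w2 k t * w1')); [field; lra|].
  rewrite HW, sqrt_mu. unfold w_wronskian. fold M. rewrite <- HM2. field. lra.
Qed.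

End Kappa.

(** * The reduced curve and its angle function *)

Section Curve.

Variables k sstar : R.
Hypothesis hk : 0 < k < 1.
Variable vartheta : R -> R.
Hypothesis hv : is_vartheta k sstar vartheta.
Variables a1 a2 a3 b1 b2 b3 : R.
Hypothesis ha3 : a3 = sqrt (a1 ^ 2 + a2 ^ 2).
Hypothesis ha3_pos : 0 < a3.
Hypothesis hb1 : b1 = b3 / a3 * a1 + 1 / (sqrt (mu k) * a3) * (- a2).
Hypothesis hb2 : b2 = b3 / a3 * a2 + 1 / (sqrt (mu k) * a3) * a1.

Let K := kappa k sstar.
Let K' := kappa' k sstar.
Let r := sqrt (mu k).

Lemma r_pos : 0 < r.
Proof. apply sqrt_lt_R0. now apply mu_pos. Qed.
Lemma r_sq : r ^ 2 = mu k.
Proof. apply pow2_sqrt. left. now apply mu_pos. Qed.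

Definition cU (s : R) : R := (a1 * W1 k sstar s + a2 * W2 k sstar s) / a3.
Definition cV (s : R) : R := (- a2 * W1 k sstar s + a1 * W2 k sstar s) / a3.
Definition cx (s : R) : R := cV s / (r * (1 + cU s)).
Definition cy (s : R) : R := 1 / (K s * (1 + cU s)).
Definition cP (s : R) : R := mu k * cx s.
Definition cQ (s : R) : R := K s - mu k * cy s.
(** [ccos + i csin] is the quotient of [Q + i P] by [K^2 / 2 + i K']; the squared modulus of the
    divisor is [K^2 - mu] by [K_D]. *)
Definition ccos (s : R) : R := (K s ^ 2 / 2 * cQ s + K' s * cP s) / (K s ^ 2 - mu k).
Definition csin (s : R) : R := (K s ^ 2 / 2 * cP s - K' s * cQ s) / (K s ^ 2 - mu k).

Lemma K_pos s : 0 < K s.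
Proof. now apply kappa_pos. Qed.
Lemma K_sq_r s : 0 < K s ^ 2 - r ^ 2.
Proof. rewrite r_sq. now apply kappa_sq_mu. Qed.
Lemma K_sq_mu s : 0 < K s ^ 2 - mu k.
Proof. now apply kappa_sq_mu. Qed.

Lemma a3_sq : a1 ^ 2 + a2 ^ 2 = a3 ^ 2.
Proof. rewrite ha3, pow2_sqrt; auto. pose proof (pow2_ge_0 a1). pose proof (pow2_ge_0 a2). lra. Qed.

Lemma cUV_sq s : cU s ^ 2 + cV s ^ 2 = 1 - r ^ 2 / K s ^ 2.
Proof.
pose proof (W_sq k sstar hk vartheta hv s) as H. fold K in H. pose proof (K_pos s) as HK.
transitivity ((a1 ^ 2 + a2 ^ 2) / a3 ^ 2 * (W1 k sstar s ^ 2 + W2 k sstar s ^ 2)).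
- unfold cU, cV. field. lra.
- rewrite a3_sq, H, r_sq. field. lra.
Qed.

Lemma cU_gt s : 0 < 1 + cU s.
Proof.
pose proof (cUV_sq s) as H. pose proof (K_pos s) as HK. pose proof r_pos.
assert (0 < r ^ 2 / K s ^ 2) by (apply Rdiv_lt_0_compat; apply pow_lt; lra).
pose proof (pow2_ge_0 (cV s)). nra.
Qed.

(** The part of [(b1, b2)] along [(a1, a2)] combines with [b3] to a translation, the rotated part
    produces [V]. The given curve is the reduced one moved by the isometry [z -> (z + b3) / a3]. *)
Lemma elastica1_eq s : elastica1 k sstar a1 a2 a3 b1 b2 b3 s = (cx s + b3) / a3.
Proof.
pose proof (cU_gt s) as H. pose proof r_pos.
unfold elastica1, cx. rewrite hb1, hb2.
assert (E1 : a1 * W1 k sstar s + a2 * W2 k sstar s = a3 * cU s) by (unfold cU; field; lra).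
assert (E2 : - a2 * W1 k sstar s + a1 * W2 k sstar s = a3 * cV s) by (unfold cV; field; lra).
replace ((b3 / a3 * a1 + 1 / (sqrt (mu k) * a3) * - a2) * W1 k sstar s + (b3 / a3 * a2 + 1 / (sqrt (mu k) * a3) * a1) * W2 k sstar s + b3)
  with (b3 / a3 * (a1 * W1 k sstar s + a2 * W2 k sstar s) + 1 / (r * a3) * (- a2 * W1 k sstar s + a1 * W2 k sstar s) + b3) by (unfold r; ring).
rewrite E1, E2. field. repeat split; try lra. nra.
Qed.

Lemma elastica2_eq s : elastica2 k sstar a1 a2 a3 s = cy s / a3.
Proof.
pose proof (cU_gt s) as H. pose proof (kappa_pos k sstar hk s) as HK. 
unfold elastica2, cy. 
assert (E1 : a1 * W1 k sstar s + a2 * W2 k sstar s = a3 * cU s) by (unfold cU; field; lra).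
rewrite E1. unfold K. field. repeat split; try lra. nra.
Qed.

Lemma cy_pos s : 0 < cy s.
Proof.
unfold cy. apply Rdiv_lt_0_compat; [lra|]. apply Rmult_lt_0_compat; [now apply kappa_pos|apply cU_gt].
Qed.

(** [cU'] and [cV'] solve the linear system [U U' + V V' = r^2 K' / K^3], [U V' - V U' = r / 2],
    obtained from [cUV_sq] and from the Wronskian. *)
Definition cU' (s : R) : R := (r ^ 2 * K' s * cU s / K s - r / 2 * K s ^ 2 * cV s) / (K s ^ 2 - r ^ 2).
Definition cV' (s : R) : R := (r ^ 2 * K' s * cV s / K s + r / 2 * K s ^ 2 * cU s) / (K s ^ 2 - r ^ 2).

Lemma cUV_derive s :
  is_derive cU s (cU' s) /\ is_derive cV s (cV' s).
Proof.
destruct (W_wronskian k sstar hk vartheta hv s) as [W1' [W2' [D1 [D2 HW]]]]. fold r in HW.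
pose proof (K_pos s) as HK.
pose proof (K_sq_r s) as HD.
set (U' := (a1 * W1' + a2 * W2') / a3). set (V' := (- a2 * W1' + a1 * W2') / a3).
assert (DU : is_derive cU s U').
{ apply (is_derive_ext (fun s => / a3 * (a1 * W1 k sstar s + a2 * W2 k sstar s))); [intros; unfold cU; simpl; field; lra|].
  replace U' with (/ a3 * (a1 * W1' + a2 * W2')) by (unfold U'; field; lra).
  apply is_derive_scal. apply (is_derive_plus (fun s => a1 * W1 k sstar s) (fun s => a2 * W2 k sstar s)); now apply is_derive_scal. }
assert (DV : is_derive cV s V').
{ apply (is_derive_ext (fun s => / a3 * (- a2 * W1 k sstar s + a1 * W2 k sstar s))); [intros; unfold cV; simpl; field; lra|].
  replace V' with (/ a3 * (- a2 * W1' + a1 * W2')) by (unfold V'; field; lra).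
  apply is_derive_scal. apply (is_derive_plus (fun s => - a2 * W1 k sstar s) (fun s => a1 * W2 k sstar s)); now apply is_derive_scal. }
assert (E1 : cU s * V' - cV s * U' = r / 2).
{ transitivity ((a1 ^ 2 + a2 ^ 2) / a3 ^ 2 * (W1 k sstar s * W2' - W2 k sstar s * W1')).
  - unfold cU, cV, U', V'. field. lra.
  - rewrite a3_sq, HW. field. lra. }
assert (E2 : cU s * U' + cV s * V' = r ^ 2 * K' s / K s ^ 3).
{ assert (H1 : is_derive (fun s => cU s ^ 2 + cV s ^ 2) s (INR 2 * U' * cU s ^ Init.Nat.pred 2 + INR 2 * V' * cV s ^ Init.Nat.pred 2)).
  { apply (is_derive_plus (fun s => cU s ^ 2) (fun s => cV s ^ 2)); apply is_derive_pow; auto. }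
  assert (H2 : is_derive (fun s => cU s ^ 2 + cV s ^ 2) s (0 - r ^ 2 * (- (INR 2 * K' s * K s ^ Init.Nat.pred 2) / (K s ^ 2) ^ 2))).
  { apply (is_derive_ext (fun s => 1 - r ^ 2 * / K s ^ 2)); [intros; symmetry; apply cUV_sq|].
    apply (is_derive_minus (fun _ => 1)); [apply is_derive_cst|].
    apply is_derive_scal. apply is_derive_inv.
    - apply is_derive_pow. now apply kappa_derive.
    - apply pow_nonzero. lra. }
  apply is_derive_unique in H1. apply is_derive_unique in H2. rewrite H1 in H2. simpl in H2.
  transitivity (/ 2 * ((1 + 1) * U' * (cU s * 1) + (1 + 1) * V' * (cV s * 1))); [field|].
  rewrite H2. field. lra. }
pose proof (cUV_sq s) as E3.
assert (E4 : cU s ^ 2 + cV s ^ 2 = (K s ^ 2 - r ^ 2) / K s ^ 2) by (rewrite E3; field; lra).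
split.
- replace (cU' s) with U'; auto. unfold cU'.
  apply (Rmult_eq_reg_l (cU s ^ 2 + cV s ^ 2)).
  + transitivity (cU s * (cU s * U' + cV s * V') - cV s * (cU s * V' - cV s * U')); [ring|].
    rewrite E1, E2, E4. field. lra.
  + rewrite E4. apply Rgt_not_eq, Rdiv_lt_0_compat; auto. apply pow_lt; lra.
- replace (cV' s) with V'; auto. unfold cV'.
  apply (Rmult_eq_reg_l (cU s ^ 2 + cV s ^ 2)).
  + transitivity (cV s * (cU s * U' + cV s * V') + cU s * (cU s * V' - cV s * U')); [ring|].
    rewrite E1, E2, E4. field. lra.
  + rewrite E4. apply Rgt_not_eq, Rdiv_lt_0_compat; auto. apply pow_lt; lra.
Qed.

Lemma cP_eq s : cP s = r * cV s / (1 + cU s).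
Proof. unfold cP, cx. rewrite <- r_sq. pose proof (cU_gt s). pose proof r_pos. field. lra. Qed.

Lemma cQ_eq s : cQ s = K s - r ^ 2 / (K s * (1 + cU s)).
Proof.
unfold cQ, cy. rewrite <- r_sq. pose proof (cU_gt s). pose proof (K_pos s) as HK. field. lra.
Qed.

(** By [K_D] the number [K^2 / 2 + i K'] has the same modulus as [Q + i P], so their quotient is a
    unit ([ccs_sq]). *)
Lemma cPQ_sq s : cP s ^ 2 + cQ s ^ 2 = K s ^ 2 - mu k.
Proof.
rewrite cP_eq, cQ_eq, <- r_sq. pose proof (cU_gt s). pose proof (K_pos s) as HK.
pose proof (cUV_sq s) as E. assert (E' : cV s ^ 2 = 1 - r ^ 2 / K s ^ 2 - cU s ^ 2) by lra.
replace ((r * cV s / (1 + cU s)) ^ 2) with (r ^ 2 * cV s ^ 2 / (1 + cU s) ^ 2) by (field; lra).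
rewrite E'. field. lra.
Qed.

Lemma K_D s : (K s ^ 2 / 2) ^ 2 + K' s ^ 2 = K s ^ 2 - mu k.
Proof. unfold K, K'. rewrite kappa_ode by auto. field. Qed.

Lemma cP_cs s : cP s = K s ^ 2 / 2 * csin s + K' s * ccos s.
Proof.
pose proof (K_D s) as H. pose proof (K_sq_mu s) as HD.
unfold csin, ccos. rewrite <- H in *. field. lra.
Qed.

Lemma cQ_cs s : cQ s = K s ^ 2 / 2 * ccos s - K' s * csin s.
Proof.
pose proof (K_D s) as H. pose proof (K_sq_mu s) as HD.
unfold csin, ccos. rewrite <- H in *. field. lra.
Qed.

Lemma ccs_sq s : ccos s ^ 2 + csin s ^ 2 = 1.
Proof.
pose proof (K_D s) as H. pose proof (K_sq_mu s) as HD. pose proof (cPQ_sq s) as HPQ.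
transitivity (((K s ^ 2 / 2) ^ 2 + K' s ^ 2) * (cP s ^ 2 + cQ s ^ 2) / (K s ^ 2 - mu k) ^ 2).
- unfold csin, ccos. field. lra.
- rewrite H, HPQ. field. lra.
Qed.

Lemma cx_derive s : is_derive cx s (cy s * ccos s).
Proof.
destruct (cUV_derive s) as [DU DV]. pose proof (cU_gt s) as HU. pose proof r_pos as Hr.
pose proof (K_pos s) as HK.
pose proof (K_sq_r s) as HD.
assert (E1 : cU s * cV' s - cV s * cU' s = r / 2).
{ transitivity (r / 2 * K s ^ 2 / (K s ^ 2 - r ^ 2) * (cU s ^ 2 + cV s ^ 2)).
  - unfold cU', cV'. field. lra.
  - rewrite cUV_sq. field. lra. }
replace (cy s * ccos s) with ((cV' s * (r * (1 + cU s)) - cV s * (r * (0 + cU' s))) / (r * (1 + cU s)) ^ 2).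
- apply (is_derive_div cV (fun s => r * (1 + cU s))); auto.
  + apply is_derive_scal. apply (is_derive_plus (fun _ => 1)); auto.
    apply is_derive_cst.
  + nra.
- replace (cV' s * (r * (1 + cU s)) - cV s * (r * (0 + cU' s))) with (r * (cV' s + (cU s * cV' s - cV s * cU' s))) by ring.
  rewrite E1. unfold ccos. rewrite cP_eq, cQ_eq. unfold cV', cy. rewrite <- r_sq. field. repeat split; lra.
Qed.

Lemma cy_derive s : is_derive cy s (cy s * csin s).
Proof.
destruct (cUV_derive s) as [DU _]. pose proof (cU_gt s) as HU. pose proof r_pos as Hr.
pose proof (K_pos s) as HK.
pose proof (K_sq_r s) as HD.
replace (cy s * csin s) with ((0 * (K s * (1 + cU s)) - 1 * (K' s * (1 + cU s) + K s * (0 + cU' s))) / (K s * (1 + cU s)) ^ 2).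
- apply (is_derive_div (fun _ => 1) (fun s => K s * (1 + cU s))).
  + apply is_derive_cst.
  + apply (is_derive_mult (K := R_AbsRing) K (fun s => 1 + cU s) s (K' s) (0 + cU' s)).
    * now apply kappa_derive.
    * apply (is_derive_plus (fun _ => 1)); auto.
      apply is_derive_cst.
    * intros; apply Rmult_comm.
  + nra.
- unfold csin. rewrite cP_eq, cQ_eq. unfold cU', cy. rewrite <- r_sq. field. repeat split; lra.
Qed.

(** The unit vector turns with speed [K - ccos]: this is [phi' + cos phi = kappa], the statement
    that the curvature is [kappa]. *)
Lemma ccs_derive s : is_derive ccos s (- csin s * (K s - ccos s)) /\
  is_derive csin s (ccos s * (K s - ccos s)).
Proof.
pose proof (K_sq_mu s) as HD.
pose proof (kappa_derive k sstar hk s) as DK. fold K in DK. fold (K' s) in DK.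
pose proof (kappa'_derive k sstar hk s) as DK'. fold K K' in DK'.
assert (DP : is_derive cP s (mu k * (cy s * ccos s))) by apply is_derive_scal, cx_derive.
assert (DQ : is_derive cQ s (K' s - mu k * (cy s * csin s))).
{ apply (is_derive_minus K (fun s => mu k * cy s)); auto. apply is_derive_scal, cy_derive. }
assert (DK2 : is_derive (fun s => K s ^ 2 / 2) s (K s * K' s)).
{ apply (is_derive_ext (fun s => / 2 * K s ^ 2)); [intros; simpl; field|].
  replace (K s * K' s) with (/ 2 * (INR 2 * K' s * K s ^ Init.Nat.pred 2)) by (simpl; field).
  apply is_derive_scal, is_derive_pow, DK. }
assert (DD : is_derive (fun s => K s ^ 2 - mu k) s (2 * K s * K' s)).
{ replace (2 * K s * K' s) with (INR 2 * K' s * K s ^ Init.Nat.pred 2 - 0) by (simpl; ring).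
  apply (is_derive_minus (fun s => K s ^ 2) (fun _ => mu k)).
  - apply is_derive_pow, DK.
  - apply is_derive_cst. }
assert (HQ : mu k * cy s = K s - cQ s) by (unfold cQ; ring).
pose proof (cP_cs s) as EP. pose proof (cQ_cs s) as EQ. pose proof (ccs_sq s) as ES. pose proof (K_D s) as EK.
assert (Hc : (K s ^ 2 / 2 * cQ s + K' s * cP s) = ccos s * (K s ^ 2 - mu k)) by (unfold ccos; field; lra).
assert (Hs : (K s ^ 2 / 2 * cP s - K' s * cQ s) = csin s * (K s ^ 2 - mu k)) by (unfold csin; field; lra).
split.
- replace (- csin s * (K s - ccos s)) with
   (((K s * K' s * cQ s + K s ^ 2 / 2 * (K' s - mu k * (cy s * csin s)) +
      ((K s - K s ^ 3 / 2) * cP s + K' s * (mu k * (cy s * ccos s)))) * (K s ^ 2 - mu k)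
     - (K s ^ 2 / 2 * cQ s + K' s * cP s) * (2 * K s * K' s)) / (K s ^ 2 - mu k) ^ 2).
  + apply (is_derive_div (fun s => K s ^ 2 / 2 * cQ s + K' s * cP s) (fun s => K s ^ 2 - mu k)); auto; [|lra].
    apply (is_derive_plus (fun s => K s ^ 2 / 2 * cQ s) (fun s => K' s * cP s));
    [apply (is_derive_Rmult (fun s => K s ^ 2 / 2) cQ)|apply (is_derive_Rmult K' cP)]; auto.
  + rewrite Hc.
    replace (mu k * (cy s * csin s)) with ((mu k * cy s) * csin s) by ring.
    replace (mu k * (cy s * ccos s)) with ((mu k * cy s) * ccos s) by ring. rewrite HQ.
    apply (Rmult_eq_reg_l ((K s ^ 2 - mu k))); [|lra].
    transitivity ((K s * K' s * cQ s + K s ^ 2 / 2 * (K' s - (K s - cQ s) * csin s) +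
      ((K s - K s ^ 3 / 2) * cP s + K' s * ((K s - cQ s) * ccos s)) - ccos s * (2 * K s * K' s))); [field; lra|].
    (* Once [K^2 - mu], [P] and [Q] are expressed by [K], [K'] and the angle, the two sides differ
       by a multiple of [1 - (co^2 + si^2)]. *)
    rewrite <- EK. revert EP EQ ES.
    generalize (K s) (K' s) (cP s) (cQ s) (csin s) (ccos s). intros x x' P Q si co EP EQ ES.
    transitivity (((x ^ 2 / 2) ^ 2 + x' ^ 2) * (- si * (x - co)) + x ^ 2 * x' / 2 * (1 - (co ^ 2 + si ^ 2))).
    * subst P Q. field.
    * rewrite ES. ring.
- replace (ccos s * (K s - ccos s)) with
   (((K s * K' s * cP s + K s ^ 2 / 2 * (mu k * (cy s * ccos s)) -
      ((K s - K s ^ 3 / 2) * cQ s + K' s * (K' s - mu k * (cy s * csin s)))) * (K s ^ 2 - mu k)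
     - (K s ^ 2 / 2 * cP s - K' s * cQ s) * (2 * K s * K' s)) / (K s ^ 2 - mu k) ^ 2).
  + apply (is_derive_div (fun s => K s ^ 2 / 2 * cP s - K' s * cQ s) (fun s => K s ^ 2 - mu k)); auto; [|lra].
    apply (is_derive_minus (fun s => K s ^ 2 / 2 * cP s) (fun s => K' s * cQ s));
    [apply (is_derive_Rmult (fun s => K s ^ 2 / 2) cP)|apply (is_derive_Rmult K' cQ)]; auto.
  + rewrite Hs.
    replace (mu k * (cy s * csin s)) with ((mu k * cy s) * csin s) by ring.
    replace (mu k * (cy s * ccos s)) with ((mu k * cy s) * ccos s) by ring. rewrite HQ.
    apply (Rmult_eq_reg_l ((K s ^ 2 - mu k))); [|lra].
    transitivity ((K s * K' s * cP s + K s ^ 2 / 2 * ((K s - cQ s) * ccos s) -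
      ((K s - K s ^ 3 / 2) * cQ s + K' s * (K' s - (K s - cQ s) * csin s)) - csin s * (2 * K s * K' s))); [field; lra|].
    rewrite <- EK. revert EP EQ ES.
    generalize (K s) (K' s) (cP s) (cQ s) (csin s) (ccos s). intros x x' P Q si co EP EQ ES.
    transitivity (((x ^ 2 / 2) ^ 2 + x' ^ 2) * (co * (x - co)) - x' ^ 2 * (1 - (co ^ 2 + si ^ 2))).
    * subst P Q. field.
    * rewrite ES. ring.
Qed.

Lemma unit_angle (x y : R) : x ^ 2 + y ^ 2 = 1 -> exists t, cos t = x /\ sin t = y.
Proof.
intros H. assert (Hx : -1 <= x <= 1) by (pose proof (pow2_ge_0 y); split; nra).
destruct (Rle_or_lt 0 y) as [Hy|Hy].
- exists (acos x). split; [now apply cos_acos|]. rewrite sin_acos by auto.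
  rewrite <- (sqrt_pow2 y) by auto. f_equal. unfold Rsqr. lra.
- exists (- acos x). rewrite cos_neg, sin_neg. split; [now apply cos_acos|]. rewrite sin_acos by auto.
  replace y with (- - y) by ring. f_equal. rewrite <- (sqrt_pow2 (- y)) by lra. f_equal. unfold Rsqr. lra.
Qed.

(** [phi] is a primitive of the known function [K - ccos], so no differential equation has to be
    solved. The inner product of [(cos phi, sin phi)] with [(ccos, csin)] is constant and equals 1
    at 0, and unit vectors with inner product 1 coincide. *)
Lemma angle_exists : exists phi : R -> R,
  (forall s, is_derive phi s (K s - cos (phi s))) /\ forall s, cos (phi s) = ccos s /\ sin (phi s) = csin s.
Proof.
destruct (unit_angle (ccos 0) (csin 0) (ccs_sq 0)) as [t0 [Hc0 Hs0]].
set (f := fun s => K s - ccos s).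
assert (Hf : forall s, continuous f s).
{ intros s. apply (ex_derive_continuous f). exists (K' s - - csin s * (K s - ccos s)).
  apply (is_derive_minus K ccos); [now apply kappa_derive|apply ccs_derive]. }
set (phi := fun s => t0 + RInt f 0 s).
assert (Hphi : forall s, is_derive phi s (f s)).
{ intros s. replace (f s) with (0 + f s) by ring.
  apply (is_derive_plus (fun _ => t0)); [apply is_derive_cst|].
  apply (is_derive_RInt f (fun s => RInt f 0 s) 0 s); auto.
  apply filter_forall. intros y. apply (RInt_correct (V := R_CompleteNormedModule) f).
  apply (ex_RInt_continuous (V := R_CompleteNormedModule)). intros z _. apply Hf. }
assert (Hphi0 : phi 0 = t0) by (unfold phi; rewrite (RInt_point (V := R_CompleteNormedModule)); unfold zero; simpl; ring).
assert (HX : forall s, ccos s * cos (phi s) + csin s * sin (phi s) = 1).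
{ intros s. transitivity (ccos 0 * cos (phi 0) + csin 0 * sin (phi 0)).
  - apply (zero_derive_const (fun s => ccos s * cos (phi s) + csin s * sin (phi s))). intros t.
    destruct (ccs_derive t) as [D1 D2].
    assert (Dc : is_derive (fun s => cos (phi s)) t (f t * - sin (phi t))).
    { apply (is_derive_comp cos phi t (- sin (phi t)) (f t)); auto. auto_derive; trivial; ring. }
    assert (Ds : is_derive (fun s => sin (phi s)) t (f t * cos (phi t))).
    { apply (is_derive_comp sin phi t (cos (phi t)) (f t)); auto. auto_derive; trivial; ring. }
    replace 0 with ((- csin t * (K t - ccos t) * cos (phi t) + ccos t * (f t * - sin (phi t)))
      + (ccos t * (K t - ccos t) * sin (phi t) + csin t * (f t * cos (phi t)))) by (unfold f; ring).
    apply (is_derive_plus (fun s => ccos s * cos (phi s)) (fun s => csin s * sin (phi s))).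
    + apply (is_derive_Rmult ccos (fun s => cos (phi s))); auto.
    + apply (is_derive_Rmult csin (fun s => sin (phi s))); auto.
  - rewrite Hphi0, Hc0, Hs0. rewrite <- (ccs_sq 0). ring. }
assert (HE : forall s, cos (phi s) = ccos s /\ sin (phi s) = csin s).
{ intros s. specialize (HX s). pose proof (ccs_sq s) as H1. pose proof (sin2_cos2 (phi s)) as H2. unfold Rsqr in H2.
  assert (H3 : (cos (phi s) - ccos s) ^ 2 + (sin (phi s) - csin s) ^ 2 = 0) by nra.
  pose proof (pow2_ge_0 (cos (phi s) - ccos s)) as G1. pose proof (pow2_ge_0 (sin (phi s) - csin s)) as G2.
  assert (Z1 : (cos (phi s) - ccos s) ^ 2 = 0) by lra. assert (Z2 : (sin (phi s) - csin s) ^ 2 = 0) by lra.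
  rewrite <- Rsqr_pow2 in Z1, Z2. apply Rsqr_0_uniq in Z1. apply Rsqr_0_uniq in Z2. split; lra. }
exists phi. split; auto. intros s. replace (cos (phi s)) with (ccos s) by (symmetry; apply HE). apply Hphi.
Qed.

Lemma angle_smooth (phi : R -> R) : (forall s, is_derive phi s (K s - cos (phi s))) -> smooth phi.
Proof.
intros Hphi.
(* The functions obtained from [phi], [kappa], [kappa'] by ring operations, [cos]
   and [sin] form a class closed under differentiation. *)
set (alg := fun f : R -> R => forall A : (R -> R) -> Prop,
  A phi -> A K -> A K' -> A (fun s => cos (phi s)) -> A (fun s => sin (phi s)) ->
  (forall c, A (fun _ => c)) ->
  (forall g h, A g -> A h -> A (fun s => g s + h s)) ->
  (forall g h, A g -> A h -> A (fun s => g s * h s)) -> A f).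
assert (aphi : alg phi) by (intros A; auto).
assert (aK : alg K) by (intros A; auto).
assert (aK' : alg K') by (intros A; auto).
assert (ac : alg (fun s => cos (phi s))) by (intros A; auto).
assert (as_ : alg (fun s => sin (phi s))) by (intros A; auto).
assert (aconst : forall c, alg (fun _ => c)) by (intros c A; auto).
assert (aplus : forall g h, alg g -> alg h -> alg (fun s => g s + h s)).
{ intros g h Hg Hh A H1 H2 H3 H4 H5 H6 H7 H8. apply H7; [apply Hg|apply Hh]; auto. }
assert (amult : forall g h, alg g -> alg h -> alg (fun s => g s * h s)).
{ intros g h Hg Hh A H1 H2 H3 H4 H5 H6 H7 H8. apply H8; [apply Hg|apply Hh]; auto. }
assert (Hphi' : alg (fun s => K s + -1 * cos (phi s))).
{ apply (aplus K (fun s => -1 * cos (phi s))); auto. }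
assert (Hphid : forall s, is_derive phi s (K s + -1 * cos (phi s))).
{ intros s. replace (K s + -1 * cos (phi s)) with (K s - cos (phi s)) by ring. apply Hphi. }
(* [alg] is the intersection of all closed classes, so its induction principle yields only the
   predicate for the constituents; the product rule also needs them to be in the class, hence the
   conjunct [alg f]. *)
assert (Hder : forall f, alg f -> alg f /\ exists g, alg g /\ forall s, is_derive f s (g s)).
{ intros f Hf. apply Hf; clear f Hf.
  - split; auto. eauto.
  - split; auto. exists K'. split; auto. intros s. now apply kappa_derive.
  - split; auto. exists (fun s => K s + -1 / 2 * (K s * (K s * K s))). split.
    + apply (aplus K (fun s => -1 / 2 * (K s * (K s * K s)))); auto.
    + intros s. replace (K s + -1 / 2 * (K s * (K s * K s))) with (K s - K s ^ 3 / 2) by field.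
      now apply kappa'_derive.
  - split; auto. exists (fun s => (K s + -1 * cos (phi s)) * (-1 * sin (phi s))). split.
    + apply (amult (fun s => K s + -1 * cos (phi s)) (fun s => -1 * sin (phi s))); auto.
    + intros s. apply (is_derive_comp cos phi s (-1 * sin (phi s)) (K s + -1 * cos (phi s))); auto. auto_derive; trivial; ring.
  - split; auto. exists (fun s => (K s + -1 * cos (phi s)) * cos (phi s)). split.
    + apply (amult (fun s => K s + -1 * cos (phi s)) (fun s => cos (phi s))); auto.
    + intros s. apply (is_derive_comp sin phi s (cos (phi s)) (K s + -1 * cos (phi s))); auto. auto_derive; trivial; ring.
  - intros c. split; auto. exists (fun _ => 0). split; auto. intros s.
    apply is_derive_cst.
  - intros g h [Hg [g' [Ag Dg]]] [Hh [h' [Ah Dh]]]. split; auto.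
    exists (fun s => g' s + h' s). split; auto. intros s. now apply (is_derive_plus g h).
  - intros g h [Hg [g' [Ag Dg]]] [Hh [h' [Ah Dh]]]. split; auto.
    exists (fun s => g' s * h s + g s * h' s). split; auto. intros s. now apply is_derive_Rmult. }
assert (Hn : forall n, exists g, alg g /\ forall s, Derive_n phi n s = g s).
{ induction n as [|n [g [Hg Eg]]].
  - now exists phi.
  - destruct (Hder g Hg) as [_ [g' [Hg' Dg']]]. exists g'. split; auto. intros s. simpl.
    rewrite (Derive_ext _ g) by auto. now apply is_derive_unique. }
intros n x. destruct n as [|n]; simpl; trivial.
destruct (Hn n) as [g [Hg Eg]]. destruct (Hder g Hg) as [_ [g' [_ Dg']]].
apply (ex_derive_ext g); [intros; symmetry; apply Eg|]. eexists. apply Dg'.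
Qed.

(** Cancelling the positive second coordinate from the derivative equations shows that any angle
    function has cosine [ccos] and sine [csin], so the existential over [phi] disappears. *)
Lemma solves_dirichlet_iff (A1 A2 B1 B2 phiA phiB L : R) :
  solves_dirichlet A1 A2 B1 B2 phiA phiB L (elastica1 k sstar a1 a2 a3 b1 b2 b3) (elastica2 k sstar a1 a2 a3) <->
  (cx 0 = a3 * A1 - b3 /\ cy 0 = a3 * A2 /\ ccos 0 = cos phiA /\ csin 0 = sin phiA) /\
  (cx L = a3 * B1 - b3 /\ cy L = a3 * B2 /\ ccos L = cos phiB /\ csin L = sin phiB).
Proof.
assert (P1 : forall s A, elastica1 k sstar a1 a2 a3 b1 b2 b3 s = A <-> cx s = a3 * A - b3).
{ intros s A. rewrite elastica1_eq. split; intros H.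
  - rewrite <- H. field. lra.
  - rewrite H. field. lra. }
assert (P2 : forall s A, elastica2 k sstar a1 a2 a3 s = A <-> cy s = a3 * A).
{ intros s A. rewrite elastica2_eq. split; intros H.
  - rewrite <- H. field. lra.
  - rewrite H. field. lra. }
assert (D1 : forall s, is_derive (elastica1 k sstar a1 a2 a3 b1 b2 b3) s (elastica2 k sstar a1 a2 a3 s * ccos s)).
{ intros s. apply (is_derive_ext (fun s => / a3 * (cx s + b3))).
  - intros t. rewrite elastica1_eq. unfold Rdiv. apply Rmult_comm.
  - rewrite elastica2_eq. replace (cy s / a3 * ccos s) with (/ a3 * (cy s * ccos s + 0)) by (field; lra).
    apply is_derive_scal. apply (is_derive_plus cx (fun _ => b3)); [apply cx_derive|].
    apply is_derive_cst. }
assert (D2 : forall s, is_derive (elastica2 k sstar a1 a2 a3) s (elastica2 k sstar a1 a2 a3 s * csin s)).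
{ intros s. apply (is_derive_ext (fun s => / a3 * cy s)).
  - intros t. rewrite elastica2_eq. unfold Rdiv. apply Rmult_comm.
  - rewrite elastica2_eq. replace (cy s / a3 * csin s) with (/ a3 * (cy s * csin s)) by (field; lra).
    apply is_derive_scal, cy_derive. }
split.
- intros [phi [[_ Hphi] [[HA1 HA2] [[HB1 HB2] [HA3 HB3]]]]].
  assert (HE : forall s, cos (phi s) = ccos s /\ sin (phi s) = csin s).
  { intros s. destruct (Hphi s) as [H1 H2].
    assert (Hpos : 0 < elastica2 k sstar a1 a2 a3 s).
    { rewrite elastica2_eq. apply Rdiv_lt_0_compat; auto. apply cy_pos. }
    pose proof (is_derive_unique _ _ _ H1) as E1. rewrite (is_derive_unique _ _ _ (D1 s)) in E1.
    pose proof (is_derive_unique _ _ _ H2) as E2. rewrite (is_derive_unique _ _ _ (D2 s)) in E2.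
    apply Rmult_eq_reg_l in E1; [|lra]. apply Rmult_eq_reg_l in E2; [|lra]. auto. }
  rewrite !Cexp_angle in HA3, HB3. injection HA3 as HA3 HA4. injection HB3 as HB3 HB4.
  destruct (HE 0) as [C0 S0]. destruct (HE L) as [CL SL].
  rewrite P1 in HA1, HB1. rewrite P2 in HA2, HB2. repeat split; congruence.
- intros [[HA1 [HA2 [HA3 HA4]]] [HB1 [HB2 [HB3 HB4]]]].
  destruct angle_exists as [phi [Hphi HE]]. exists phi.
  destruct (HE 0) as [C0 S0]. destruct (HE L) as [CL SL].
  split; [split|].
  + now apply angle_smooth.
  + intros s. destruct (HE s) as [-> ->]. auto.
  + rewrite !P1, !P2, !Cexp_angle, C0, S0, CL, SL, HA3, HA4, HB3, HB4. tauto.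
Qed.

End Curve.

(** * The Dirichlet problem *)

Section Endpoints.

Variables k sstar : R.
Hypothesis hk : 0 < k < 1.
Variable vartheta : R -> R.
Hypothesis hv : is_vartheta k sstar vartheta.
Variables a1 a2 a3 : R.
Hypothesis ha3 : a3 = sqrt (a1 ^ 2 + a2 ^ 2).
Hypothesis ha3_pos : 0 < a3.

Let K := kappa k sstar.
Let K' := kappa' k sstar.
Let r := sqrt (mu k).
Let U := cU k sstar a1 a2 a3.
Let V := cV k sstar a1 a2 a3.

Definition crho (s : R) : R := sqrt (kappa k sstar s ^ 2 - mu k) / kappa k sstar s.

Lemma crho_pos s : 0 < crho s.
Proof.
apply Rdiv_lt_0_compat; [apply sqrt_lt_R0; now apply kappa_sq_mu|now apply kappa_pos].
Qed.

Lemma crho_sq s : crho s ^ 2 = 1 - r ^ 2 / K s ^ 2.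
Proof.
pose proof (kappa_pos k sstar hk s) as HK. pose proof (kappa_sq_mu k sstar hk s) as HD.
unfold crho, r. fold K in HK, HD |- *. rewrite r_sq by auto. unfold Rdiv at 1. rewrite Rpow_mult_distr, pow2_sqrt by lra.
field. lra.
Qed.

Lemma cUV_rho s : U s ^ 2 + V s ^ 2 = crho s ^ 2.
Proof. rewrite crho_sq. unfold U, V, K, r. eapply cUV_sq; eauto. Qed.

(** [mu (x^2 + y^2) = (1 - U) / (1 + U)]. Hence sigma_1 and sigma_2 are [U] and [V] divided by
    [1 + U], and normalising removes this positive factor. *)
Lemma endpoint_sigma s :
  let x := cx k sstar a1 a2 a3 s in let y := cy k sstar a1 a2 a3 s in
  let sg1 := 1 / 2 * (1 - mu k * (y ^ 2 + x ^ 2)) in let sg2 := r * x in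
  (1 + mu k * (y ^ 2 + x ^ 2)) / (2 * y) = K s /\
  0 < sqrt (sg1 ^ 2 + sg2 ^ 2) /\
  sg1 / sqrt (sg1 ^ 2 + sg2 ^ 2) = U s / crho s /\ sg2 / sqrt (sg1 ^ 2 + sg2 ^ 2) = V s / crho s.
Proof.
intros x y sg1 sg2.
pose proof (kappa_pos k sstar hk s) as HK. fold K in HK.
pose proof (cU_gt k sstar hk vartheta hv a1 a2 a3 ha3 ha3_pos s) as HU. fold U in HU.
pose proof (r_pos k hk) as Hr. fold r in Hr. pose proof (r_sq k hk) as Hr2. fold r in Hr2.
pose proof (cUV_rho s) as H. pose proof (crho_pos s) as Hrho. pose proof (crho_sq s) as Hrho2.
assert (HV : V s ^ 2 = 1 - r ^ 2 / K s ^ 2 - U s ^ 2) by lra.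
assert (HX : mu k * (y ^ 2 + x ^ 2) = (1 - U s) / (1 + U s)).
{ unfold x, y, cx, cy. fold U V K r. rewrite <- Hr2.
  transitivity ((r ^ 2 / K s ^ 2 + V s ^ 2) / (1 + U s) ^ 2); [field; repeat split; lra|].
  rewrite HV. field. lra. }
assert (E1 : sg1 = U s / (1 + U s)) by (unfold sg1; rewrite HX; field; lra).
assert (E2 : sg2 = V s / (1 + U s)) by (unfold sg2, x, cx; fold U V r; field; lra).
assert (EN : sqrt (sg1 ^ 2 + sg2 ^ 2) = crho s / (1 + U s)).
{ rewrite <- (sqrt_pow2 (crho s / (1 + U s))) by (apply Rdiv_le_0_compat; lra). f_equal.
  rewrite E1, E2. transitivity ((U s ^ 2 + V s ^ 2) / (1 + U s) ^ 2); [field; lra|]. rewrite H. field. lra. }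
rewrite EN, E1, E2. repeat split.
- rewrite HX. unfold y, cy. fold U K. field. lra.
- apply Rdiv_lt_0_compat; lra.
- field. lra.
- field. lra.
Qed.

(** The direction gives sigma_1 and sigma_2 as [tau U] and [tau V] with an unknown [tau > 0]; the
    equation with [K s] then determines [tau]. *)
Lemma endpoint_unique s x y :
  let sg1 := 1 / 2 * (1 - mu k * (y ^ 2 + x ^ 2)) in let sg2 := r * x in
  0 < y -> (1 + mu k * (y ^ 2 + x ^ 2)) / (2 * y) = K s ->
  0 < sqrt (sg1 ^ 2 + sg2 ^ 2) ->
  sg1 / sqrt (sg1 ^ 2 + sg2 ^ 2) = U s / crho s -> sg2 / sqrt (sg1 ^ 2 + sg2 ^ 2) = V s / crho s ->
  cx k sstar a1 a2 a3 s = x /\ cy k sstar a1 a2 a3 s = y.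
Proof.
intros sg1 sg2 Hy HX HN H1 H2.
pose proof (kappa_pos k sstar hk s) as HK. fold K in HK.
pose proof (cU_gt k sstar hk vartheta hv a1 a2 a3 ha3 ha3_pos s) as HU. fold U in HU.
pose proof (r_pos k hk) as Hr. fold r in Hr. pose proof (r_sq k hk) as Hr2. fold r in Hr2.
pose proof (cUV_rho s) as H. pose proof (crho_pos s) as Hrho. pose proof (crho_sq s) as Hrho2.
set (N := sqrt (sg1 ^ 2 + sg2 ^ 2)) in *.
set (tau := N / crho s). assert (Htau : 0 < tau) by (apply Rdiv_lt_0_compat; lra).
assert (E1 : sg1 = tau * U s).
{ unfold tau. replace sg1 with (sg1 / N * N) by (field; lra). rewrite H1. field. lra. }
assert (E2 : sg2 = tau * V s).
{ unfold tau. replace sg2 with (sg2 / N * N) by (field; lra). rewrite H2. field. lra. }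
assert (HX' : 1 + mu k * (y ^ 2 + x ^ 2) = 2 * y * K s) by (rewrite <- HX; field; lra).
assert (Ey : y = (1 - tau * U s) / K s).
{ rewrite <- E1. unfold sg1. replace (mu k * (y ^ 2 + x ^ 2)) with (2 * y * K s - 1) by lra. field. lra. }
assert (Ex : x = tau * V s / r) by (rewrite <- E2; unfold sg2; field; lra).
assert (Hpos : 0 < 1 - tau * U s).
{ replace (1 - tau * U s) with (y * K s) by (rewrite Ey; field; lra). now apply Rmult_lt_0_compat. }
assert (HV : V s ^ 2 = crho s ^ 2 - U s ^ 2) by lra.
assert (Hsq : tau ^ 2 = (1 - tau * U s) ^ 2).
{ rewrite <- Hr2 in HX'.
  assert (HX2 : 1 + r ^ 2 / K s ^ 2 * (1 - tau * U s) ^ 2 + tau ^ 2 * V s ^ 2 = 2 * (1 - tau * U s)).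
  { rewrite Ey, Ex in HX'. transitivity (1 + r ^ 2 * (((1 - tau * U s) / K s) ^ 2 + (tau * V s / r) ^ 2)); [field; lra|].
    rewrite HX'. field. lra. }
  replace (r ^ 2 / K s ^ 2) with (1 - crho s ^ 2) in HX2 by lra. rewrite HV in HX2.
  apply (Rmult_eq_reg_l (crho s ^ 2)); [|apply pow_nonzero; lra]. lra. }
(* Both sides are positive, the right one being [y * K s], so the equality of squares [Hsq] gives
   equality. *)
assert (Ht : tau = 1 - tau * U s) by nra.
assert (Ht' : tau = / (1 + U s)).
{ apply (Rmult_eq_reg_r (1 + U s)); [|lra]. rewrite Rinv_l by lra. lra. }
unfold cx, cy. fold U V K r. rewrite Ex, Ey, Ht'. split; field; lra.
Qed.

Definition cdir (s : R) : C := (V s / crho s, U s / crho s).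

Lemma cdir_unit s : (cdir s * Cconj (cdir s))%C = 1.
Proof.
pose proof (crho_pos s). pose proof (cUV_rho s) as E.
unfold cdir, Cconj. apply C_eq; unfold Re, Im; simpl.
- transitivity ((U s ^ 2 + V s ^ 2) / crho s ^ 2); [field; lra|]. rewrite E. field. lra.
- field. lra.
Qed.

(** [(V + i U) a3 = (a1 + i a2) (W2 + i W1)], and [W2 + i W1] is [crho e^(-i vartheta)]. So
    [cdir s * e^(i vartheta s)] is the same for all [s], which links the two end points. *)
Lemma cdir_eq s : (RtoC a1 + Ci * RtoC a2)%C = (RtoC a3 * cdir s * Cexp (Ci * RtoC (vartheta s)))%C.
Proof.
destruct (W_polar k sstar vartheta hv s) as [E1 E2]. fold (crho s) in E1, E2.
pose proof (crho_pos s) as Hr. pose proof (W_sq k sstar hk vartheta hv s) as HW.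
pose proof (crho_sq s) as Hr2. unfold r, K in Hr2. rewrite r_sq in Hr2 by auto.
pose proof (kappa_pos k sstar hk s) as HK.
assert (HW2 : W1 k sstar s ^ 2 + W2 k sstar s ^ 2 = crho s ^ 2) by (rewrite HW, Hr2; field; lra).
rewrite Cexp_angle.
assert (C1 : cos (vartheta s) = W2 k sstar s / crho s) by (rewrite E1; field; lra).
assert (C2 : sin (vartheta s) = - W1 k sstar s / crho s) by (rewrite E2; field; lra).
rewrite C1, C2. unfold cdir, U, V, cU, cV. apply C_eq; unfold Re, Im; simpl.
- transitivity (a1 * (W1 k sstar s ^ 2 + W2 k sstar s ^ 2) / crho s ^ 2); [rewrite HW2|]; field; lra.
- transitivity (a2 * (W1 k sstar s ^ 2 + W2 k sstar s ^ 2) / crho s ^ 2); [rewrite HW2|]; field; lra.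
Qed.

Lemma cdir_rotation s t : Cexp (Ci * RtoC (vartheta t - vartheta s)) = (cdir s * Cconj (cdir t))%C.
Proof.
assert (Ha : RtoC a3 <> 0) by (intros E; apply RtoC_inj in E; lra).
assert (H : (cdir s * Cexp (Ci * RtoC (vartheta s)) = cdir t * Cexp (Ci * RtoC (vartheta t)))%C).
{ transitivity ((RtoC a1 + Ci * RtoC a2) / RtoC a3)%C.
  - rewrite (cdir_eq s). field. auto.
  - rewrite (cdir_eq t). field. auto. }
rewrite RtoC_minus. replace (Ci * (RtoC (vartheta t) - RtoC (vartheta s)))%C
  with (Ci * RtoC (vartheta t) + - (Ci * RtoC (vartheta s)))%C by ring.
rewrite Cexp_plus.
transitivity ((cdir t * Cexp (Ci * RtoC (vartheta t))) * Cconj (cdir t) * Cexp (- (Ci * RtoC (vartheta s))))%C.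
- transitivity ((cdir t * Cconj (cdir t)) * Cexp (Ci * RtoC (vartheta t)) * Cexp (- (Ci * RtoC (vartheta s))))%C; [|ring].
  rewrite cdir_unit. ring.
- rewrite <- H.
  transitivity (cdir s * Cconj (cdir t) * (Cexp (Ci * RtoC (vartheta s)) * Cexp (- (Ci * RtoC (vartheta s)))))%C; [ring|].
  rewrite Cexp_opp. ring.
Qed.

Lemma cdir_neq_0 s : cdir s <> 0.
Proof.
intros E. pose proof (cdir_unit s) as H. rewrite E, Cmult_0_l in H. apply (f_equal Re) in H.
unfold Re in H. simpl in H. lra.
Qed.

Lemma C_div_R (x y N : R) : N <> 0 -> ((RtoC x + Ci * RtoC y) / RtoC N)%C = (x / N, y / N).
Proof.
intros HN. unfold Cdiv. rewrite <- RtoC_inv by auto. apply C_eq; unfold Re, Im; simpl; field; auto.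
Qed.

Lemma C_div_0 (z : C) : (z / RtoC 0)%C = 0.
Proof.
unfold Cdiv. replace (/ RtoC 0)%C with (RtoC 0); [ring|].
unfold Cinv, RtoC. simpl. unfold Rdiv. f_equal; ring.
Qed.

Lemma coef_iff (sg1 sg2 : R) : let N := sqrt (sg1 ^ 2 + sg2 ^ 2) in
  (RtoC a1 + Ci * RtoC a2)%C =
      (RtoC a3 * ((RtoC sg2 + Ci * RtoC sg1) / RtoC N) * Cexp (Ci * RtoC (vartheta 0)))%C <->
  (0 < N /\ sg1 / N = U 0 / crho 0 /\ sg2 / N = V 0 / crho 0).
Proof.
intros N.
assert (HN0 : 0 <= N) by apply sqrt_pos.
split.
- intros H. rewrite (cdir_eq 0) in H.
  assert (E : cdir 0 = ((RtoC sg2 + Ci * RtoC sg1) / RtoC N)%C).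
  { assert (Ha : RtoC a3 <> 0) by (intros E; apply RtoC_inj in E; lra).
    set (S := ((RtoC sg2 + Ci * RtoC sg1) / RtoC N)%C) in *.
    transitivity (RtoC a3 * cdir 0 * Cexp (Ci * RtoC (vartheta 0)) * Cexp (- (Ci * RtoC (vartheta 0))) / RtoC a3)%C.
    - transitivity (cdir 0 * (Cexp (Ci * RtoC (vartheta 0)) * Cexp (- (Ci * RtoC (vartheta 0)))))%C; [|field; auto].
      rewrite Cexp_opp. ring.
    - rewrite H.
      transitivity (S * (Cexp (Ci * RtoC (vartheta 0)) * Cexp (- (Ci * RtoC (vartheta 0)))))%C; [field; auto|].
      rewrite Cexp_opp. ring. }
  destruct HN0 as [HN0|HN0].
  (* For [N = 0] the quotient is 0 by convention while [cdir 0] has modulus 1; thus the equation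
     itself yields [0 < N]. *)
  2:{ exfalso. rewrite <- HN0, C_div_0 in E. now apply (cdir_neq_0 0). }
  rewrite C_div_R in E by lra. unfold cdir in E. injection E as E1 E2. auto.
- intros [HN [H1 H2]]. rewrite (cdir_eq 0), C_div_R by lra. unfold cdir. now rewrite H1, H2.
Qed.

Lemma rotation_iff (sg1 sg2 sg3 sg4 L : R) :
  let N := sqrt (sg1 ^ 2 + sg2 ^ 2) in let N' := sqrt (sg3 ^ 2 + sg4 ^ 2) in
  0 < N -> sg1 / N = U 0 / crho 0 -> sg2 / N = V 0 / crho 0 ->
  Cexp (Ci * RtoC (vartheta L - vartheta 0)) =
      ((RtoC sg1 - Ci * RtoC sg2) * (RtoC sg3 + Ci * RtoC sg4)
       / RtoC (sqrt ((sg1 ^ 2 + sg2 ^ 2) * (sg3 ^ 2 + sg4 ^ 2))))%C <->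
  (0 < N' /\ sg3 / N' = U L / crho L /\ sg4 / N' = V L / crho L).
Proof.
intros N N' HN H1 H2.
assert (HN0 : 0 <= N') by apply sqrt_pos.
assert (Hs1 : 0 <= sg1 ^ 2 + sg2 ^ 2) by (pose proof (pow2_ge_0 sg1); pose proof (pow2_ge_0 sg2); lra).
rewrite sqrt_mult_alt by auto. fold N N'. rewrite cdir_rotation.
(* sigma_1 - i sigma_2 is [-i] times (sigma_2 + i sigma_1), and sigma_3 + i sigma_4 is [i] times
   (sigma_4 - i sigma_3); the factors [-i] and [i] cancel. *)
assert (HR : 0 < N' -> ((RtoC sg1 - Ci * RtoC sg2) * (RtoC sg3 + Ci * RtoC sg4) / RtoC (N * N'))%C =
   (cdir 0 * ((sg4 / N')%R, (- (sg3 / N'))%R))%C).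
{ intros HN'. unfold cdir. rewrite <- H1, <- H2. unfold Cdiv. rewrite <- RtoC_inv by nra.
  apply C_eq; unfold Re, Im; simpl; field; lra. }
split.
- intros H. destruct HN0 as [HN0|HN0].
  + rewrite HR in H by auto.
    assert (E : Cconj (cdir L) = ((sg4 / N')%R, (- (sg3 / N'))%R)).
    { transitivity (Cconj (cdir 0) * (cdir 0 * Cconj (cdir L)))%C.
      - transitivity ((cdir 0 * Cconj (cdir 0)) * Cconj (cdir L))%C; [|ring]. rewrite cdir_unit. ring.
      - rewrite H. transitivity ((cdir 0 * Cconj (cdir 0)) * ((sg4 / N')%R, (- (sg3 / N'))%R))%C; [ring|]. rewrite cdir_unit. ring. }
    unfold cdir, Cconj in E. simpl in E. injection E as E1 E2. repeat split; lra.
  + exfalso. rewrite <- HN0, Rmult_0_r, C_div_0 in H.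
    apply (cdir_neq_0 0). transitivity (cdir 0 * (cdir L * Cconj (cdir L)))%C; [rewrite cdir_unit; ring|].
    transitivity (cdir L * (cdir 0 * Cconj (cdir L)))%C; [ring|]. rewrite H. ring.
- intros [HN' [H3 H4]]. rewrite HR by auto. f_equal. unfold cdir, Cconj. simpl. now rewrite H3, H4.
Qed.

Lemma angle_from_PQ (s co si : R) :
  cP k sstar a1 a2 a3 s = K s ^ 2 / 2 * si + K' s * co ->
  cQ k sstar a1 a2 a3 s = K s ^ 2 / 2 * co - K' s * si ->
  ccos k sstar a1 a2 a3 s = co /\ csin k sstar a1 a2 a3 s = si.
Proof.
intros HP HQ. pose proof (K_D k sstar hk s) as H. pose proof (kappa_sq_mu k sstar hk s) as HD. fold K in H, HD. fold K' in H.
unfold ccos, csin. fold K K'. rewrite HP, HQ, <- H. rewrite <- H in HD. split; field; lra.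
Qed.

(** The two linear hypotheses express [mu x] and [K 0 - mu y] by the angle; adding their squares
    eliminates the angle and gives the relation between the point and [K 0] that [endpoint_unique]
    asks for. *)
Lemma kappa_at_start (x y co si : R) : co ^ 2 + si ^ 2 = 1 -> 0 < y ->
  2 * mu k * y = 2 * K 0 + 2 * K' 0 * si - K 0 ^ 2 * co ->
  2 * mu k * x = K 0 ^ 2 * si + 2 * K' 0 * co ->
  (1 + mu k * (y ^ 2 + x ^ 2)) / (2 * y) = K 0.
Proof.
intros Hcs Hy H1 H2. pose proof (K_D k sstar hk 0) as H. fold K in H. fold K' in H.
pose proof (mu_pos k hk) as Hmu.
assert (E : (mu k * x) ^ 2 + (K 0 - mu k * y) ^ 2 = K 0 ^ 2 - mu k).
{ replace (mu k * x) with (K 0 ^ 2 / 2 * si + K' 0 * co) by lra.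
  replace (K 0 - mu k * y) with (K 0 ^ 2 / 2 * co - K' 0 * si) by lra.
  rewrite <- H. transitivity (((K 0 ^ 2 / 2) ^ 2 + K' 0 ^ 2) * (co ^ 2 + si ^ 2)); [ring|]. rewrite Hcs. ring. }
apply (Rmult_eq_reg_l (2 * y * mu k)); [|apply Rgt_not_eq, Rmult_lt_0_compat; lra].
transitivity (mu k * (1 + mu k * (y ^ 2 + x ^ 2))); [field; lra|]. lra.
Qed.

End Endpoints.

(** * Recovering L from kappa(L) and the sign of kappa'(L) *)

Section Phase.

Variables k sstar : R.
Hypothesis hk : 0 < k < 1.

Lemma sign1_cases z : (sign1 z = 1 /\ 0 <= z) \/ (sign1 z = -1 /\ z < 0).
Proof. unfold sign1. destruct (Rle_dec 0 z); [left|right]; split; lra. Qed.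

(** Reduce to [- K <= t < K]. For [0 < t] the derivative is strictly negative, so the sign is -1 and
    [t] is the value of [dn_inv]; for [t <= 0] the derivative is nonnegative, so the sign is 1 and
    [- t] is that value. *)
Lemma phase_exists L : exists l : Z,
  L = - sstar + sqrt (2 - k ^ 2) * (2 * IZR l * ellK k
     - sign1 (kappa' k sstar L) * dn_inv (sqrt (2 - k ^ 2) / 2 * kappa k sstar L) k).
Proof.
pose proof (sqrtm_pos k hk) as HM. pose proof (modulus_sq k hk) as Hk2.
unfold kappa, kappa'. set (M := sqrt (2 - k ^ 2)) in *. set (u := (L + sstar) / M).
replace (M / 2 * (2 / M * dn u k)) with (dn u k) by (field; lra).
assert (HL : L = - sstar + M * u) by (unfold u; field; lra).
destruct (period_reduce k hk u) as [l [t [Hu Ht]]].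
assert (Hd : dn u k = dn t k) by (rewrite Hu; now apply dn_shift_Z).
assert (Hd' : dn' k u = dn' k t) by (rewrite Hu; now apply dn'_shift_Z).
exists l. rewrite Hd, Hd'.
assert (E : t = - sign1 (2 / (2 - k ^ 2) * dn' k t) * dn_inv (dn t k) k); [|rewrite HL, Hu; rewrite E at 1; ring].
assert (Hc : 0 < 2 / (2 - k ^ 2)) by (apply Rdiv_lt_0_compat; lra).
pose proof (ellK_pos k hk) as HK.
destruct (Rlt_or_le 0 t) as [Hpos|Hneg].
- pose proof (dn'_quarter_lt k hk t ltac:(lra)) as Hn.
  destruct (sign1_cases (2 / (2 - k ^ 2) * dn' k t)) as [[-> H]|[-> H]]; [nra|].
  rewrite dn_inv_dn by (auto; lra). ring.
- pose proof (dn'_quarter k hk (- t) ltac:(lra)) as Hn. rewrite dn'_odd in Hn by auto.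
  destruct (sign1_cases (2 / (2 - k ^ 2) * dn' k t)) as [[-> H]|[-> H]]; [|nra].
  rewrite <- dn_even by auto. rewrite dn_inv_dn by (auto; lra). ring.
Qed.

(** Converse of [phase_exists]. Only a weak inequality comes out, since the derivative vanishes for
    [v = 0] and for [v = ellK k]. *)
Lemma phase_kappa (sg v L : R) (l : Z) : sg = 1 \/ sg = -1 ->
  0 <= v <= ellK k -> L = - sstar + sqrt (2 - k ^ 2) * (2 * IZR l * ellK k - sg * v) ->
  kappa k sstar L = 2 / sqrt (2 - k ^ 2) * dn v k /\ 0 <= sg * kappa' k sstar L.
Proof.
intros Hsg Hv HL. pose proof (sqrtm_pos k hk) as HM. pose proof (modulus_sq k hk) as Hk2.
unfold kappa, kappa'. set (M := sqrt (2 - k ^ 2)) in *.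
assert (Hu : (L + sstar) / M = 2 * IZR l * ellK k + - (sg * v)) by (rewrite HL; field; lra).
rewrite Hu, dn_shift_Z, dn'_shift_Z, dn_even, dn'_odd by auto.
pose proof (dn'_quarter k hk v Hv) as Hn.
assert (Hc : 0 < 2 / (2 - k ^ 2)) by (apply Rdiv_lt_0_compat; lra).
destruct Hsg as [-> | ->].
- split; [do 2 f_equal; ring|]. replace (1 * v) with v by ring. nra.
- replace (-1 * v) with (- v) by ring. rewrite dn_even, dn'_odd by auto. split; [reflexivity|]. nra.
Qed.

End Phase.

(** The two ends play different roles. At 0 the curvature is a datum, and the equations for [a3] and
    [b3] contain it. At [L] the expression [X] stands for kappa(L); the length equation makes the
    two equal, and only then do the last two equations yield the end point and the end angle. *)
Theorem theorem6 (A1 A2 B1 B2 phiA phiB : R) (hA : 0 < A2) (hB : 0 < B2)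
  (sstar k : R) (hk : 0 < k < 1)
  (vartheta : R -> R) (hvartheta : is_vartheta k sstar vartheta)
  (a1 a2 a3 b1 b2 b3 : R)
  (ha3 : a3 = sqrt (a1 ^ 2 + a2 ^ 2)) (ha3_pos : 0 < a3)
  (hb1 : b1 = b3 / a3 * a1 + 1 / (sqrt (mu k) * a3) * (- a2))
  (hb2 : b2 = b3 / a3 * a2 + 1 / (sqrt (mu k) * a3) * a1)
  (L : R) (hL : 0 < L) :
  let mu := mu k in
  let kappa0 := kappa k sstar 0 in
  let dkappa0 := Derive (kappa k sstar) 0 in
  let sigma1 := 1 / 2 * (1 - mu * (a3 ^ 2 * A2 ^ 2 + (a3 * A1 - b3) ^ 2)) in
  let sigma2 := sqrt mu * (A1 * a3 - b3) in
  let sigma3 := 1 / 2 * (1 - mu * (a3 ^ 2 * B2 ^ 2 + (a3 * B1 - b3) ^ 2)) in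
  let sigma4 := sqrt mu * (B1 * a3 - b3) in
  let X := (1 + mu * (B2 ^ 2 * a3 ^ 2 + (a3 * B1 - b3) ^ 2)) / (2 * B2 * a3) in
  let sigma :=
    sign1 (mu * (a3 * B1 - b3) * cos phiB
           - (1 + mu * (- a3 ^ 2 * B2 ^ 2 + (a3 * B1 - b3) ^ 2))
             / (2 * B2 * a3) * sin phiB) in
  solves_dirichlet A1 A2 B1 B2 phiA phiB L
    (elastica1 k sstar a1 a2 a3 b1 b2 b3)
    (elastica2 k sstar a1 a2 a3)
  <->
  exists l : Z,
    a3 = (2 * kappa0 + 2 * dkappa0 * sin phiA - kappa0 ^ 2 * cos phiA)
         / (2 * mu * A2) /\
    b3 = a3 * A1 - (kappa0 ^ 2 * sin phiA + 2 * dkappa0 * cos phiA)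
                   / (2 * mu) /\
    (RtoC a1 + Ci * RtoC a2)%C =
      (RtoC a3 * ((RtoC sigma2 + Ci * RtoC sigma1)
                  / RtoC (sqrt (sigma1 ^ 2 + sigma2 ^ 2)))
       * Cexp (Ci * RtoC (vartheta 0)))%C /\
    (RtoC b1 + Ci * RtoC b2)%C =
      ((RtoC (b3 / a3) + Ci / RtoC (sqrt mu * a3))
       * (RtoC a1 + Ci * RtoC a2))%C /\
    (sqrt (1 - k ^ 2) <= sqrt (2 - k ^ 2) / 2 * X <= 1 /\
     L = - sstar + sqrt (2 - k ^ 2)
                   * (2 * IZR l * ellK k
                      - sigma * dn_inv (sqrt (2 - k ^ 2) / 2 * X) k)) /\
    X ^ 2 = 2 * mu * (a3 * B1 - b3) * sin phiB
            + (1 + mu * (- B2 ^ 2 * a3 ^ 2 + (a3 * B1 - b3) ^ 2))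
              / (B2 * a3) * cos phiB /\
    Cexp (Ci * RtoC (vartheta L - vartheta 0)) =
      ((RtoC sigma1 - Ci * RtoC sigma2) * (RtoC sigma3 + Ci * RtoC sigma4)
       / RtoC (sqrt ((sigma1 ^ 2 + sigma2 ^ 2)
                     * (sigma3 ^ 2 + sigma4 ^ 2))))%C.
Proof.
intros m kappa0 dkappa0 sigma1 sigma2 sigma3 sigma4 X sigma.
rewrite (solves_dirichlet_iff k sstar hk vartheta hvartheta a1 a2 a3 b1 b2 b3 ha3 ha3_pos hb1 hb2).
pose proof (mu_pos k hk) as Hm. fold m in Hm.
assert (Hd : dkappa0 = kappa' k sstar 0) by (apply is_derive_unique; now apply kappa_derive).
set (xA := a3 * A1 - b3). set (yA := a3 * A2). set (xB := a3 * B1 - b3). set (yB := a3 * B2).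
assert (HyA : 0 < yA) by (apply Rmult_lt_0_compat; auto).
assert (HyB : 0 < yB) by (apply Rmult_lt_0_compat; auto).
assert (Es1 : sigma1 = 1 / 2 * (1 - m * (yA ^ 2 + xA ^ 2))) by (unfold sigma1, yA, xA; ring).
assert (Es2 : sigma2 = sqrt m * xA) by (unfold sigma2, xA; ring).
assert (Es3 : sigma3 = 1 / 2 * (1 - m * (yB ^ 2 + xB ^ 2))) by (unfold sigma3, yB, xB; ring).
assert (Es4 : sigma4 = sqrt m * xB) by (unfold sigma4, xB; ring).
assert (EX : X = (1 + m * (yB ^ 2 + xB ^ 2)) / (2 * yB)) by (unfold X, yB, xB; field; lra).
(* With [P = m xB] and [Q = X - m yB], dividing [Q + i P = (X^2 / 2 + i kappa') e^(i phi)] by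
   [e^(i phi)] gives [z = kappa'(L)] as imaginary part, which is the argument of [sigma], and the
   equation for [X ^ 2] as real part. *)
set (z := m * xB * cos phiB - (X - m * yB) * sin phiB).
assert (Esg : sigma = sign1 z).
{ unfold sigma, z. f_equal. unfold xB, yB, X. field. lra. }
assert (EX2 : 2 * m * xB * sin phiB + (1 + m * (- B2 ^ 2 * a3 ^ 2 + xB ^ 2)) / (B2 * a3) * cos phiB
   = 2 * (m * xB * sin phiB + (X - m * yB) * cos phiB)).
{ unfold xB, yB, X. field. lra. }
assert (E4 : (RtoC b1 + Ci * RtoC b2)%C = ((RtoC (b3 / a3) + Ci / RtoC (sqrt m * a3)) * (RtoC a1 + Ci * RtoC a2))%C).
{ pose proof (r_pos k hk) as Hr. fold m in Hr. fold m in hb1, hb2.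
  assert (sqrt m * a3 <> 0) by (apply Rgt_not_eq, Rmult_lt_0_compat; auto).
  unfold Cdiv. rewrite <- RtoC_inv by auto. rewrite hb1, hb2.
  apply C_eq; unfold Re, Im; simpl; field; lra. }
assert (Hmod : forall s, sqrt (2 - k ^ 2) / 2 * kappa k sstar s = dn ((s + sstar) / sqrt (2 - k ^ 2)) k).
{ intros s. unfold kappa. pose proof (sqrtm_pos k hk). field. lra. }
assert (HcsA : cos phiA ^ 2 + sin phiA ^ 2 = 1) by (pose proof (sin2_cos2 phiA) as H; unfold Rsqr in H; lra).
assert (HcsB : cos phiB ^ 2 + sin phiB ^ 2 = 1) by (pose proof (sin2_cos2 phiB) as H; unfold Rsqr in H; lra).
rewrite EX2, Hd.
split.
- intros [[HA1 [HA2 [HA3 HA4]]] [HB1 [HB2 [HB3 HB4]]]].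
  pose proof (cP_cs k sstar hk a1 a2 a3 0) as PA. pose proof (cQ_cs k sstar hk a1 a2 a3 0) as QA.
  pose proof (cP_cs k sstar hk a1 a2 a3 L) as PB. pose proof (cQ_cs k sstar hk a1 a2 a3 L) as QB.
  rewrite HA3, HA4 in PA, QA. rewrite HB3, HB4 in PB, QB.
  unfold cP, cQ in PA, QA, PB, QB. rewrite HA1 in PA. rewrite HA2 in QA. rewrite HB1 in PB. rewrite HB2 in QB.
  fold m kappa0 in PA, QA, PB, QB.
  destruct (endpoint_sigma k sstar hk vartheta hvartheta a1 a2 a3 ha3 ha3_pos 0) as [_ [NA [SA1 SA2]]].
  destruct (endpoint_sigma k sstar hk vartheta hvartheta a1 a2 a3 ha3 ha3_pos L) as [XB [NB [SB1 SB2]]].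
  rewrite HA1, HA2 in NA, SA1, SA2. rewrite HB1, HB2 in XB, NB, SB1, SB2.
  fold m in NA, SA1, SA2, XB, NB, SB1, SB2.
  rewrite <- Es1, <- Es2 in NA, SA1, SA2. rewrite <- Es3, <- Es4 in NB, SB1, SB2. rewrite <- EX in XB.
  assert (Hz : z = kappa' k sstar L).
  { unfold z. rewrite PB, XB, QB.
    transitivity (kappa' k sstar L * (cos phiB ^ 2 + sin phiB ^ 2)); [ring|]. rewrite HcsB. ring. }
  destruct (phase_exists k sstar hk L) as [l Hl]. exists l.
  split; [|split; [|split; [|split; [|split; [|split]]]]].
  + assert (E : 2 * m * yA = 2 * kappa0 + 2 * kappa' k sstar 0 * sin phiA - kappa0 ^ 2 * cos phiA) by lra.
    rewrite <- E. unfold yA. field. lra.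
  + assert (E : 2 * m * xA = kappa0 ^ 2 * sin phiA + 2 * kappa' k sstar 0 * cos phiA) by lra.
    rewrite <- E. unfold xA. field. lra.
  + apply (coef_iff k sstar hk vartheta hvartheta a1 a2 a3 ha3 ha3_pos). auto.
  + exact E4.
  + rewrite XB, Hmod. split; [now apply dn_bound|]. rewrite <- Hmod, Esg, Hz. exact Hl.
  + rewrite XB, PB, QB.
    transitivity (kappa k sstar L ^ 2 * (cos phiB ^ 2 + sin phiB ^ 2)); [rewrite HcsB; ring|field].
  + apply (rotation_iff k sstar hk vartheta hvartheta a1 a2 a3 ha3 ha3_pos); auto.
- intros [l [H1 [H2 [H3 [_ [[H5 H5'] [H6 H7]]]]]]].
  assert (EyA : 2 * m * yA = 2 * kappa0 + 2 * kappa' k sstar 0 * sin phiA - kappa0 ^ 2 * cos phiA).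
  { unfold yA. rewrite H1. field. lra. }
  assert (ExA : 2 * m * xA = kappa0 ^ 2 * sin phiA + 2 * kappa' k sstar 0 * cos phiA).
  { unfold xA. rewrite H2 at 1. field. lra. }
  apply (coef_iff k sstar hk vartheta hvartheta a1 a2 a3 ha3 ha3_pos) in H3.
  destruct H3 as [NA [SA1 SA2]].
  apply (rotation_iff k sstar hk vartheta hvartheta a1 a2 a3 ha3 ha3_pos) in H7; auto.
  destruct H7 as [NB [SB1 SB2]].
  pose proof (kappa_at_start k sstar hk xA yA (cos phiA) (sin phiA) HcsA HyA EyA ExA) as XA.
  destruct (dn_inv_spec k hk _ H5) as [Hv1 Hv2]. set (v := dn_inv (sqrt (2 - k ^ 2) / 2 * X) k) in *.
  pose proof (sqrtm_pos k hk) as HM.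
  assert (Hsg : sign1 z = 1 \/ sign1 z = -1) by (destruct (sign1_cases z) as [[]|[]]; auto).
  rewrite Esg in H5'.
  destruct (phase_kappa k sstar hk (sign1 z) v L l Hsg Hv1 H5') as [HKL HKL'].
  assert (XB : kappa k sstar L = X) by (rewrite HKL, Hv2; field; lra).
  assert (PA : cx k sstar a1 a2 a3 0 = xA /\ cy k sstar a1 a2 a3 0 = yA).
  { apply (endpoint_unique k sstar hk vartheta hvartheta a1 a2 a3 ha3 ha3_pos); auto; fold m; rewrite <- Es1, <- Es2; auto. }
  assert (PB : cx k sstar a1 a2 a3 L = xB /\ cy k sstar a1 a2 a3 L = yB).
  { apply (endpoint_unique k sstar hk vartheta hvartheta a1 a2 a3 ha3 ha3_pos); auto; fold m; rewrite <- ?Es3, <- ?Es4; auto.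
    rewrite XB. auto. }
  destruct PA as [PA1 PA2]. destruct PB as [PB1 PB2].
  assert (AA : ccos k sstar a1 a2 a3 0 = cos phiA /\ csin k sstar a1 a2 a3 0 = sin phiA).
  { apply (angle_from_PQ k sstar hk); unfold cP, cQ; rewrite ?PA1, ?PA2; fold m kappa0; lra. }
  assert (PQ : (m * xB) ^ 2 + (X - m * yB) ^ 2 = X ^ 2 - m).
  { pose proof (cPQ_sq k sstar hk vartheta hvartheta a1 a2 a3 ha3 ha3_pos L) as H.
    unfold cP, cQ in H. now rewrite PB1, PB2, XB in H. }
  assert (KD : (X ^ 2 / 2) ^ 2 + kappa' k sstar L ^ 2 = X ^ 2 - m).
  { rewrite <- XB. now apply K_D. }
  (* Both squares equal [X^2 - m - (X^2 / 2)^2]. The signs agree: [sigma] is the sign of [z], and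
     [phase_kappa] gives [sigma kappa'(L) >= 0]. *)
  assert (Hz : z = kappa' k sstar L).
  { assert (Hzz : z ^ 2 = kappa' k sstar L ^ 2).
    { assert (E : z ^ 2 + (X ^ 2 / 2) ^ 2 = X ^ 2 - m); [|lra].
      rewrite <- PQ.
      replace (X ^ 2 / 2) with (m * xB * sin phiB + (X - m * yB) * cos phiB) by lra. unfold z.
      transitivity (((m * xB) ^ 2 + (X - m * yB) ^ 2) * (cos phiB ^ 2 + sin phiB ^ 2)); [ring|]. rewrite HcsB. ring. }
    destruct (sign1_cases z) as [[E Hs]|[E Hs]]; rewrite E in HKL'; nra. }
  assert (AB : ccos k sstar a1 a2 a3 L = cos phiB /\ csin k sstar a1 a2 a3 L = sin phiB).
  { apply (angle_from_PQ k sstar hk); unfold cP, cQ; rewrite ?PB1, ?PB2, XB, <- Hz, H6; fold m; unfold z.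
    - transitivity (m * xB * (cos phiB ^ 2 + sin phiB ^ 2)); [rewrite HcsB; ring|field].
    - transitivity ((X - m * yB) * (cos phiB ^ 2 + sin phiB ^ 2)); [rewrite HcsB; ring|field]. }
  tauto.
Qed.
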